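(* For every $w\in G$, the functor $\mathrm{op}_w:\mathrm{Glob}\to\mathrm{Glob}$ together with the natural transformation $\mathrm{op}_w^T:T\,\mathrm{op}_w\Rightarrow\mathrm{op}_w\,T$ is a morphism of monads from $T$ to $T$, i.e. $\mathrm{op}_w^T\circ\eta\,\mathrm{op}_w=\mathrm{op}_w\,\eta$ and $\mathrm{op}_w^T\circ\mu\,\mathrm{op}_w=\mathrm{op}_w\,\mu\circ\mathrm{op}_w^TT\circ T\mathrm{op}_w^T$; it therefore induces an endofunctor $\mathrm{op}_w:\omega\mathrm{Cat}\to\omega\mathrm{Cat}$ sending $(X,\alpha)$ to $(\mathrm{op}_wX,\ \mathrm{op}_w\alpha\circ\mathrm{op}^T_{w,X})$. These endofunctors form an action of the group $G$ on the category $\omega\mathrm{Cat}$, i.e. $w\mapsto\mathrm{op}_w$ is a group homomorphism $G\to\mathrm{Aut}(\omega\mathrm{Cat})$. Moreover, for every $w\in G$ there is a natural isomorphism $\mathrm{op}_w^K:\mathrm{op}_w\,K^T\Rightarrow K^T\,\mathrm{op}_w:\mathrm{Comp}\to\omega\mathrm{Cat}$ whose underlying morphism of globular sets is $\mathrm{op}_w^{\mathrm{Cell}}:\mathrm{op}_w\,\mathrm{Cell}\Rightarrow\mathrm{Cell}\,\mathrm{op}_w$. In particular, if an $\omega$-category is free on a computad $C$, then its opposite with respect to $w$ is free on the opposite computad $\mathrm{op}_wC$.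
   Context: **Globular sets.** The category $\mathbb G$ of globes has objects $[n]$, $n\in\mathbb N$, and morphisms freely generated by $s_n,t_n:[n]\to[n+1]$ subject to $s_{n+1}s_n=t_{n+1}s_n$ and $s_{n+1}t_n=t_{n+1}t_n$. A globular set $X$ is a presheaf on $\mathbb G$: sets $X_n$ of $n$-cells and functions $\mathrm{src},\mathrm{tgt}:X_{n+1}\to X_n$ with $\mathrm{src}\,\mathrm{src}=\mathrm{src}\,\mathrm{tgt}$, $\mathrm{tgt}\,\mathrm{src}=\mathrm{tgt}\,\mathrm{tgt}$. Globular sets form the category $\mathrm{Glob}$. $\mathbb D^n$ is the globular set represented by $[n]$. A bipointed globular set $(X,x_-,x_+)$ is a globular set with two distinguished $0$-cells; with basepoint-preserving morphisms these form $\mathrm{Glob}^{\star\star}$. The wedge $X\vee Y$ of bipointed globular sets is the pushout of $X\xleftarrow{x_+}\mathbb D^0\xrightarrow{y_-}Y$ with basepoints the images of $x_-$ and $y_+$; $\bigvee_{i=1}^nX_i$ is the iterated wedge, with inclusions $\mathrm{in}_i:X_i\to\bigvee_iX_i$ (the empty wedge is $\mathbb D^0$ with both basepoints its unique $0$-cell). The suspension $\Sigma X$ of a globular set has $(\Sigma X)_0=\{v_-,v_+\}$, $(\Sigma X)_{n+1}=X_n$, source and target of cells of dimension $\ge2$ as in $X$, and every $1$-cell has source $v_-$ and target $v_+$; basepoints are $v_-,v_+$. **Batanin trees.** A Batanin tree is (inductively) a finite list $\mathrm{br}[B_1,\dots,B_n]$ of Batanin trees, $n\ge0$. Its dimension is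 $\dim\mathrm{br}[\,]=0$, $\dim\mathrm{br}[B_1,\dots,B_n]=\max_i(\dim B_i+1)$. Its bipointed globular set of positions is $\mathrm{Pos}(\mathrm{br}[B_1,\dots,B_n])=\bigvee_{i=1}^n\Sigma\mathrm{Pos}(B_i)$. The $k$-boundary is $\partial_0B=\mathrm{br}[\,]$, $\partial_{k+1}\mathrm{br}[B_1,\dots,B_n]=\mathrm{br}[\partial_kB_1,\dots,\partial_kB_n]$. The source and target inclusions $s_k^B,t_k^B:\mathrm{Pos}(\partial_kB)\to\mathrm{Pos}(B)$ are: $s_0^B,t_0^B$ pick the first and second basepoint; $s_{k+1}^B=\bigvee_i\Sigma s_k^{B_i}$, $t_{k+1}^B=\bigvee_i\Sigma t_k^{B_i}$ for $B=\mathrm{br}[B_1,\dots,B_n]$. **Computads.** By mutual recursion on $n$ one defines categories $\mathrm{Comp}_n$ of $n$-computads, forgetful functors $u_n:\mathrm{Comp}_n\to\mathrm{Comp}_{n-1}$, functors $\mathrm{Free}_n:\mathrm{Glob}\to\mathrm{Comp}_n$, $\mathrm{Cell}_n,\mathrm{Sph}_n:\mathrm{Comp}_n\to\mathrm{Set}$ and natural transformations $\mathrm{bdry}_n:\mathrm{Cell}_n\Rightarrow\mathrm{Sph}_{n-1}u_n$ and $\mathrm{pr}_1,\mathrm{pr}_2:\mathrm{Sph}_n\Rightarrow\mathrm{Cell}_n$. Base: $\mathrm{Comp}_{-1}$ is terminal and $\mathrm{Sph}_{-1}$ picks a one-element set. An $n$-computad is $C=(C_{n-1},V_n^C,\phi_n^C)$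 with $C_{n-1}$ an $(n-1)$-computad, $V_n^C$ a set (generators), $\phi_n^C:V_n^C\to\mathrm{Sph}_{n-1}(C_{n-1})$. A morphism $\sigma:C\to D$ is a pair $(\sigma_{n-1}:C_{n-1}\to D_{n-1},\ \sigma_V=\sigma_{n,V}:V_n^C\to\mathrm{Cell}_nD)$ with $\mathrm{bdry}_{n,D}\circ\sigma_V=\mathrm{Sph}_{n-1}(\sigma_{n-1})\circ\phi_n^C$; composition is $\sigma\circ\tau=(\sigma_{n-1}\tau_{n-1},\mathrm{Cell}_n(\sigma)\circ\tau_V)$, identities are $(\mathrm{id},\mathrm{var})$, and $u_n$ is projection. The set $\mathrm{Cell}_nC$ is inductively generated by: $\mathrm{var}\,v$ for $v\in V_n^C$; and, if $n>0$, coherence cells $\mathrm{coh}(B,A,\tau)$, where $B$ is a Batanin tree with $\dim B\le n$, $A\in\mathrm{Sph}_{n-1}(\mathrm{Free}_{n-1}\mathrm{Pos}(B))$ is full (see below) and $\tau:\mathrm{Free}_n\mathrm{Pos}(B)\to C$ is a morphism. Boundaries: $\mathrm{bdry}(\mathrm{var}\,v)=\phi_n^C(v)$, $\mathrm{bdry}(\mathrm{coh}(B,A,\tau))=\mathrm{Sph}_{n-1}(\tau_{n-1})(A)$. Action of $\sigma:C\to D$: $\mathrm{var}\,v\mapsto\sigma_V(v)$, $\mathrm{coh}(B,A,\tau)\mapsto\mathrm{coh}(B,A,\sigma\circ\tau)$. $\mathrm{Sph}_nC=\{(a,b)\in(\mathrm{Cell}_nC)^2:\mathrm{bdry}_na=\mathrm{bdry}_nb\}$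 with projections $\mathrm{pr}_1,\mathrm{pr}_2$. $\mathrm{Free}_nX=(\mathrm{Free}_{n-1}X,X_n,x\mapsto(\mathrm{var}(\mathrm{src}\,x),\mathrm{var}(\mathrm{tgt}\,x)))$, acting on $f$ by $(\mathrm{Free}_{n-1}f,\mathrm{var}\circ f_n)$. Support of a cell: $\mathrm{supp}(\mathrm{var}\,v)=\{v\}$ if $n=0$ and $\{v\}\cup\mathrm{supp}(\mathrm{pr}_1\phi_n^C(v))\cup\mathrm{supp}(\mathrm{pr}_2\phi_n^C(v))$ if $n>0$; $\mathrm{supp}(\mathrm{coh}(B,A,\tau))=\bigcup_{k\le n}\bigcup_{p\in\mathrm{Pos}(B)_k}\mathrm{supp}(\tau_{k,V}(p))$. A sphere $(a,b)\in\mathrm{Sph}_n(\mathrm{Free}_n\mathrm{Pos}(B))$ is full if $a=\mathrm{Cell}_n\mathrm{Free}_n(s_n^B)(a')$ and $b=\mathrm{Cell}_n\mathrm{Free}_n(t_n^B)(b')$ for $n$-cells $a',b'$ of $\mathrm{Free}_n\mathrm{Pos}(\partial_nB)$ whose supports contain all positions of $\partial_nB$. $\mathrm{Comp}$ is the limit of the $\mathrm{Comp}_n$: a computad is a sequence $C=(C_n)_n$ with $u_{n+1}C_{n+1}=C_n$. $\mathrm{Free}:\mathrm{Glob}\to\mathrm{Comp}$ has components $\mathrm{Free}_n$; $\mathrm{Cell}:\mathrm{Comp}\to\mathrm{Glob}$ sends $C$ to the globular set with $n$-cells $\mathrm{Cell}_nC_n$, and source and target the projections of $\mathrm{bdry}$.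 $\mathrm{Free}\dashv\mathrm{Cell}$ with unit $\eta(x)=\mathrm{var}\,x$ and counit $\varepsilon_C:\mathrm{Free}\,\mathrm{Cell}\,C\to C$ given on generators by the identities $V_n^{\mathrm{Free}\,\mathrm{Cell}\,C}=\mathrm{Cell}_nC$. Let $T=\mathrm{Cell}\,\mathrm{Free}$ with its induced monad structure $(T,\mu,\eta)$. An (weak) $\omega$-category is a $T$-algebra; they form $\omega\mathrm{Cat}$. The comparison functor $K^T:\mathrm{Comp}\to\omega\mathrm{Cat}$ is $C\mapsto(\mathrm{Cell}\,C,\mathrm{Cell}\,\varepsilon_C)$; an $\omega$-category is free on a computad $C$ if it is isomorphic to $K^TC$. **Opposites of globular sets and trees.** $G=\mathcal P(\mathbb N_{>0})\cong\mathbb Z_2^{\mathbb N_{>0}}$ is the group of subsets of the positive integers under symmetric difference (written $ww'$); $w$ is identified with its indicator function, and $w-1\in G$ is given by $(w-1)(n)=w(n+1)$. For $w\in G$, $\mathrm{op}_wX$ is the globular set with the same cells as $X$ and with source and target of $n$-cells exchanged exactly when $n\in w$. For bipointed globular sets, $\mathrm{op}_w(X,x_-,x_+)$ is $\mathrm{op}_wX$ with the same basepoints if $1\notin w$ and with swapped basepoints if $1\in w$. Let $\mathrm{swap}_0$ be the identity on lists and $\mathrm{swap}_1$ list reversal. The natural isomorphism $\mathrm{op}_w^\Sigma:\Sigma\,\mathrm{op}_{w-1}\Rightarrow\mathrm{op}_w\Sigma$ is the identity on positive-dimensional cells, and on $0$-cells it is the identity if $1\notin w$ and swaps $v_-,v_+$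 if $1\in w$. The natural isomorphism $\mathrm{op}_w^\vee:\bigvee_{i=1}^n\mathrm{swap}_{w(1)}(\mathrm{op}_wX_1,\dots,\mathrm{op}_wX_n)\to\mathrm{op}_w(\bigvee_{i=1}^nX_i)$ is the one compatible with the inclusions of each $\mathrm{op}_wX_i$. The opposite tree is $\mathrm{op}_w\mathrm{br}[B_1,\dots,B_n]=\mathrm{br}(\mathrm{swap}_{w(1)}[\mathrm{op}_{w-1}B_1,\dots,\mathrm{op}_{w-1}B_n])$, and the isomorphism $\mathrm{op}_w^B:\mathrm{Pos}(\mathrm{op}_wB)\to\mathrm{op}_w\mathrm{Pos}(B)$ is defined recursively as the composite $\mathrm{Pos}(\mathrm{op}_wB)=\bigvee\mathrm{swap}_{w(1)}(\Sigma\mathrm{Pos}(\mathrm{op}_{w-1}B_i))\to\bigvee\mathrm{swap}_{w(1)}(\Sigma\,\mathrm{op}_{w-1}\mathrm{Pos}(B_i))\to\bigvee\mathrm{swap}_{w(1)}(\mathrm{op}_w\Sigma\mathrm{Pos}(B_i))\to\mathrm{op}_w(\bigvee\Sigma\mathrm{Pos}(B_i))$ of the maps induced by $\Sigma\,\mathrm{op}_{w-1}^{B_i}$, then $\mathrm{op}_w^\Sigma$, then $\mathrm{op}_w^\vee$. **Opposites of computads.** Fix $w\in G$ (omitted where clear). Functors $\mathrm{op}:\mathrm{Comp}_n\to\mathrm{Comp}_n$ and natural transformations $\mathrm{op}^{\mathrm{Cell}}:\mathrm{Cell}_n\Rightarrow\mathrm{Cell}_n\mathrm{op}$, $\mathrm{op}^{\mathrm{Sph}}:\mathrm{Sph}_n\Rightarrow\mathrm{Sph}_n\mathrm{op}$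 are defined recursively (identities for $n=-1$): $\mathrm{op}\,C=(\mathrm{op}\,C_{n-1},V_n^C,\mathrm{op}^{\mathrm{Sph}}\circ\phi_n^C)$; $\mathrm{op}(\sigma)=(\mathrm{op}\,\sigma_{n-1},\mathrm{op}^{\mathrm{Cell}}\circ\sigma_V)$; $\mathrm{op}^{\mathrm{Cell}}(\mathrm{var}\,v)=\mathrm{var}\,v$; $\mathrm{op}^{\mathrm{Cell}}(\mathrm{coh}(B,A,\tau))=\mathrm{coh}(\mathrm{op}\,B,A',\mathrm{op}(\tau)\circ\mathrm{Free}_n(\mathrm{op}^B))$ with $A'=\mathrm{Sph}_{n-1}\mathrm{Free}_{n-1}((\mathrm{op}^B)^{-1})(\mathrm{op}^{\mathrm{Sph}}A)$; and $\mathrm{op}^{\mathrm{Sph}}(a,b)=(\mathrm{op}^{\mathrm{Cell}}b,\mathrm{op}^{\mathrm{Cell}}a)$ if $n+1\in w$, $=(\mathrm{op}^{\mathrm{Cell}}a,\mathrm{op}^{\mathrm{Cell}}b)$ otherwise, for $(a,b)\in\mathrm{Sph}_nC$. (These are well defined and $\mathrm{op}\,\mathrm{Free}_n=\mathrm{Free}_n\mathrm{op}$.) They assemble to functors $\mathrm{op}_w:\mathrm{Comp}\to\mathrm{Comp}$, $\mathrm{op}_w(C_n)_n=(\mathrm{op}_wC_n)_n$, with $\mathrm{op}_w\mathrm{Free}=\mathrm{Free}\,\mathrm{op}_w$, and to natural isomorphisms $\mathrm{op}_w^{\mathrm{Cell}}:\mathrm{op}_w\mathrm{Cell}\Rightarrow\mathrm{Cell}\,\mathrm{op}_w$.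 Define $\mathrm{op}_w^T=(\mathrm{op}_w^{\mathrm{Cell}}\mathrm{Free})^{-1}:T\,\mathrm{op}_w\Rightarrow\mathrm{op}_wT$. *)

(* Defs.v *)
From Stdlib Require Import List Arith Lia Bool.
From Stdlib Require Import FunctionalExtensionality ProofIrrelevance.
From Stdlib Require Import ClassicalEpsilon.
Import ListNotations.

Set Implicit Arguments.
Unset Strict Implicit.
Unset Printing Implicit Defensive.

(** Types play the role of sets: proof irrelevance and functional
    extensionality are available throughout, and equality of morphisms and of
    functors is Leibniz equality. *)

Record Category := {
  Ob :> Type;
  Hom : Ob -> Ob -> Type;
  idm : forall x, Hom x x;
  cmp : forall x y z, Hom y z -> Hom x y -> Hom x z;
  cmp_idl : forall x y (f : Hom x y), cmp (idm y) f = f;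
  cmp_idr : forall x y (f : Hom x y), cmp f (idm x) = f;
  cmpA : forall x y z t (h : Hom z t) (g : Hom y z) (f : Hom x y),
    cmp h (cmp g f) = cmp (cmp h g) f
}.

Arguments Hom {_} _ _.
Arguments idm {_} x.
Arguments cmp {_ x y z} _ _.
Notation "g ∘ f" := (cmp g f) (at level 40, left associativity).

Record Functor (C D : Category) := {
  fob :> C -> D;
  fmap : forall x y, Hom x y -> Hom (fob x) (fob y);
  fmap_id : forall x, fmap (idm x) = idm (fob x);
  fmap_cmp : forall x y z (g : Hom y z) (f : Hom x y),
    fmap (g ∘ f) = fmap g ∘ fmap f
}.

Arguments fmap {C D} _ {x y} _.

Definition idF (C : Category) : Functor C C :=
  {| fob := fun x : C => x;
     fmap := fun x y f => f;
     fmap_id := fun x => eq_refl;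
     fmap_cmp := fun x y z g f => eq_refl |}.

Lemma compF_id C D E (G : Functor D E) (F : Functor C D) x :
  fmap G (fmap F (idm x)) = idm (G (F x)).
Proof. now rewrite !fmap_id. Qed.

Lemma compF_cmp C D E (G : Functor D E) (F : Functor C D)
    x y z (g : Hom y z) (f : Hom x y) :
  fmap G (fmap F (g ∘ f)) = fmap G (fmap F g) ∘ fmap G (fmap F f).
Proof. now rewrite !fmap_cmp. Qed.

Definition compF C D E (G : Functor D E) (F : Functor C D) : Functor C E :=
  {| fob := fun x => G (F x);
     fmap := fun x y f => fmap G (fmap F f);
     fmap_id := compF_id G F;
     fmap_cmp := compF_cmp G F |}.

Notation "G ∘F F" := (compF G F) (at level 40, left associativity).

Record NatTrans C D (F G : Functor C D) := {
  ncomp :> forall x, Hom (F x) (G x);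
  ncomp_nat : forall x y (f : Hom x y), ncomp y ∘ fmap F f = fmap G f ∘ ncomp x
}.

Notation "F ⇒ G" := (NatTrans F G) (at level 70, no associativity).

Definition inverse_of (C : Category) (x y : C) (f : Hom x y) (g : Hom y x) : Prop :=
  g ∘ f = idm x /\ f ∘ g = idm y.

Definition is_iso (C : Category) (x y : C) (f : Hom x y) : Prop :=
  exists g, inverse_of f g.

Definition isomorphic (C : Category) (x y : C) : Prop :=
  exists f : Hom x y, is_iso f.

Definition inv (C : Category) (x y : C) (f : Hom x y) (h : is_iso f) : Hom y x :=
  proj1_sig (constructive_indefinite_description _ h).

Definition is_nat_iso C D (F G : Functor C D) (a : F ⇒ G) : Prop :=
  forall x, is_iso (a x).

Definition eq_to_hom (C : Category) (x y : C) (e : x = y) : Hom x y :=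
  match e with eq_refl => idm x end.

Definition SetCat : Category :=
  {| Ob := Type;
     Hom := fun A B => A -> B;
     idm := fun A a => a;
     cmp := fun A B C g f a => g (f a);
     cmp_idl := fun A B f => eq_refl;
     cmp_idr := fun A B f => eq_refl;
     cmpA := fun A B C D h g f => eq_refl |}.

Lemma inv_l (C : Category) (x y : C) (f : Hom x y) (h : is_iso f) : inv h ∘ f = idm x.
Proof. exact (proj1 (proj2_sig (constructive_indefinite_description _ h))). Qed.

Lemma inv_r (C : Category) (x y : C) (f : Hom x y) (h : is_iso f) : f ∘ inv h = idm y.
Proof. exact (proj2 (proj2_sig (constructive_indefinite_description _ h))). Qed.

Lemma is_iso_id (C : Category) (x : C) : is_iso (idm x).
Proof. exists (idm x); split; apply cmp_idl. Qed.

Lemma is_iso_cmp (C : Category) (x y z : C) (g : Hom y z) (f : Hom x y) :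
  is_iso g -> is_iso f -> is_iso (g ∘ f).
Proof.
  intros [g' [Hg1 Hg2]] [f' [Hf1 Hf2]]; exists (f' ∘ g'); split.
  - now rewrite cmpA, <- (cmpA f'), Hg1, cmp_idr.
  - now rewrite cmpA, <- (cmpA g), Hf2, cmp_idr.
Qed.

Lemma is_iso_fmap (C D : Category) (F : Functor C D) (x y : C) (f : Hom x y) :
  is_iso f -> is_iso (fmap F f).
Proof.
  intros [g [H1 H2]]; exists (fmap F g).
  split; rewrite <- fmap_cmp, ?H1, ?H2; apply fmap_id.
Qed.

Lemma fmap_square (C D : Category) (F : Functor C D) (x y y' z : C)
    (g : Hom y z) (f : Hom x y) (k : Hom y' z) (h : Hom x y') :
  g ∘ f = k ∘ h -> fmap F g ∘ fmap F f = fmap F k ∘ fmap F h.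
Proof. intros E; now rewrite <- !fmap_cmp, E. Qed.

Lemma fmap_retract (C D : Category) (F : Functor C D) (x y : C)
    (g : Hom y x) (f : Hom x y) :
  g ∘ f = idm x -> fmap F g ∘ fmap F f = idm (F x).
Proof. intros E; rewrite <- !fmap_cmp, E; apply fmap_id. Qed.

Lemma is_iso_eq_to_hom (C : Category) (x y : C) (e : x = y) : is_iso (eq_to_hom e).
Proof. destruct e; apply is_iso_id. Qed.

Lemma eq_to_hom_sym_l (C : Category) (x y : C) (e : x = y) :
  eq_to_hom (eq_sym e) ∘ eq_to_hom e = idm x.
Proof. destruct e; apply cmp_idl. Qed.

Lemma eq_to_hom_sym_r (C : Category) (x y : C) (e : x = y) :
  eq_to_hom e ∘ eq_to_hom (eq_sym e) = idm y.
Proof. destruct e; apply cmp_idl. Qed.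

Lemma fmap_eq_to_hom (C D : Category) (F : Functor C D) (x y : C) (e : x = y) :
  fmap F (eq_to_hom e) = eq_to_hom (f_equal (fob F) e).
Proof. destruct e; apply fmap_id. Qed.

Lemma nat_trans_inv_nat C D (F G : Functor C D) (a : F ⇒ G) (h : is_nat_iso a)
    x y (f : Hom x y) :
  inv (h y) ∘ fmap G f = fmap F f ∘ inv (h x).
Proof.
  rewrite <- (cmp_idr (fmap G f)), <- (inv_r (h x)), (cmpA (fmap G f)),
    <- ncomp_nat, <- !cmpA, (cmpA (inv (h y))), inv_l.
  now rewrite cmp_idl.
Qed.

Definition nat_inv C D (F G : Functor C D) (a : F ⇒ G) (h : is_nat_iso a) : G ⇒ F :=
  {| ncomp := fun x => inv (h x); ncomp_nat := nat_trans_inv_nat h |}.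

Record Monad (C : Category) := {
  mT :> Functor C C;
  mη : idF C ⇒ mT;
  mμ : mT ∘F mT ⇒ mT;
  m_unit_l : forall x, mμ x ∘ mη (mT x) = idm (mT x);
  m_unit_r : forall x, mμ x ∘ fmap mT (mη x) = idm (mT x);
  m_assoc : forall x, mμ x ∘ mμ (mT x) = mμ x ∘ fmap mT (mμ x)
}.

Section Algebras.
Context (C : Category) (T : Monad C).

Record Algebra := {
  acar :> C;
  astr : Hom (T acar) acar;
  astr_unit : astr ∘ mη T acar = idm acar;
  astr_mult : astr ∘ mμ T acar = astr ∘ fmap T astr
}.

Record AlgHom (X Y : Algebra) := {
  ahom :> Hom (acar X) (acar Y);
  ahom_str : ahom ∘ astr X = astr Y ∘ fmap T ahom
}.

Lemma AlgHom_eq (X Y : Algebra) (f g : AlgHom X Y) : ahom f = ahom g -> f = g.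
Proof.
  destruct f as [f Hf], g as [g Hg]; simpl; intros <-; f_equal; apply proof_irrelevance.
Qed.

Definition alg_id (X : Algebra) : AlgHom X X.
Proof.
  exists (idm (acar X)). abstract (now rewrite fmap_id, cmp_idl, cmp_idr).
Defined.

Definition alg_cmp (X Y Z : Algebra) (g : AlgHom Y Z) (f : AlgHom X Y) : AlgHom X Z.
Proof.
  exists (ahom g ∘ ahom f).
  abstract (rewrite fmap_cmp, <- cmpA, ahom_str, !cmpA; f_equal; apply ahom_str).
Defined.

Definition AlgCat : Category.
Proof.
  refine {| Ob := Algebra; Hom := AlgHom; idm := alg_id; cmp := alg_cmp |}.
  - abstract (intros; apply AlgHom_eq, cmp_idl).
  - abstract (intros; apply AlgHom_eq, cmp_idr).
  - abstract (intros; apply AlgHom_eq, cmpA).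
Defined.

End Algebras.

(** [(F, ψ)] is a morphism of monads from [T] to [S]. *)
Definition monad_morphism C D (T : Monad C) (S : Monad D)
    (F : Functor C D) (ψ : S ∘F F ⇒ F ∘F T) : Prop :=
  (forall x, ψ x ∘ mη S (F x) = fmap F (mη T x)) /\
  (forall x, ψ x ∘ mμ S (F x) = fmap F (mμ T x) ∘ ψ (T x) ∘ fmap S (ψ x)).

Section Induced.
Context C D (T : Monad C) (S : Monad D) (F : Functor C D) (ψ : S ∘F F ⇒ F ∘F T)
  (H : monad_morphism ψ).

Lemma induced_unit (X : Algebra T) :
  fmap F (astr X) ∘ ψ (acar X) ∘ mη S (F (acar X)) = idm (F (acar X)).
Proof.
  rewrite <- cmpA, (proj1 H). exact (fmap_retract F (astr_unit X)).
Qed.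

Lemma induced_mult (X : Algebra T) :
  fmap F (astr X) ∘ ψ (acar X) ∘ mμ S (F (acar X)) =
  fmap F (astr X) ∘ ψ (acar X) ∘ fmap S (fmap F (astr X) ∘ ψ (acar X)).
Proof.
  rewrite <- cmpA, (proj2 H), fmap_cmp, !cmpA.
  rewrite (fmap_square F (astr_mult X)).
  rewrite <- !cmpA; f_equal; rewrite !cmpA; f_equal.
  symmetry; apply (ncomp_nat ψ (astr X)).
Qed.

Definition induced_ob (X : AlgCat T) : AlgCat S :=
  {| acar := F (acar X);
     astr := fmap F (astr X) ∘ ψ (acar X);
     astr_unit := induced_unit X;
     astr_mult := induced_mult X |}.

Definition induced_hom (X Y : AlgCat T) (f : Hom X Y) : Hom (induced_ob X) (induced_ob Y).
Proof.
  exists (fmap F (ahom f)).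
  abstract (simpl; rewrite cmpA, (fmap_square F (ahom_str f)), <- !cmpA; f_equal;
    symmetry; apply (ncomp_nat ψ (ahom f))).
Defined.

Definition induced : Functor (AlgCat T) (AlgCat S).
Proof.
  refine {| fob := induced_ob : AlgCat T -> AlgCat S; fmap := induced_hom |}.
  - abstract (intros; apply AlgHom_eq, fmap_id).
  - abstract (intros; apply AlgHom_eq, fmap_cmp).
Defined.

End Induced.

Record Adjunction (C D : Category) (L : Functor C D) (R : Functor D C) := {
  adj_unit : idF C ⇒ R ∘F L;
  adj_counit : L ∘F R ⇒ idF D;
  adj_triL : forall x, adj_counit (L x) ∘ fmap L (adj_unit x) = idm (L x);
  adj_triR : forall y, fmap R (adj_counit y) ∘ adj_unit (R y) = idm (R y)
}.

Section AdjunctionMonad.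
Context (C D : Category) (L : Functor C D) (R : Functor D C) (A : Adjunction L R).

Definition adj_mult : (R ∘F L) ∘F (R ∘F L) ⇒ R ∘F L.
Proof.
  exists (fun x => fmap R (adj_counit A (L x))).
  abstract (intros x y f; exact (fmap_square R (ncomp_nat (adj_counit A) (fmap L f)))).
Defined.

Definition adj_monad : Monad C.
Proof.
  refine {| mT := R ∘F L; mη := adj_unit A; mμ := adj_mult |}.
  - abstract (intros x; apply (adj_triR A)).
  - abstract (intros x; exact (fmap_retract R (adj_triL A x))).
  - abstract (intros x;
      exact (fmap_square R (eq_sym (ncomp_nat (adj_counit A) (adj_counit A (L x)))))).
Defined.

Definition comparison_ob (y : D) : AlgCat adj_monad.
Proof.
  refine {| acar := R y; astr := fmap R (adj_counit A y) : Hom (adj_monad (R y)) (R y) |}.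
  - abstract (apply adj_triR).
  - abstract (exact (fmap_square R (eq_sym (ncomp_nat (adj_counit A) (adj_counit A y))))).
Defined.

Definition comparison_hom (y z : D) (f : Hom y z) :
  Hom (comparison_ob y) (comparison_ob z).
Proof.
  exists (fmap R f).
  abstract (exact (fmap_square R (eq_sym (ncomp_nat (adj_counit A) f)))).
Defined.

Definition comparison : Functor D (AlgCat adj_monad).
Proof.
  refine {| fob := comparison_ob : D -> AlgCat adj_monad; fmap := comparison_hom |}.
  - abstract (intros; apply AlgHom_eq, fmap_id).
  - abstract (intros; apply AlgHom_eq, fmap_cmp).
Defined.

End AdjunctionMonad.

Record Group := {
  gcar :> Type;
  gmul : gcar -> gcar -> gcar;
  gone : gcar;
  ginv : gcar -> gcar;
  gmulA : forall x y z, gmul x (gmul y z) = gmul (gmul x y) z;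
  gmul1 : forall x, gmul gone x = x;
  gmulV : forall x, gmul (ginv x) x = gone
}.

Definition is_group_hom (G H : Group) (h : G -> H) : Prop :=
  forall x y, h (gmul x y) = gmul (h x) (h y).

Record Automorphism (C : Category) := {
  aut_fun :> Functor C C;
  aut_inv : Functor C C;
  aut_invl : aut_inv ∘F aut_fun = idF C;
  aut_invr : aut_fun ∘F aut_inv = idF C
}.

Lemma functor_ext_strict C D (F G : Functor C D)
  (e : fob F = fob G)
  (h : forall x y (f : Hom x y),
     eq_rect (fob F) (fun o => Hom (o x) (o y)) (fmap F f) (fob G) e = fmap G f) :
  F = G.
Proof.
  destruct F as [o m i c], G as [o' m' i' c']; simpl in *; destruct e; simpl in h.
  assert (E : m = m') by (do 3 (apply functional_extensionality_dep; intro); apply h).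
  destruct E; f_equal; apply proof_irrelevance.
Qed.

Lemma compFA C D E B (H : Functor E B) (G : Functor D E) (F : Functor C D) :
  H ∘F (G ∘F F) = (H ∘F G) ∘F F.
Proof. now apply (@functor_ext_strict _ _ (H ∘F (G ∘F F)) ((H ∘F G) ∘F F) eq_refl). Qed.

Lemma compF_idl C D (F : Functor C D) : idF D ∘F F = F.
Proof. now apply (@functor_ext_strict _ _ (idF D ∘F F) F eq_refl). Qed.

Lemma compF_idr C D (F : Functor C D) : F ∘F idF C = F.
Proof. now apply (@functor_ext_strict _ _ (F ∘F idF C) F eq_refl). Qed.

Lemma Automorphism_eq C (F G : Automorphism C) :
  aut_fun F = aut_fun G -> F = G.
Proof.
  intros e.
  assert (e' : aut_inv F = aut_inv G).
  { rewrite <- (compF_idr (aut_inv F)), <- (aut_invr G), <- e, compFA, aut_invl.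
    apply compF_idl. }
  destruct F, G; simpl in *; subst; f_equal; apply proof_irrelevance.
Qed.

Definition aut_cmp C (F G : Automorphism C) : Automorphism C.
Proof.
  refine {| aut_fun := aut_fun F ∘F aut_fun G; aut_inv := aut_inv G ∘F aut_inv F |}.
  - abstract (rewrite compFA, <- (compFA (aut_inv G)), aut_invl, compF_idr; apply aut_invl).
  - abstract (rewrite compFA, <- (compFA (aut_fun F)), aut_invr, compF_idr; apply aut_invr).
Defined.

Definition Aut (C : Category) : Group.
Proof.
  refine {| gcar := Automorphism C;
            gmul := @aut_cmp C;
            gone := {| aut_fun := idF C; aut_inv := idF C;
                       aut_invl := compF_idl _; aut_invr := compF_idl _ |};
            ginv := fun F => {| aut_fun := aut_inv F; aut_inv := aut_fun F;
                                aut_invl := aut_invr F; aut_invr := aut_invl F |} |}.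
  - abstract (intros; apply Automorphism_eq, compFA).
  - abstract (intros; apply Automorphism_eq, compF_idl).
  - abstract (intros; apply Automorphism_eq, aut_invl).
Defined.

Record Glob := {
  gcell :> nat -> Type;
  src : forall n, gcell (S n) -> gcell n;
  tgt : forall n, gcell (S n) -> gcell n;
  src_src : forall n (x : gcell (S (S n))), src (src x) = src (tgt x);
  tgt_src : forall n (x : gcell (S (S n))), tgt (src x) = tgt (tgt x)
}.

Record GMap (X Y : Glob) := {
  gmap :> forall n, X n -> Y n;
  gmap_src : forall n (x : X (S n)), gmap (src x) = src (gmap x);
  gmap_tgt : forall n (x : X (S n)), gmap (tgt x) = tgt (gmap x)
}.

Lemma GMap_eq (X Y : Glob) (f g : GMap X Y) : (forall n x, f n x = g n x) -> f = g.
Proof.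
  destruct f as [f f1 f2], g as [g g1 g2]; simpl; intros E.
  assert (f = g) by (do 2 (apply functional_extensionality_dep; intro); apply E).
  subst; f_equal; apply proof_irrelevance.
Qed.

Definition gid (X : Glob) : GMap X X :=
  {| gmap := fun n x => x;
     gmap_src := fun n x => eq_refl;
     gmap_tgt := fun n x => eq_refl |}.

Definition gcmp (X Y Z : Glob) (g : GMap Y Z) (f : GMap X Y) : GMap X Z.
Proof.
  exists (fun n x => g n (f n x)).
  - abstract (intros; now rewrite !gmap_src).
  - abstract (intros; now rewrite !gmap_tgt).
Defined.

Canonical GLOB : Category.
Proof.
  refine {| Ob := Glob; Hom := GMap; idm := gid; cmp := gcmp |};
    abstract (intros; now apply GMap_eq).
Defined.

Record BGlob := { bglob :> Glob; bminus : bglob 0; bplus : bglob 0 }.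

Record BMap (X Y : BGlob) := {
  bmap :> GMap X Y;
  bmap_minus : bmap 0 (bminus X) = bminus Y;
  bmap_plus : bmap 0 (bplus X) = bplus Y
}.

Lemma BMap_eq (X Y : BGlob) (f g : BMap X Y) : (forall n x, f n x = g n x) -> f = g.
Proof.
  intros E; apply GMap_eq in E; destruct f, g; simpl in E; subst.
  f_equal; apply proof_irrelevance.
Qed.

Definition bid (X : BGlob) : BMap X X :=
  {| bmap := gid X; bmap_minus := eq_refl; bmap_plus := eq_refl |}.

Definition bcmp (X Y Z : BGlob) (g : BMap Y Z) (f : BMap X Y) : BMap X Z.
Proof.
  exists (gcmp g f).
  - abstract (simpl; now rewrite !bmap_minus).
  - abstract (simpl; now rewrite !bmap_plus).
Defined.

Canonical BGLOB : Category.
Proof.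
  refine {| Ob := BGlob; Hom := BMap; idm := bid; cmp := bcmp |};
    abstract (intros; now apply BMap_eq).
Defined.

(** The globe [D^0]: in the category of globes the only morphism into [[0]] is
    the identity. *)
Definition D0cell (n : nat) : Type := match n with 0 => unit | S _ => Empty_set end.

Definition D0g : Glob.
Proof.
  refine {| gcell := D0cell;
            src := fun n (x : D0cell (S n)) => match x with end;
            tgt := fun n (x : D0cell (S n)) => match x with end |};
    abstract (intros n []).
Defined.

Definition D0 : BGlob := {| bglob := D0g; bminus := tt; bplus := tt |}.

Definition pick (X : Glob) (x : X 0) : GMap D0 X.
Proof.
  refine {| gmap := fun n => match n return D0 n -> X n with
                             | 0 => fun _ => x
                             | S _ => fun z => match z with end
                             end |};
    abstract (intros n []).
Defined.

(** The pushout of [X <-(bplus X)- D0 -(bminus Y)-> Y]: the [0]-cells are those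
    of [X] other than [bplus X] together with those of [Y]. *)

Section Wedge.
Context (X Y : BGlob).

Definition wcell (n : nat) : Type :=
  match n with
  | 0 => {x : X 0 | x <> bplus X} + Y 0
  | S n => X (S n) + Y (S n)
  end.

Definition win1 (n : nat) : X n -> wcell n :=
  match n with
  | 0 => fun x => match excluded_middle_informative (x = bplus X) with
                  | left _ => inr (bminus Y)
                  | right h => inl (exist _ x h)
                  end
  | S n => fun x => inl x
  end.

Definition win2 (n : nat) : Y n -> wcell n :=
  match n with 0 => fun y => inr y | S n => fun y => inr y end.

Definition wsrc (n : nat) (z : wcell (S n)) : wcell n :=
  match z with inl x => win1 (src x) | inr y => win2 (src y) end.

Definition wtgt (n : nat) (z : wcell (S n)) : wcell n :=
  match z with inl x => win1 (tgt x) | inr y => win2 (tgt y) end.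

Definition wglob : Glob.
Proof.
  refine {| gcell := wcell; src := wsrc; tgt := wtgt |};
    abstract (intros n [x|y]; simpl; now rewrite ?src_src, ?tgt_src).
Defined.

Definition Wedge : BGlob :=
  {| bglob := wglob; bminus := win1 (bminus X) : wglob 0; bplus := win2 (bplus Y) : wglob 0 |}.

Definition in1 : GMap X Wedge.
Proof. exists win1; abstract (intros [|n] x; reflexivity). Defined.

Definition in2 : GMap Y Wedge.
Proof. exists win2; abstract (intros [|n] x; reflexivity). Defined.

Lemma wedge_glue : in1 0 (bplus X) = in2 0 (bminus Y).
Proof.
  simpl; destruct excluded_middle_informative as [|h]; [reflexivity | now case h].
Qed.

Lemma wedge_cell n (z : Wedge n) : (exists x, z = in1 n x) \/ (exists y, z = in2 n y).
Proof.
  destruct n, z as [x|y]; try (now right; exists y); left.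
  - destruct x as [x h]; exists x; simpl.
    destruct excluded_middle_informative as [e|h']; [now case h|].
    do 2 f_equal; apply proof_irrelevance.
  - now exists x.
Qed.

Section Copair.
Context (Z : Glob) (f : GMap X Z) (g : GMap Y Z) (h : f 0 (bplus X) = g 0 (bminus Y)).

Definition wcopair (n : nat) : wcell n -> Z n :=
  match n with
  | 0 => fun z => match z with inl x => f 0 (proj1_sig x) | inr y => g 0 y end
  | S n => fun z => match z with inl x => f (S n) x | inr y => g (S n) y end
  end.

Lemma wcopair_in1 n (x : X n) : wcopair (win1 x) = f n x.
Proof.
  destruct n; simpl; [|reflexivity].
  destruct excluded_middle_informative as [e|h']; [now subst|reflexivity].
Qed.

Lemma wcopair_in2 n (y : Y n) : wcopair (win2 y) = g n y.
Proof. now destruct n. Qed.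

Definition copair : GMap Wedge Z.
Proof.
  refine {| gmap := wcopair : forall n, Wedge n -> Z n |};
    abstract (intros n [x|y]; simpl;
      rewrite ?wcopair_in1, ?wcopair_in2, ?gmap_src, ?gmap_tgt; now destruct n).
Defined.

Lemma copair_in1 n (x : X n) : copair n (in1 n x) = f n x.
Proof. apply wcopair_in1. Qed.

Lemma copair_in2 n (y : Y n) : copair n (in2 n y) = g n y.
Proof. apply wcopair_in2. Qed.

End Copair.

Lemma wedge_ext (Z : nat -> Type) (f g : forall n, Wedge n -> Z n) :
  (forall n x, f n (in1 n x) = g n (in1 n x)) ->
  (forall n y, f n (in2 n y) = g n (in2 n y)) ->
  forall n z, f n z = g n z.
Proof. intros H1 H2 n z; destruct (wedge_cell z) as [[x ->]|[y ->]]; auto. Qed.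

(** [Wedge] is the pushout. *)
Lemma wedge_pushout (Z : Glob) (f : GMap X Z) (g : GMap Y Z) :
  f 0 (bplus X) = g 0 (bminus Y) ->
  exists! k : GMap Wedge Z, k ∘ in1 = f /\ k ∘ in2 = g.
Proof.
  intros h; exists (copair h); split.
  - split; apply GMap_eq; intros n x; [apply copair_in1 | apply copair_in2].
  - intros k [<- <-]; apply GMap_eq; apply wedge_ext; intros n x;
      [apply copair_in1 | apply copair_in2].
Qed.

End Wedge.

Definition wedge_map (X X' Y Y' : BGlob) (f : BMap X X') (g : BMap Y Y') :
  BMap (Wedge X Y) (Wedge X' Y').
Proof.
  unshelve refine {| bmap := @copair X Y (Wedge X' Y') (in1 X' Y' ∘ bmap f) (in2 X' Y' ∘ bmap g) _ |}.
  - abstract (simpl gmap; rewrite bmap_plus, bmap_minus; apply wedge_glue).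
  - abstract (etransitivity; [apply copair_in1|]; simpl; now rewrite bmap_minus).
  - abstract (etransitivity; [apply copair_in2|]; simpl; now rewrite bmap_plus).
Defined.

Lemma wedge_map_in1 (X X' Y Y' : BGlob) (f : BMap X X') (g : BMap Y Y') n x :
  wedge_map f g n (in1 X Y n x) = in1 X' Y' n (f n x).
Proof. unfold wedge_map; simpl bmap; now rewrite copair_in1. Qed.

Lemma wedge_map_in2 (X X' Y Y' : BGlob) (f : BMap X X') (g : BMap Y Y') n y :
  wedge_map f g n (in2 X Y n y) = in2 X' Y' n (g n y).
Proof. unfold wedge_map; simpl bmap; now rewrite copair_in2. Qed.

(** [Wedges f [a_1; ...; a_n]] is the iterated wedge of the [f a_i]. *)
Definition Wedges (A : Type) (f : A -> BGlob) (l : list A) : BGlob :=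
  fold_right (fun a Y => Wedge (f a) Y) D0 l.

(** The map of wedges induced by maps [f' (o a) -> f a]. *)
Definition wedges_map (A A' : Type) (f' : A' -> BGlob) (f : A -> BGlob) (o : A -> A')
    (m : forall a, BMap (f' (o a)) (f a)) :
    forall l, BMap (Wedges f' (map o l)) (Wedges f l) :=
  fix go l := match l return BMap (Wedges f' (map o l)) (Wedges f l) with
              | [] => bid D0
              | a :: l => wedge_map (m a) (go l)
              end.

(** In [Susp X], [v_-] and [v_+] are [false] and [true]. *)

Definition scell (X : Glob) (n : nat) : Type := match n with 0 => bool | S n => X n end.

Definition ssrc (X : Glob) (n : nat) : scell X (S n) -> scell X n :=
  match n with 0 => fun _ => false | S n => fun x => src x end.

Definition stgt (X : Glob) (n : nat) : scell X (S n) -> scell X n :=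
  match n with 0 => fun _ => true | S n => fun x => tgt x end.

Definition suspg (X : Glob) : Glob.
Proof.
  refine {| gcell := scell X; src := @ssrc X; tgt := @stgt X |};
    abstract (intros [|n] x; simpl; [reflexivity | apply src_src || apply tgt_src]).
Defined.

Definition Susp (X : Glob) : BGlob :=
  {| bglob := suspg X; bminus := false : suspg X 0; bplus := true : suspg X 0 |}.

Definition susp_gmap (X Y : Glob) (f : GMap X Y) : GMap (Susp X) (Susp Y).
Proof.
  refine {| gmap := fun n => match n return Susp X n -> Susp Y n with
                             | 0 => fun v => v
                             | S n => fun x => f n x
                             end |};
    abstract (intros [|n] x; simpl; [reflexivity | apply gmap_src || apply gmap_tgt]).
Defined.

Definition susp_map (X Y : Glob) (f : GMap X Y) : BMap (Susp X) (Susp Y) :=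
  {| bmap := susp_gmap f; bmap_minus := eq_refl; bmap_plus := eq_refl |}.

Inductive tree : Set := br (l : list tree).

Lemma tree_ind' (P : tree -> Prop) :
  (forall l, (forall b, In b l -> P b) -> P (br l)) -> forall B, P B.
Proof.
  intros H; fix IH 1; intros [l]; apply H.
  induction l as [|b l IHl]; simpl; intros b'; [intros []|].
  intros [<-|h]; [apply IH | now apply IHl].
Qed.

Fixpoint dim (B : tree) : nat :=
  match B with br l => fold_right (fun b d => Nat.max (S (dim b)) d) 0 l end.

Fixpoint Pos (B : tree) : BGlob :=
  match B with br l => Wedges (fun b => Susp (Pos b)) l end.

Fixpoint bdry_tree (k : nat) (B : tree) : tree :=
  match k, B with
  | 0, _ => br []
  | S k, br l => br (map (bdry_tree k) l)
  end.

Definition basepoint (e : bool) (X : BGlob) : X 0 := if e then bplus X else bminus X.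

(** The inclusions [s_k^B] (for [e = false]) and [t_k^B] (for [e = true]). *)
Fixpoint bdry_inc (e : bool) (k : nat) : forall B, GMap (Pos (bdry_tree k B)) (Pos B) :=
  match k with
  | 0 => fun B => pick (basepoint e (Pos B))
  | S k => fun B =>
      match B return GMap (Pos (bdry_tree (S k) B)) (Pos B) with
      | br l => wedges_map (f' := fun b => Susp (Pos b)) (f := fun b => Susp (Pos b))
                  (fun b => susp_map (bdry_inc e k b)) l
      end
  end.

Definition src_inc : forall k B, GMap (Pos (bdry_tree k B)) (Pos B) := bdry_inc false.
Definition tgt_inc : forall k B, GMap (Pos (bdry_tree k B)) (Pos B) := bdry_inc true.

(** [w : G] is the subset [{n > 0 | w (n - 1) = true}] of the positive
    integers. *)

Definition G := nat -> bool.

Definition G_group : Group.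
Proof.
  refine {| gcar := G;
            gmul := fun w w' n => xorb (w n) (w' n);
            gone := fun _ => false;
            ginv := fun w => w |}.
  - abstract (intros; apply functional_extensionality; intro; symmetry; apply xorb_assoc).
  - abstract (intros; apply functional_extensionality; intro; apply xorb_false_l).
  - abstract (intros; apply functional_extensionality; intro; apply xorb_nilpotent).
Defined.

Definition pred_G (w : G) : G := fun n => w (S n).

Section OpGlob.
Context (w : G).

Definition op_glob (X : Glob) : Glob.
Proof.
  refine {| gcell := X;
            src := fun n (x : X (S n)) => if w n then tgt x else src x;
            tgt := fun n (x : X (S n)) => if w n then src x else tgt x |};
  abstract (intros n x; destruct (w n), (w (S n)); simpl;
    rewrite ?src_src, ?tgt_src; reflexivity).
Defined.

Definition op_gmap (X Y : Glob) (f : GMap X Y) : GMap (op_glob X) (op_glob Y).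
Proof.
  refine {| gmap := fun n (x : op_glob X n) => f n x : op_glob Y n |};
    abstract (intros n x; simpl; destruct (w n); apply gmap_src || apply gmap_tgt).
Defined.

Definition op_Glob : Functor GLOB GLOB.
Proof.
  refine {| fob := op_glob : GLOB -> GLOB; fmap := op_gmap |};
    abstract (intros; now apply GMap_eq).
Defined.

Definition op_bglob (X : BGlob) : BGlob :=
  {| bglob := op_glob X;
     bminus := (if w 0 then bplus X else bminus X) : op_glob X 0;
     bplus := (if w 0 then bminus X else bplus X) : op_glob X 0 |}.

Definition op_bmap (X Y : BGlob) (f : BMap X Y) : BMap (op_bglob X) (op_bglob Y).
Proof.
  refine {| bmap := op_gmap f : GMap (op_bglob X) (op_bglob Y) |};
    abstract (simpl; destruct (w 0); apply bmap_minus || apply bmap_plus).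
Defined.

End OpGlob.

Definition swap (A : Type) (b : bool) (l : list A) : list A := if b then rev l else l.

Definition op_susp_gmap (w : G) (X : Glob) :
  GMap (Susp (op_glob (pred_G w) X)) (op_bglob w (Susp X)).
Proof.
  refine {| gmap := fun n => match n return Susp (op_glob (pred_G w) X) n -> op_bglob w (Susp X) n with
                             | 0 => fun v => if w 0 then negb v else v
                             | S n => fun x => x
                             end |};
    abstract (intros [|n] x; simpl; [now destruct (w 0) | reflexivity]).
Defined.

Definition op_susp (w : G) (X : Glob) :
  BMap (Susp (op_glob (pred_G w) X)) (op_bglob w (Susp X)).
Proof. exists (op_susp_gmap w X); abstract (simpl; now destruct (w 0)). Defined.

Section OpWedge.
Context (w : G).

Definition op_wedge_false (h : w 0 = false) (X Y : BGlob) :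
  BMap (Wedge (op_bglob w X) (op_bglob w Y)) (op_bglob w (Wedge X Y)).
Proof.
  unshelve refine {| bmap := @copair (op_bglob w X) (op_bglob w Y) (op_bglob w (Wedge X Y))
    (op_gmap w (in1 X Y)) (op_gmap w (in2 X Y)) _ |}.
  - abstract (simpl; rewrite h; apply wedge_glue).
  - abstract (etransitivity; [apply copair_in1|]; simpl; now rewrite h).
  - abstract (etransitivity; [apply copair_in2|]; simpl; now rewrite h).
Defined.

Definition op_wedge_true (h : w 0 = true) (X Y : BGlob) :
  BMap (Wedge (op_bglob w Y) (op_bglob w X)) (op_bglob w (Wedge X Y)).
Proof.
  unshelve refine {| bmap := @copair (op_bglob w Y) (op_bglob w X) (op_bglob w (Wedge X Y))
    (op_gmap w (in2 X Y)) (op_gmap w (in1 X Y)) _ |}.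
  - abstract (simpl; rewrite h; symmetry; apply wedge_glue).
  - abstract (etransitivity; [apply copair_in1|]; simpl; now rewrite h).
  - abstract (etransitivity; [apply copair_in2|]; simpl; now rewrite h).
Defined.

End OpWedge.

(** [X ∨ D0 ≅ D0 ∨ X], [X ∨ (Y ∨ Z) ≅ (X ∨ Y) ∨ Z], and the resulting
    decomposition of [⋁ (l ++ [a])]. *)

Definition wedge_unit (X : BGlob) : BMap (Wedge X D0) (Wedge D0 X).
Proof.
  unshelve refine {| bmap := @copair X D0 (Wedge D0 X) (in2 D0 X) (pick (bplus (Wedge D0 X))) _ |}.
  - abstract reflexivity.
  - abstract (etransitivity; [apply copair_in1|]; simpl bminus;
      symmetry; apply (wedge_glue D0 X)).
  - abstract (etransitivity; [apply copair_in2|]; reflexivity).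
Defined.

Definition wedge_assoc_r (X Y Z : BGlob) : GMap (Wedge Y Z) (Wedge (Wedge X Y) Z).
Proof.
  refine (@copair Y Z _ (in1 (Wedge X Y) Z ∘ in2 X Y) (in2 (Wedge X Y) Z) _).
  abstract (apply (wedge_glue (Wedge X Y) Z)).
Defined.

Definition wedge_assoc (X Y Z : BGlob) :
  BMap (Wedge X (Wedge Y Z)) (Wedge (Wedge X Y) Z).
Proof.
  unshelve refine {| bmap := @copair X (Wedge Y Z) (Wedge (Wedge X Y) Z)
    (in1 (Wedge X Y) Z ∘ in1 X Y) (wedge_assoc_r X Y Z) _ |}.
  - abstract (etransitivity; [exact (f_equal (in1 (Wedge X Y) Z 0) (wedge_glue X Y))|];
      symmetry; unfold wedge_assoc_r; exact (@copair_in1 Y Z _ _ _ _ 0 (bminus Y))).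
  - abstract (etransitivity; [apply copair_in1|]; reflexivity).
  - abstract (etransitivity; [apply copair_in2|];
      etransitivity; [apply copair_in2|]; reflexivity).
Defined.

Section Snoc.
Context (A : Type) (f : A -> BGlob).

Fixpoint wedges_snoc (l : list A) (a : A) :
  BMap (Wedges f (l ++ [a])) (Wedge (Wedges f l) (f a)) :=
  match l return BMap (Wedges f (l ++ [a])) (Wedge (Wedges f l) (f a)) with
  | [] => wedge_unit (f a)
  | b :: l => bcmp (wedge_assoc (f b) (Wedges f l) (f a))
                   (wedge_map (bid (f b)) (wedges_snoc l a))
  end.

End Snoc.

(** [op_wedges m l] is the map
    [⋁ swap_{w(1)} [f' (o a_1), ..., f' (o a_n)] -> op_w (⋁ [f a_1, ..., f a_n])]
    that is compatible with the inclusions along the given maps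
    [m a : f' (o a) -> op_w (f a)]; that is, the map of wedges induced by the
    [m a], followed by [op_w^∨]. *)
Section OpWedges.
Context (w : G) (A A' : Type) (f' : A' -> BGlob) (f : A -> BGlob) (o : A -> A')
  (m : forall a, BMap (f' (o a)) (op_bglob w (f a))).

Definition op_D0 : BMap D0 (op_bglob w D0).
Proof.
  exists (pick (tt : op_bglob w D0 0)); abstract (simpl; now destruct (w 0)).
Defined.

Definition op_wedges_false (h : w 0 = false) :
    forall l, BMap (Wedges f' (map o l)) (op_bglob w (Wedges f l)) :=
  fix go l := match l return BMap (Wedges f' (map o l)) (op_bglob w (Wedges f l)) with
              | [] => op_D0
              | a :: l => bcmp (op_wedge_false h (f a) (Wedges f l))
                               (wedge_map (m a) (go l))
              end.

Definition op_wedges_true (h : w 0 = true) :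
    forall l, BMap (Wedges f' (rev (map o l))) (op_bglob w (Wedges f l)) :=
  fix go l := match l return BMap (Wedges f' (rev (map o l))) (op_bglob w (Wedges f l)) with
              | [] => op_D0
              | a :: l => bcmp (op_wedge_true h (f a) (Wedges f l))
                               (bcmp (wedge_map (go l) (m a))
                                     (wedges_snoc f' (rev (map o l)) (o a)))
              end.

Definition op_wedges (l : list A) :
    BMap (Wedges f' (swap (w 0) (map o l))) (op_bglob w (Wedges f l)) :=
  match w 0 as b return w 0 = b -> BMap (Wedges f' (swap b (map o l))) (op_bglob w (Wedges f l)) with
  | true => fun h => op_wedges_true h l
  | false => fun h => op_wedges_false h l
  end eq_refl.

End OpWedges.

Fixpoint op_tree (w : G) (B : tree) {struct B} : tree :=
  match B with br l => br (swap (w 0) (map (op_tree (pred_G w)) l)) end.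

Fixpoint op_pos (w : G) (B : tree) {struct B} :
    BMap (Pos (op_tree w B)) (op_bglob w (Pos B)) :=
  match B return BMap (Pos (op_tree w B)) (op_bglob w (Pos B)) with
  | br l => op_wedges (f' := fun b => Susp (Pos b)) (f := fun b => Susp (Pos b))
              (fun b => bcmp (op_susp w (Pos b)) (susp_map (op_pos (pred_G w) b))) l
  end.

Definition gbij (X Y : Glob) (f : GMap X Y) : Prop :=
  forall n, (forall x x', f n x = f n x' -> x = x') /\ (forall y, exists x, f n x = y).

Lemma gbij_inverse (X Y : Glob) (f : GMap X Y) :
  gbij f -> exists g : GMap Y X, (forall n x, g n (f n x) = x) /\ (forall n y, f n (g n y) = y).
Proof.
  intros H.
  pose (g := fun n y => proj1_sig (constructive_indefinite_description _ (proj2 (H n) y))).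
  assert (fg : forall n y, f n (g n y) = y)
    by (intros n y; exact (proj2_sig (constructive_indefinite_description _ (proj2 (H n) y)))).
  unshelve eexists {| gmap := g |}.
  - intros n y; apply (proj1 (H n)); now rewrite gmap_src, !fg.
  - intros n y; apply (proj1 (H n)); now rewrite gmap_tgt, !fg.
  - split; simpl; [|apply fg]. intros n x; apply (proj1 (H n)); apply fg.
Qed.

Lemma gbij_iso (X Y : GLOB) (f : Hom X Y) : gbij f -> is_iso f.
Proof.
  intros H; destruct (gbij_inverse H) as [g [H1 H2]].
  exists g; split; now apply GMap_eq.
Qed.

Lemma gbij_biso (X Y : BGLOB) (f : Hom X Y) : gbij f -> is_iso f.
Proof.
  intros H; destruct (gbij_inverse H) as [g [H1 H2]].
  unshelve eexists {| bmap := g |}.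
  - now rewrite <- (bmap_minus f), H1.
  - now rewrite <- (bmap_plus f), H1.
  - split; now apply BMap_eq.
Qed.

Lemma biso_iso (X Y : BGLOB) (f : Hom X Y) : is_iso f -> @is_iso GLOB X Y (bmap f).
Proof.
  intros [g [H1 H2]]; exists (bmap g); split; [exact (f_equal (@bmap _ _) H1) | exact (f_equal (@bmap _ _) H2)].
Qed.

Lemma bcmp_app (X Y Z : BGlob) (g : BMap Y Z) (f : BMap X Y) n (x : X n) :
  bcmp g f n x = g n (f n x).
Proof. reflexivity. Qed.

Lemma op_bmap_app w (X Y : BGlob) (f : BMap X Y) n (x : X n) : op_bmap w f n x = f n x.
Proof. reflexivity. Qed.

Lemma bmap_wedge_ext (X Y Z : BGlob) (f g : BMap (Wedge X Y) Z) :
  (forall n x, f n (in1 X Y n x) = g n (in1 X Y n x)) ->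
  (forall n y, f n (in2 X Y n y) = g n (in2 X Y n y)) -> f = g.
Proof. intros H1 H2; apply BMap_eq; now apply wedge_ext. Qed.

Lemma wedge_map_cmp (X X' X'' Y Y' Y'' : BGlob) (f' : BMap X' X'') (f : BMap X X')
    (g' : BMap Y' Y'') (g : BMap Y Y') :
  bcmp (wedge_map f' g') (wedge_map f g) = wedge_map (bcmp f' f) (bcmp g' g).
Proof.
  apply bmap_wedge_ext; intros n x; rewrite ?bcmp_app.
  - now rewrite !wedge_map_in1.
  - now rewrite !wedge_map_in2.
Qed.

Lemma wedge_map_id (X Y : BGlob) : wedge_map (bid X) (bid Y) = bid (Wedge X Y).
Proof.
  apply bmap_wedge_ext; intros n x.
  - apply wedge_map_in1.
  - apply wedge_map_in2.
Qed.

Lemma wedge_map_iso (X X' Y Y' : BGLOB) (f : Hom X X') (g : Hom Y Y') :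
  is_iso f -> is_iso g -> @is_iso BGLOB _ _ (wedge_map f g).
Proof.
  intros [f' [F1 F2]] [g' [G1 G2]]; exists (wedge_map f' g'); split.
  - etransitivity; [apply wedge_map_cmp|]; etransitivity; [|apply wedge_map_id].
    exact (f_equal2 (@wedge_map _ _ _ _) F1 G1).
  - etransitivity; [apply wedge_map_cmp|]; etransitivity; [|apply wedge_map_id].
    exact (f_equal2 (@wedge_map _ _ _ _) F2 G2).
Qed.

Lemma wedges_map_iso A A' f' f o m l :
  (forall a, @is_iso BGLOB _ _ (m a)) ->
  @is_iso BGLOB _ _ (@wedges_map A A' f' f o m l).
Proof.
  intros H; induction l; simpl; [apply (@is_iso_id BGLOB) | now apply wedge_map_iso].
Qed.

Lemma susp_map_iso (X Y : GLOB) (f : Hom X Y) : is_iso f -> @is_iso BGLOB _ _ (susp_map f).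
Proof.
  intros [g [H1 H2]]; exists (susp_map g).
  split; apply BMap_eq; intros [|n] x; try reflexivity;
    [exact (f_equal (fun k : GMap X X => k n x) H1) | exact (f_equal (fun k : GMap Y Y => k n x) H2)].
Qed.

Lemma op_susp_iso w X : @is_iso BGLOB _ _ (op_susp w X).
Proof.
  apply gbij_biso; intros [|n]; simpl; split; eauto.
  - destruct (w 0); intros [] []; easy.
  - intros []; destruct (w 0); (now exists true) || now exists false.
Qed.

Lemma op_susp_nat w (X Y : Glob) (f : GMap X Y) :
  bcmp (op_susp w Y) (susp_map (op_gmap (pred_G w) f)) =
  bcmp (op_bmap w (susp_map f)) (op_susp w X).
Proof. apply BMap_eq; intros [|n] x; reflexivity. Qed.

Lemma win1_inj (X Y : BGlob) n (x x' : X n) : in1 X Y n x = in1 X Y n x' -> x = x'.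
Proof.
  destruct n; simpl; [|congruence].
  do 2 destruct excluded_middle_informative; congruence.
Qed.

Lemma win2_inj (X Y : BGlob) n (y y' : Y n) : in2 X Y n y = in2 X Y n y' -> y = y'.
Proof. destruct n; simpl; congruence. Qed.

Lemma win12_0 (X Y : BGlob) (x : X 0) (y : Y 0) :
  in1 X Y 0 x = in2 X Y 0 y -> x = bplus X /\ y = bminus Y.
Proof. simpl; destruct excluded_middle_informative; [intros [=] | easy]; now split. Qed.

Lemma win12_S (X Y : BGlob) n (x : X (S n)) (y : Y (S n)) :
  in1 X Y (S n) x <> in2 X Y (S n) y.
Proof. easy. Qed.

Ltac glue n E E1 E2 :=
  destruct n as [|n];
  [apply win12_0 in E as [E1 E2] | exfalso; exact (win12_S E)].

Lemma win21 (X Y : BGlob) (x : X 0) (y : Y 0) :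
  x = bplus X -> y = bminus Y -> in1 X Y 0 x = in2 X Y 0 y.
Proof. intros -> ->; apply wedge_glue. Qed.

Lemma op_wedge_false_in1 w h X Y n x :
  @op_wedge_false w h X Y n (in1 (op_bglob w X) (op_bglob w Y) n x) = in1 X Y n x.
Proof. unfold op_wedge_false; simpl bmap; now rewrite copair_in1. Qed.

Lemma op_wedge_false_in2 w h X Y n x :
  @op_wedge_false w h X Y n (in2 (op_bglob w X) (op_bglob w Y) n x) = in2 X Y n x.
Proof. unfold op_wedge_false; simpl bmap; now rewrite copair_in2. Qed.

Lemma op_wedge_true_in1 w h X Y n x :
  @op_wedge_true w h X Y n (in1 (op_bglob w Y) (op_bglob w X) n x) = in2 X Y n x.
Proof. unfold op_wedge_true; simpl bmap; now rewrite copair_in1. Qed.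

Lemma op_wedge_true_in2 w h X Y n x :
  @op_wedge_true w h X Y n (in2 (op_bglob w Y) (op_bglob w X) n x) = in1 X Y n x.
Proof. unfold op_wedge_true; simpl bmap; now rewrite copair_in2. Qed.

Lemma op_wedge_false_iso w h X Y : @is_iso BGLOB _ _ (@op_wedge_false w h X Y).
Proof.
  apply gbij_biso; intros n; split.
  - intros z z'.
    destruct (wedge_cell z) as [[x ->]|[x ->]], (wedge_cell z') as [[x' ->]|[x' ->]];
      rewrite ?op_wedge_false_in1, ?op_wedge_false_in2; intros E.
    + now apply win1_inj in E as ->.
    + glue n E E1 E2.
      apply win21; simpl; now rewrite h.
    + symmetry in E; glue n E E1 E2.
      symmetry; apply win21; simpl; now rewrite h.
    + now apply win2_inj in E as ->.
  - intros z; destruct (wedge_cell (X:=X) (Y:=Y) z) as [[x ->]|[x ->]]; eexists;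
      [apply op_wedge_false_in1 | apply op_wedge_false_in2].
Qed.

Lemma op_wedge_true_iso w h X Y : @is_iso BGLOB _ _ (@op_wedge_true w h X Y).
Proof.
  apply gbij_biso; intros n; split.
  - intros z z'.
    destruct (wedge_cell z) as [[x ->]|[x ->]], (wedge_cell z') as [[x' ->]|[x' ->]];
      rewrite ?op_wedge_true_in1, ?op_wedge_true_in2; intros E.
    + now apply win2_inj in E as ->.
    + symmetry in E; glue n E E1 E2.
      apply win21; simpl; now rewrite h.
    + glue n E E1 E2.
      symmetry; apply win21; simpl; now rewrite h.
    + now apply win1_inj in E as ->.
  - intros z; destruct (wedge_cell (X:=X) (Y:=Y) z) as [[x ->]|[x ->]]; eexists;
      [apply op_wedge_true_in2 | apply op_wedge_true_in1].
Qed.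

Lemma op_wedge_false_nat w h (X X' Y Y' : BGlob) (f : BMap X X') (g : BMap Y Y') :
  bcmp (op_wedge_false h X' Y') (wedge_map (op_bmap w f) (op_bmap w g)) =
  bcmp (op_bmap w (wedge_map f g)) (op_wedge_false h X Y).
Proof.
  apply bmap_wedge_ext; intros n x; rewrite ?bcmp_app.
  - rewrite wedge_map_in1, !op_wedge_false_in1; exact (eq_sym (wedge_map_in1 f g x)).
  - rewrite wedge_map_in2, !op_wedge_false_in2; exact (eq_sym (wedge_map_in2 f g x)).
Qed.

Lemma op_wedge_true_nat w h (X X' Y Y' : BGlob) (f : BMap X X') (g : BMap Y Y') :
  bcmp (op_wedge_true h X' Y') (wedge_map (op_bmap w g) (op_bmap w f)) =
  bcmp (op_bmap w (wedge_map f g)) (op_wedge_true h X Y).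
Proof.
  apply bmap_wedge_ext; intros n x; rewrite ?bcmp_app.
  - rewrite wedge_map_in1, !op_wedge_true_in1; exact (eq_sym (wedge_map_in2 f g x)).
  - rewrite wedge_map_in2, !op_wedge_true_in2; exact (eq_sym (wedge_map_in1 f g x)).
Qed.

Lemma wedge_unit_in1 X n x : wedge_unit X n (in1 X D0 n x) = in2 D0 X n x.
Proof. unfold wedge_unit; simpl bmap; now rewrite copair_in1. Qed.

Lemma wedge_unit_in2 X n x : wedge_unit X n (in2 X D0 n x) = pick (bplus (Wedge D0 X)) n x.
Proof. unfold wedge_unit; simpl bmap; now rewrite copair_in2. Qed.

Lemma wedge_unit_iso X : @is_iso BGLOB _ _ (wedge_unit X).
Proof.
  assert (E2 : forall n (x : D0 n), exists y, in2 X D0 n x = in1 X D0 n y).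
  { intros [|n] []; exists (bplus X); symmetry; apply wedge_glue. }
  assert (E1 : forall n (x : D0 n), exists y, in1 D0 X n x = in2 D0 X n y).
  { intros [|n] []; exists (bminus X). apply (wedge_glue D0 X). }
  apply gbij_biso; intros n; split.
  - intros z z'.
    assert (K : forall z : Wedge X D0 n, exists y, z = in1 X D0 n y).
    { intros y; destruct (wedge_cell y) as [[x ->]|[x ->]]; eauto. }
    destruct (K z) as [y ->], (K z') as [y' ->].
    rewrite !wedge_unit_in1; intros E; now apply win2_inj in E as ->.
  - intros z.
    assert (K : exists y, z = in2 D0 X n y).
    { destruct (wedge_cell z) as [[x ->]|[x ->]]; eauto. }
    destruct K as [y ->]; eexists; apply wedge_unit_in1.
Qed.

Lemma wedge_assoc_in1 X Y Z n x :
  wedge_assoc X Y Z n (in1 X (Wedge Y Z) n x) = in1 (Wedge X Y) Z n (in1 X Y n x).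
Proof. unfold wedge_assoc; simpl bmap; now rewrite copair_in1. Qed.

Lemma wedge_assoc_in21 X Y Z n x :
  wedge_assoc X Y Z n (in2 X (Wedge Y Z) n (in1 Y Z n x)) = in1 (Wedge X Y) Z n (in2 X Y n x).
Proof.
  unfold wedge_assoc; simpl bmap; rewrite copair_in2; unfold wedge_assoc_r.
  now rewrite copair_in1.
Qed.

Lemma wedge_assoc_in22 X Y Z n x :
  wedge_assoc X Y Z n (in2 X (Wedge Y Z) n (in2 Y Z n x)) = in2 (Wedge X Y) Z n x.
Proof.
  unfold wedge_assoc; simpl bmap; rewrite copair_in2; unfold wedge_assoc_r.
  now rewrite copair_in2.
Qed.

Lemma wedge_assoc_iso X Y Z : @is_iso BGLOB _ _ (wedge_assoc X Y Z).
Proof.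
  apply gbij_biso; intros n; split.
  - intros z z'.
    destruct (wedge_cell z) as [[x ->]|[x ->]];
      [|destruct (wedge_cell x) as [[y ->]|[y ->]]];
      (destruct (wedge_cell z') as [[x' ->]|[x' ->]];
      [|destruct (wedge_cell x') as [[y' ->]|[y' ->]]]);
      rewrite ?wedge_assoc_in1, ?wedge_assoc_in21, ?wedge_assoc_in22; intros E.
    + now apply win1_inj, win1_inj in E as ->.
    + apply win1_inj in E; glue n E E1 E2; subst.
      exact (wedge_glue X (Wedge Y Z)).
    + glue n E E1 E2; subst; apply (win12_0 (X:=X) (Y:=Y)) in E1 as [E1 E2]; subst.
      etransitivity; [exact (wedge_glue X (Wedge Y Z))|].
      apply f_equal; rewrite <- (wedge_glue Y Z), E2; reflexivity.
    + symmetry in E; apply win1_inj in E; glue n E E1 E2; subst.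
      symmetry; exact (wedge_glue X (Wedge Y Z)).
    + now apply win1_inj, win2_inj in E as ->.
    + glue n E E1 E2; subst; apply (win2_inj (X:=X) (Y:=Y) (n:=0)) in E1; subst.
      apply f_equal; apply wedge_glue.
    + symmetry in E; glue n E E1 E2; subst; apply (win12_0 (X:=X) (Y:=Y)) in E1 as [E1 E2]; subst.
      symmetry; etransitivity; [exact (wedge_glue X (Wedge Y Z))|].
      apply f_equal; rewrite <- (wedge_glue Y Z), E2; reflexivity.
    + symmetry in E; glue n E E1 E2; subst; apply (win2_inj (X:=X) (Y:=Y) (n:=0)) in E1; subst.
      symmetry; apply f_equal; apply wedge_glue.
    + now apply win2_inj in E as ->.
  - intros z; destruct (wedge_cell z) as [[x ->]|[x ->]];
      [destruct (wedge_cell x) as [[y ->]|[y ->]]|]; eexists.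
    + apply wedge_assoc_in1.
    + apply wedge_assoc_in21.
    + apply wedge_assoc_in22.
Qed.

Lemma wedges_snoc_iso A f l a : @is_iso BGLOB _ _ (@wedges_snoc A f l a).
Proof.
  induction l as [|b l IH]; simpl; [apply wedge_unit_iso|].
  apply (@is_iso_cmp BGLOB); [apply wedge_assoc_iso|].
  apply wedge_map_iso; [apply (@is_iso_id BGLOB) | exact IH].
Qed.

Lemma op_D0_iso w : @is_iso BGLOB _ _ (op_D0 w).
Proof.
  apply gbij_biso; intros [|n]; split; intros []; try (now intros []); now exists tt.
Qed.

Lemma op_wedges_elim w A A' f' f o m l
  (P : forall b, BMap (Wedges f' (swap b (map o l))) (op_bglob w (Wedges f l)) -> Prop) :
  (forall h, P true (@op_wedges_true w A A' f' f o m h l)) ->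
  (forall h, P false (@op_wedges_false w A A' f' f o m h l)) ->
  P (w 0) (op_wedges m l).
Proof.
  intros Ht Hf; unfold op_wedges.
  refine (match w 0 as b return forall e : w 0 = b, P b (match b as b return w 0 = b ->
     BMap (Wedges f' (swap b (map o l))) (op_bglob w (Wedges f l)) with
  | true => fun h => op_wedges_true m h l
  | false => fun h => op_wedges_false m h l
  end e) with true => Ht | false => Hf end eq_refl).
Qed.

(** [inclusion f l i a ι]: [a] is the [i]-th entry of [l], counted from [0], and
    [ι] is the corresponding inclusion [f a -> Wedges f l]. *)
Inductive inclusion (A : Type) (f : A -> BGlob) :
    forall (l : list A) (i : nat) (a : A), GMap (f a) (Wedges f l) -> Prop :=
| incl_head a l : @inclusion A f (a :: l) 0 a (in1 (f a) (Wedges f l))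
| incl_tail b l i a ι : @inclusion A f l i a ι ->
    @inclusion A f (b :: l) (S i) a (gcmp (in2 (f b) (Wedges f l)) ι).

Lemma wedges_snoc_last A f (l : list A) (x : A) :
  exists ι, inclusion (f := f) (l := l ++ [x]) (length l) ι /\
    forall n y, wedges_snoc f l x n (ι n y) = in2 (Wedges f l) (f x) n y.
Proof.
  induction l as [|b l [ι [H E]]]; simpl.
  - eexists; split; [apply (incl_head f x [])|]. intros n y; apply (wedge_unit_in1 (X := f x)).
  - eexists; split; [exact (incl_tail b H)|]; intros n y; simpl in E |- *.
    etransitivity; [apply f_equal, (wedge_map_in2 (bid (f b)) (wedges_snoc f l x))|].
    simpl; rewrite E; apply wedge_assoc_in22.
Qed.

Lemma wedges_snoc_init A f (l : list A) (x : A) i a ι :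
  inclusion (f := f) (l := l) (a := a) i ι ->
  exists ι', inclusion (f := f) (l := l ++ [x]) (a := a) i ι' /\
    forall n y, wedges_snoc f l x n (ι' n y) = in1 (Wedges f l) (f x) n (ι n y).
Proof.
  induction 1 as [a l|b l i a ι H [ι' [H' E]]]; simpl.
  - eexists; split; [apply (incl_head f a (l ++ [x]))|]; intros n y; simpl.
    etransitivity; [apply f_equal, (wedge_map_in1 (bid (f a)) (wedges_snoc f l x))|].
    apply wedge_assoc_in1.
  - eexists; split; [exact (incl_tail b H')|]; intros n y; simpl in E |- *.
    etransitivity; [apply f_equal, (wedge_map_in2 (bid (f b)) (wedges_snoc f l x))|].
    simpl; rewrite E; apply wedge_assoc_in21.
Qed.

(** [op_wedges] is compatible with the inclusions; the order of the factors is
    reversed when [1 ∈ w]. *)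
Lemma op_wedges_inclusion w A A' f' f o m l i a ι :
  inclusion (f := f) (l := l) (a := a) i ι ->
  exists ι', inclusion (f := f') (l := swap (w 0) (map o l)) (a := o a)
               (if w 0 then length l - S i else i) ι' /\
    gcmp (@op_wedges w A A' f' f o m l) ι' = gcmp (op_gmap w ι) (m a).
Proof.
  intros H.
  apply (@op_wedges_elim w A A' f' f o m l (fun b F =>
    exists ι', inclusion (f := f') (l := swap b (map o l)) (a := o a)
               (if b then length l - S i else i) ι' /\
      gcmp F ι' = gcmp (op_gmap w ι) (m a))); intros h; simpl swap;
    induction H as [a l|b l i a ι H [ι' [H' E]]].
  - destruct (wedges_snoc_last f' (rev (map o l)) (o a)) as [ι [Hι E]].
    exists ι; split.
    + rewrite length_rev, length_map in Hι; simpl; now rewrite Nat.sub_0_r.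
    + apply GMap_eq; intros n y; simpl.
      etransitivity; [apply f_equal, f_equal, E|].
      etransitivity; [apply f_equal, (wedge_map_in2 (op_wedges_true m h l) (m a))|].
      exact (@op_wedge_true_in2 w h (f a) (Wedges f l) n _).
  - destruct (wedges_snoc_init (o b) H') as [κ [Hκ Eκ]].
    exists κ; split; [exact Hκ|].
    apply GMap_eq; intros n y; simpl.
    etransitivity; [apply f_equal, f_equal, Eκ|].
    etransitivity; [apply f_equal, (wedge_map_in1 (op_wedges_true m h l) (m b))|].
    etransitivity; [exact (@op_wedge_true_in1 w h (f b) (Wedges f l) n _)|].
    apply (f_equal (in2 (f b) (Wedges f l) n)).
    exact (f_equal (fun z : GMap _ _ => z n y) E).
  - eexists; split; [apply (incl_head f' (o a) (map o l))|].
    apply GMap_eq; intros n y; simpl.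
    etransitivity; [apply f_equal, (wedge_map_in1 (m a) (op_wedges_false m h l))|].
    exact (@op_wedge_false_in1 w h (f a) (Wedges f l) n _).
  - eexists; split; [exact (incl_tail (o b) H')|].
    apply GMap_eq; intros n y; simpl.
    etransitivity; [apply f_equal, (wedge_map_in2 (m b) (op_wedges_false m h l))|].
    etransitivity; [exact (@op_wedge_false_in2 w h (f b) (Wedges f l) n _)|].
    apply (f_equal (in2 (f b) (Wedges f l) n)).
    exact (f_equal (fun z : GMap _ _ => z n y) E).
Qed.

Lemma op_wedges_iso w A A' f' f o m l :
  (forall a, In a l -> @is_iso BGLOB _ _ (m a)) ->
  @is_iso BGLOB _ _ (@op_wedges w A A' f' f o m l).
Proof.
  intros H.
  apply (@op_wedges_elim w A A' f' f o m l (fun b F => @is_iso BGLOB _ _ F)); intros h;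
    revert H; (induction l as [|a l IH]; simpl; [intros; apply op_D0_iso|]); intros H.
  - apply (@is_iso_cmp BGLOB); [apply op_wedge_true_iso|].
    apply (@is_iso_cmp BGLOB); [apply wedge_map_iso; auto | apply wedges_snoc_iso].
  - apply (@is_iso_cmp BGLOB); [apply op_wedge_false_iso|].
    apply wedge_map_iso; auto.
Qed.

Lemma op_pos_biso : forall B w, @is_iso BGLOB _ _ (op_pos w B).
Proof.
  apply (tree_ind' (P := fun B => forall w, @is_iso BGLOB _ _ (op_pos w B))).
  intros l IH w; simpl; apply op_wedges_iso; intros b Hb.
  apply (@is_iso_cmp BGLOB); [apply op_susp_iso | apply susp_map_iso].
  exact (biso_iso (IH b Hb (pred_G w))).
Qed.

Lemma op_pos_iso w B : @is_iso GLOB (Pos (op_tree w B)) (op_glob w (Pos B)) (op_pos w B).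
Proof. exact (biso_iso (op_pos_biso B w)). Qed.

Definition op_pos_inv (w : G) (B : tree) : GMap (op_glob w (Pos B)) (Pos (op_tree w B)) :=
  inv (op_pos_iso w B).

Lemma op_tree_invol : forall B w, op_tree w (op_tree w B) = B.
Proof.
  apply (tree_ind' (P := fun B => forall w, op_tree w (op_tree w B) = B)).
  intros l IH w; simpl; f_equal.
  assert (E : map (op_tree (pred_G w)) (map (op_tree (pred_G w)) l) = l).
  { rewrite map_map; induction l as [|b l IHl]; simpl; [reflexivity|].
    f_equal; [apply IH; now left|apply IHl; intros; apply IH; now right]. }
  unfold swap; destruct (w 0); [|exact E].
  now rewrite map_rev, rev_involutive.
Qed.

Lemma dim_br l : dim (br l) = fold_right Nat.max 0 (map (fun b => S (dim b)) l).
Proof. induction l; simpl; [reflexivity|]. simpl in IHl; now rewrite IHl. Qed.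

Lemma fold_max_rev l : fold_right Nat.max 0 (rev l) = fold_right Nat.max 0 l.
Proof.
  assert (H : forall l a, fold_right Nat.max a l = Nat.max a (fold_right Nat.max 0 l)).
  { intros k; induction k; simpl; intros; [lia|]. rewrite IHk; lia. }
  induction l; simpl; [reflexivity|]. rewrite fold_right_app; simpl; rewrite H, IHl; lia.
Qed.

Lemma dim_op_tree : forall B w, dim (op_tree w B) = dim B.
Proof.
  apply (tree_ind' (P := fun B => forall w, dim (op_tree w B) = dim B)).
  intros l IH w; simpl op_tree; rewrite !dim_br.
  transitivity (fold_right Nat.max 0 (map (fun b => S (dim b)) (map (op_tree (pred_G w)) l))).
  - unfold swap; destruct (w 0); [|reflexivity]. now rewrite map_rev, fold_max_rev.
  - rewrite map_map; f_equal; apply map_ext_in; intros b Hb; now rewrite IH.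
Qed.

(** The boundary inclusions of [op_w B] correspond to those of [B], source and
    target being exchanged in dimension [k] when [k + 1 ∈ w]. *)

Lemma basepoint_op w e X : basepoint e (op_bglob w X) = basepoint (xorb e (w 0)) X.
Proof. now destruct e; simpl; destruct (w 0). Qed.

Lemma bmap_basepoint e (X Y : BGlob) (f : BMap X Y) :
  f 0 (basepoint e X) = basepoint e Y.
Proof. destruct e; [apply bmap_plus | apply bmap_minus]. Qed.

Lemma wedge_unit_nat (X X' : BGlob) (f : BMap X X') :
  bcmp (wedge_unit X') (wedge_map f (bid D0)) = bcmp (wedge_map (bid D0) f) (wedge_unit X).
Proof.
  apply bmap_wedge_ext; intros n x; rewrite ?bcmp_app.
  - now rewrite wedge_map_in1, !wedge_unit_in1, wedge_map_in2.
  - rewrite wedge_map_in2, !wedge_unit_in2; destruct n; [|destruct x].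
    simpl pick; cbv beta iota; symmetry; apply (bmap_plus (wedge_map (bid D0) f)).
Qed.

Lemma wedge_assoc_nat (X X' Y Y' Z Z' : BGlob)
    (f : BMap X X') (g : BMap Y Y') (h : BMap Z Z') :
  bcmp (wedge_assoc X' Y' Z') (wedge_map f (wedge_map g h)) =
  bcmp (wedge_map (wedge_map f g) h) (wedge_assoc X Y Z).
Proof.
  apply bmap_wedge_ext.
  - intros n x; rewrite !bcmp_app.
    now rewrite wedge_map_in1, !wedge_assoc_in1, !wedge_map_in1.
  - apply (wedge_ext (Z := fun n => Wedge (Wedge X' Y') Z' n)
      (f := fun n y => bcmp (wedge_assoc X' Y' Z') (wedge_map f (wedge_map g h)) n (in2 X (Wedge Y Z) n y))
      (g := fun n y => bcmp (wedge_map (wedge_map f g) h) (wedge_assoc X Y Z) n (in2 X (Wedge Y Z) n y)));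
      intros n x; rewrite !bcmp_app.
    + now rewrite wedge_map_in2, wedge_map_in1, !wedge_assoc_in21, wedge_map_in1, wedge_map_in2.
    + now rewrite !wedge_map_in2, !wedge_assoc_in22, wedge_map_in2.
Qed.

Lemma bcmp_idl (X Y : BGlob) (f : BMap X Y) : bcmp (bid Y) f = f.
Proof. now apply BMap_eq. Qed.

Lemma bcmp_idr (X Y : BGlob) (f : BMap X Y) : bcmp f (bid X) = f.
Proof. now apply BMap_eq. Qed.

Section ClaimLists.
Context (w : G) (A A' C C' : Type) (f' : A' -> BGlob) (f : A -> BGlob)
  (g' : C' -> BGlob) (g : C -> BGlob) (o : A -> A') (d' : A' -> C') (d : A -> C)
  (m : forall a, BMap (f' (o a)) (op_bglob w (f a)))
  (inc' : bool -> forall a', BMap (g' (d' a')) (f' a'))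
  (inc : bool -> forall a, BMap (g (d a)) (f a))
  (J : forall a, BMap (g' (d' (o a))) (op_bglob w (g (d a))))
  (JI : forall a, @is_iso BGLOB _ _ (J a))
  (e' : bool -> bool)
  (sq : forall e a, bcmp (m a) (inc' e (o a)) = bcmp (op_bmap w (inc (e' e) a)) (J a)).

Lemma snoc_inc l a' :
  exists σ : BMap (Wedges g' (map d' (l ++ [a']))) (Wedge (Wedges g' (map d' l)) (g' (d' a'))),
    @is_iso BGLOB _ _ σ /\
    forall e, bcmp (wedges_snoc f' l a') (wedges_map (f' := g') (inc' e) (l ++ [a'])) =
              bcmp (wedge_map (wedges_map (f' := g') (inc' e) l) (inc' e a')) σ.
Proof.
  induction l as [|b l [σ [Hσ E]]]; simpl.
  - exists (wedge_unit (g' (d' a'))); split; [apply wedge_unit_iso|].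
    intros e; apply (wedge_unit_nat (inc' e a')).
  - exists (bcmp (wedge_assoc _ _ _) (wedge_map (bid (g' (d' b))) σ)); split.
    + apply (@is_iso_cmp BGLOB); [apply wedge_assoc_iso|].
      apply wedge_map_iso; [apply (@is_iso_id BGLOB) | exact Hσ].
    + intros e.
      pose proof (@cmpA BGLOB) as AS; simpl in AS. rewrite <- AS, wedge_map_cmp, E.
      rewrite (AS _ _ _ _ (wedge_map (wedge_map _ _) _)), <- wedge_assoc_nat.
      rewrite <- AS, wedge_map_cmp, bcmp_idl, bcmp_idr; reflexivity.
Qed.

Lemma op_wedges_inc l :
  exists j : BMap (Wedges g' (map d' (swap (w 0) (map o l)))) (op_bglob w (Wedges g (map d l))),
    @is_iso BGLOB _ _ j /\
    forall e, bcmp (op_wedges m l) (wedges_map (f' := g') (inc' e) (swap (w 0) (map o l))) =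
              bcmp (op_bmap w (wedges_map (f' := g) (inc (e' e)) l)) j.
Proof.
  pose proof (@cmpA BGLOB) as AS; simpl in AS.
  apply (@op_wedges_elim w A A' f' f o m l (fun b F =>
    exists j : BMap (Wedges g' (map d' (swap b (map o l)))) (op_bglob w (Wedges g (map d l))),
    @is_iso BGLOB _ _ j /\
    forall e, bcmp F (wedges_map (f' := g') (inc' e) (swap b (map o l))) =
              bcmp (op_bmap w (wedges_map (f' := g) (inc (e' e)) l)) j)); intros h; simpl swap;
   (induction l as [|a l [j [Hj E]]]; simpl;
     [exists (op_D0 w); split; [apply op_D0_iso | intros; now apply BMap_eq] |]).
  - destruct (snoc_inc (rev (map o l)) (o a)) as [σ [Hσ Eσ]].
    exists (bcmp (op_wedge_true h (g (d a)) (Wedges g (map d l))) (bcmp (wedge_map j (J a)) σ)); split.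
    + apply (@is_iso_cmp BGLOB); [apply op_wedge_true_iso|].
      apply (@is_iso_cmp BGLOB); [now apply wedge_map_iso | exact Hσ].
    + intros e; rewrite <- !AS, Eσ, (AS _ _ _ _ (wedge_map _ _) (wedge_map _ _)), wedge_map_cmp, E, sq.
      rewrite <- wedge_map_cmp, (AS _ _ _ _ (op_bmap _ _)), <- op_wedge_true_nat, <- !AS.
      reflexivity.
  - exists (bcmp (op_wedge_false h (g (d a)) (Wedges g (map d l))) (wedge_map (J a) j)); split.
    + apply (@is_iso_cmp BGLOB); [apply op_wedge_false_iso|]. now apply wedge_map_iso.
    + intros e; rewrite <- !AS, wedge_map_cmp, E, sq.
      rewrite <- wedge_map_cmp, (AS _ _ _ _ (op_bmap _ _)), <- op_wedge_false_nat, <- !AS.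
      reflexivity.
Qed.

End ClaimLists.

Lemma susp_map_cmp (X Y Z : Glob) (g : GMap Y Z) (f : GMap X Y) :
  susp_map (gcmp g f) = bcmp (susp_map g) (susp_map f).
Proof. apply BMap_eq; now intros [|n] x. Qed.

Lemma op_pos_inc : forall k w B,
  exists j : GMap (Pos (bdry_tree k (op_tree w B))) (op_glob w (Pos (bdry_tree k B))),
    @is_iso GLOB _ _ j /\
    forall e, gcmp (op_pos w B) (bdry_inc e k (op_tree w B)) =
              gcmp (op_gmap w (bdry_inc (xorb e (w k)) k B)) j.
Proof.
  induction k as [|k IH]; intros w B.
  - exists (op_D0 w); split; [exact (biso_iso (op_D0_iso w))|].
    intros e; apply GMap_eq; intros [|n] [].
    etransitivity; [exact (bmap_basepoint e (op_pos w B)) | exact (basepoint_op w e (Pos B))].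
  - pose (j := fun b => proj1_sig (constructive_indefinite_description _ (IH (pred_G w) b))).
    assert (Hj : forall b, @is_iso GLOB _ _ (j b) /\
      forall e, gcmp (op_pos (pred_G w) b) (bdry_inc e k (op_tree (pred_G w) b)) =
              gcmp (op_gmap (pred_G w) (bdry_inc (xorb e (pred_G w k)) k b)) (j b))
      by (intros b; exact (proj2_sig (constructive_indefinite_description _ (IH (pred_G w) b)))).
    destruct B as [l].
    destruct (@op_wedges_inc w tree tree tree tree (fun b => Susp (Pos b)) (fun b => Susp (Pos b))
      (fun b => Susp (Pos b)) (fun b => Susp (Pos b)) (op_tree (pred_G w)) (bdry_tree k) (bdry_tree k)
      (fun b => bcmp (op_susp w (Pos b)) (susp_map (op_pos (pred_G w) b)))
      (fun e b => susp_map (bdry_inc e k b))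
      (fun e b => susp_map (bdry_inc e k b))
      (fun b => bcmp (op_susp w (Pos (bdry_tree k b))) (susp_map (j b))))
      with (e' := fun e => xorb e (w (S k))) (l := l) as [i [Hi E]].
    + intros b; apply (@is_iso_cmp BGLOB); [apply op_susp_iso | apply susp_map_iso, Hj].
    + intros e b.
      pose proof (@cmpA BGLOB) as AS; simpl in AS.
      rewrite <- AS, <- susp_map_cmp.
      etransitivity; [exact (f_equal (fun z => bcmp (op_susp w (Pos b)) (susp_map z)) (proj2 (Hj b) e))|].
      rewrite susp_map_cmp, !AS, op_susp_nat; reflexivity.
    + exists i; split; [exact (biso_iso Hi)|].
      intros e; exact (f_equal (@bmap _ _) (E e)).
Qed.

(** [Stage k] collects what the recursive definition of [k]-computads uses from
    dimension [k - 1]: the category [Comp_{k-1}], the functors [Sph_{k-1}] and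
    [Free_{k-1}], the spheres [(var (src x), var (tgt x))] of [Free_{k-1} X]
    for [x ∈ X_k], the full spheres, and supports.  [Gen C] is the set of
    generators of all dimensions of [C]; [gsupp σ g] is the support of the cell
    to which [σ] sends [g], and [sphsupp (a, b)] is
    [supp a ∪ supp b]. *)

Record Stage (k : nat) := {
  Cat : Category;
  SphF : Functor Cat SetCat;
  FreeF : Functor GLOB Cat;
  fsph : forall X : Glob, X k -> SphF (FreeF X);
  fsph_nat : forall (X Y : Glob) (f : GMap X Y) (x : X k),
    fmap SphF (fmap FreeF f) (fsph x) = fsph (f k x);
  fsph_par : forall (X : Glob) (x : X (S k)), fsph (src x) = fsph (tgt x);
  full : forall B, SphF (FreeF (Pos B)) -> Prop;
  Gen : Cat -> Type;
  gsupp : forall C D : Cat, Hom C D -> Gen C -> Gen D -> Prop;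
  sphsupp : forall C : Cat, SphF C -> Gen C -> Prop
}.

Lemma fun_cmp (C : Category) (F : Functor C SetCat) (x y z : C) (g : Hom y z) (f : Hom x y) a :
  fmap F (g ∘ f) a = fmap F g (fmap F f a).
Proof. now rewrite fmap_cmp. Qed.

Lemma fun_id (C : Category) (F : Functor C SetCat) (x : C) a : fmap F (idm x) a = a.
Proof. now rewrite fmap_id. Qed.

Arguments fun_cmp {C} F {x y z} g f a.
Arguments fun_id {C} F {x} a.

Section Step.
Context (k : nat) (P : Stage k).

Record NComp := {
  low : Cat P;
  gen : Type;
  att : gen -> SphF P low
}.

(** The set [Cell_k C] and the function [bdry] are defined by simultaneous
    induction and recursion.  Since [bdry (coh (B, A, τ))] only depends on the
    [(k-1)]-dimensional part of [τ], this is rendered as a well-formedness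
    predicate on raw cells: [raw] drops the conditions on [B], [A] and [τ] that
    [wf] restores. *)
Inductive raw (C : NComp) : Type :=
| rvar (v : gen C)
| rcoh (B : tree) (A : SphF P (FreeF P (Pos B)))
       (τ : Hom (FreeF P (Pos B)) (low C)) (τV : Pos B k -> raw C).

#[global] Arguments rvar {C} v.
#[global] Arguments rcoh {C} B A τ τV.

Definition rbdry (C : NComp) (r : raw C) : SphF P (low C) :=
  match r with
  | rvar v => att v
  | rcoh B A τ _ => fmap (SphF P) τ A
  end.

Fixpoint wf (C : NComp) (r : raw C) : Prop :=
  match r with
  | rvar _ => True
  | rcoh B A τ τV =>
      0 < k /\ dim B <= k /\ full A /\
      (forall p, wf (τV p)) /\
      (forall p, rbdry (τV p) = fmap (SphF P) τ (fsph P p))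
  end.

Definition cell (C : NComp) : Type := {r : raw C | wf r}.

Lemma cell_eq (C : NComp) (a b : cell C) : proj1_sig a = proj1_sig b -> a = b.
Proof.
  destruct a, b; simpl; intros; subst; f_equal; apply proof_irrelevance.
Qed.

Definition bdry (C : NComp) (a : cell C) : SphF P (low C) := rbdry (proj1_sig a).

Definition var (C : NComp) (v : gen C) : cell C := exist _ (rvar v) I.

Record NMor (C D : NComp) := {
  mlow : Hom (low C) (low D);
  mgen : gen C -> cell D;
  mgen_bdry : forall v, bdry (mgen v) = fmap (SphF P) mlow (att v)
}.

Lemma NMor_eq (C D : NComp) (f g : NMor C D) :
  mlow f = mlow g -> (forall v, proj1_sig (mgen f v) = proj1_sig (mgen g v)) -> f = g.
Proof.
  destruct f as [f1 f2 f3], g as [g1 g2 g3]; simpl; intros <- H.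
  assert (f2 = g2) as <- by (apply functional_extensionality; intro; now apply cell_eq).
  f_equal; apply proof_irrelevance.
Qed.

Definition nfree (X : Glob) : NComp :=
  {| low := FreeF P X; gen := X k; att := @fsph k P X |}.

Definition coh (C : NComp) (hk : 0 < k) (B : tree) (hB : dim B <= k)
    (A : SphF P (FreeF P (Pos B))) (hA : full A) (τ : NMor (nfree (Pos B)) C) : cell C :=
  exist _ (rcoh B A (mlow τ) (fun p => proj1_sig (mgen τ p)))
    (conj hk (conj hB (conj hA (conj (fun p => proj2_sig (mgen τ p)) (mgen_bdry τ))))).

Lemma bdry_coh C hk B hB A hA τ : bdry (@coh C hk B hB A hA τ) = fmap (SphF P) (mlow τ) A.
Proof. reflexivity. Qed.

Lemma cell_induction (C : NComp) (Q : cell C -> Prop) :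
  (forall v, Q (var v)) ->
  (forall hk B (hB : dim B <= k) (A : SphF P (FreeF P (Pos B))) (hA : full A)
          (τ : NMor (nfree (Pos B)) C),
     (forall p, Q (mgen τ p)) -> Q (coh hk hB hA τ)) ->
  forall a, Q a.
Proof.
  intros Hv Hc [r h]; induction r as [v|B A τ τV IH].
  - destruct h; apply Hv.
  - pose (τ' := {| mlow := τ : Hom (low (nfree (Pos B))) (low C);
                   mgen := fun p : gen (nfree (Pos B)) =>
                     exist _ (τV p) (proj1 (proj2 (proj2 (proj2 h))) p) : cell C;
                   mgen_bdry := proj2 (proj2 (proj2 (proj2 h))) |}).
    assert (E : exist _ (rcoh B A τ τV) h =
      coh (proj1 h) (proj1 (proj2 h)) (proj1 (proj2 (proj2 h))) τ') by now apply cell_eq.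
    refine (eq_ind_r Q _ E); apply Hc; intros p; apply IH.
Qed.

Lemma coh_inj (C : NComp) (hk hk' : 0 < k) B (hB hB' : dim B <= k)
    (A A' : SphF P (FreeF P (Pos B))) (hA : full A) (hA' : full A') (τ τ' : NMor (nfree (Pos B)) C) :
  @coh C hk B hB A hA τ = @coh C hk' B hB' A' hA' τ' -> A = A' /\ τ = τ'.
Proof.
  intros E; apply (f_equal (@proj1_sig _ _)) in E; simpl in E; injection E as E1 E2 E3.
  apply inj_pair2 in E1, E2, E3; split; [exact E1|].
  apply NMor_eq; [exact E2|]. intros v; exact (f_equal (fun F => F v) E3).
Qed.

Fixpoint ract (C D : NComp) (σ : NMor C D) (r : raw C) : raw D :=
  match r with
  | rvar v => proj1_sig (mgen σ v)
  | rcoh B A τ τV => rcoh B A (mlow σ ∘ τ) (fun p => ract σ (τV p))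
  end.

Lemma rbdry_ract C D (σ : NMor C D) r :
  rbdry (ract σ r) = fmap (SphF P) (mlow σ) (rbdry r).
Proof.
  destruct r; simpl; [apply mgen_bdry | apply fun_cmp].
Qed.

Lemma wf_ract C D (σ : NMor C D) r : wf r -> wf (ract σ r).
Proof.
  induction r as [v|B A τ τV IH]; simpl.
  - intros _; exact (proj2_sig (mgen σ v)).
  - intros (h1 & h2 & h3 & h4 & h5); repeat split; auto.
    intros p; rewrite rbdry_ract, h5; symmetry; apply fun_cmp.
Qed.

Definition act (C D : NComp) (σ : NMor C D) (a : cell C) : cell D :=
  exist _ (ract σ (proj1_sig a)) (wf_ract σ (proj2_sig a)).

Lemma bdry_act C D (σ : NMor C D) a :
  bdry (act σ a) = fmap (SphF P) (mlow σ) (bdry a).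
Proof. apply rbdry_ract. Qed.

Definition nid (C : NComp) : NMor C C.
Proof.
  refine {| mlow := idm (low C); mgen := @var C |}.
  abstract (intros v; symmetry; apply fun_id).
Defined.

Definition ncmp (C D E : NComp) (σ : NMor D E) (τ : NMor C D) : NMor C E.
Proof.
  refine {| mlow := mlow σ ∘ mlow τ; mgen := fun v => act σ (mgen τ v) |}.
  abstract (intros v; rewrite bdry_act, mgen_bdry; symmetry; apply fun_cmp).
Defined.

Lemma act_coh C D (σ : NMor C D) hk B hB A hA τ :
  act σ (@coh C hk B hB A hA τ) = coh hk hB hA (ncmp σ τ).
Proof. now apply cell_eq. Qed.

Lemma ract_id C (r : raw C) : ract (nid C) r = r.
Proof.
  induction r as [v|B A τ τV IH]; simpl; [reflexivity|].
  rewrite cmp_idl; f_equal; apply functional_extensionality; exact IH.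
Qed.

Lemma ract_cmp C D E (σ : NMor D E) (τ : NMor C D) r :
  ract (ncmp σ τ) r = ract σ (ract τ r).
Proof.
  induction r as [v|B A ρ ρV IH]; simpl; [reflexivity|].
  rewrite cmpA; f_equal; apply functional_extensionality; exact IH.
Qed.

Definition NCat : Category.
Proof.
  refine {| Ob := NComp; Hom := NMor; idm := nid; cmp := ncmp |}.
  - abstract (intros; apply NMor_eq; [apply cmp_idl | intros; apply ract_id]).
  - abstract (intros; apply NMor_eq; [apply cmp_idr | reflexivity]).
  - abstract (intros; apply NMor_eq; [apply cmpA | intros; symmetry; apply ract_cmp]).
Defined.

Definition lowF : Functor NCat (Cat P) :=
  {| fob := low : NCat -> Cat P;
     fmap := mlow;
     fmap_id := fun C => eq_refl;
     fmap_cmp := fun C D E σ τ => eq_refl |}.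

Definition CellF : Functor NCat SetCat.
Proof.
  refine {| fob := cell : NCat -> SetCat; fmap := act |}.
  - abstract (intros; apply functional_extensionality; intros; apply cell_eq, ract_id).
  - abstract (intros; apply functional_extensionality; intros; apply cell_eq, ract_cmp).
Defined.

Definition bdry_nat : CellF ⇒ SphF P ∘F lowF.
Proof.
  exists (bdry : forall C : NCat, CellF C -> SphF P (lowF C)).
  abstract (intros; apply functional_extensionality; intros; apply bdry_act).
Defined.

Definition sphere (C : NComp) : Type := {ab : cell C * cell C | bdry (fst ab) = bdry (snd ab)}.

Definition mksph (C : NComp) (a b : cell C) (h : bdry a = bdry b) : sphere C :=
  exist _ (a, b) h.

Definition pr1 (C : NComp) (s : sphere C) : cell C := fst (proj1_sig s).
Definition pr2 (C : NComp) (s : sphere C) : cell C := snd (proj1_sig s).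

Lemma pr_bdry C (s : sphere C) : bdry (pr1 s) = bdry (pr2 s).
Proof. exact (proj2_sig s). Qed.

Lemma sphere_eq C (s s' : sphere C) : pr1 s = pr1 s' -> pr2 s = pr2 s' -> s = s'.
Proof.
  destruct s as [[a b] h], s' as [[a' b'] h']; unfold pr1, pr2; simpl; intros; subst.
  f_equal; apply proof_irrelevance.
Qed.

Definition sph_act (C D : NComp) (σ : NMor C D) (s : sphere C) : sphere D.
Proof.
  refine (mksph (a := act σ (pr1 s)) (b := act σ (pr2 s)) _).
  abstract (rewrite !bdry_act; f_equal; apply pr_bdry).
Defined.

Definition NSphF : Functor NCat SetCat.
Proof.
  refine {| fob := sphere : NCat -> SetCat; fmap := sph_act |}.
  - abstract (intros; apply functional_extensionality; intros;
      apply sphere_eq; apply (fun_id CellF)).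
  - abstract (intros; apply functional_extensionality; intros;
      apply sphere_eq; apply (fun_cmp CellF)).
Defined.

Definition nfree_map (X Y : Glob) (f : GMap X Y) : NMor (nfree X) (nfree Y).
Proof.
  refine {| mlow := fmap (FreeF P) f : Hom (low (nfree X)) (low (nfree Y));
            mgen := fun x : gen (nfree X) => var (f k x : gen (nfree Y)) |}.
  abstract (intros x; symmetry; apply fsph_nat).
Defined.

Definition NFreeF : Functor GLOB NCat.
Proof.
  refine {| fob := nfree : GLOB -> NCat; fmap := nfree_map |}.
  - abstract (intros; apply NMor_eq; [apply (fmap_id (FreeF P)) | reflexivity]).
  - abstract (intros; apply NMor_eq; [apply (fmap_cmp (FreeF P)) | reflexivity]).
Defined.

Definition nfsph (X : Glob) (x : X (S k)) : sphere (nfree X) :=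
  mksph (a := var (src x : gen (nfree X))) (b := var (tgt x : gen (nfree X))) (fsph_par P x).

Lemma nfsph_nat (X Y : Glob) (f : GMap X Y) (x : X (S k)) :
  sph_act (nfree_map f) (nfsph x) = nfsph (f (S k) x).
Proof.
  apply sphere_eq; apply cell_eq; unfold pr1, pr2; simpl; now rewrite ?gmap_src, ?gmap_tgt.
Qed.

Lemma nfsph_par (X : Glob) (x : X (S (S k))) : nfsph (src x) = nfsph (tgt x).
Proof.
  apply sphere_eq; apply cell_eq; unfold pr1, pr2; simpl; now rewrite ?src_src, ?tgt_src.
Qed.

Definition NGen (C : NComp) : Type := (Gen (low C) + gen C)%type.

Fixpoint rsupp (C : NComp) (r : raw C) (g : NGen C) : Prop :=
  match r with
  | rvar v => match g with
              | inl g => sphsupp (att v) g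
              | inr v' => v' = v
              end
  | rcoh B A τ τV => match g with
                     | inl g => exists q, gsupp τ q g
                     | inr _ => False
                     end \/ exists p, rsupp (τV p) g
  end.

Definition supp (C : NComp) (a : cell C) : NGen C -> Prop := rsupp (proj1_sig a).

Definition nsphsupp (C : NComp) (s : sphere C) (g : NGen C) : Prop :=
  supp (pr1 s) g \/ supp (pr2 s) g.

Definition ngsupp (C D : NComp) (σ : NMor C D) (q : NGen C) (g : NGen D) : Prop :=
  match q, g with
  | inl q, inl g => gsupp (mlow σ) q g
  | inl _, inr _ => False
  | inr v, g => supp (mgen σ v) g
  end.

(** [supp (coh (B, A, τ))] is the union of the supports of the [τ_{j,V} p]. *)
Lemma supp_coh C hk B hB A hA τ g :
  supp (@coh C hk B hB A hA τ) g <-> exists q, ngsupp τ q g.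
Proof.
  unfold supp; simpl; split.
  - intros [H|[p H]]; [|now exists (inr p)].
    destruct g as [g|v]; [|easy]. destruct H as [q H]; now exists (inl q).
  - intros [[q|p] H]; [|right; now exists p].
    destruct g; [|easy]. left; now exists q.
Qed.

Definition nfull (B : tree) (s : sphere (nfree (Pos B))) : Prop :=
  exists a b : cell (nfree (Pos (bdry_tree k B))),
    (forall g, supp a g) /\ (forall g, supp b g) /\
    pr1 s = act (nfree_map (src_inc k B)) a /\
    pr2 s = act (nfree_map (tgt_inc k B)) b.

Definition step : Stage (S k) :=
  {| Cat := NCat;
     SphF := NSphF;
     FreeF := NFreeF;
     fsph := nfsph : forall X : Glob, X (S k) -> NSphF (NFreeF X);
     fsph_nat := nfsph_nat;
     fsph_par := nfsph_par;
     full := nfull : forall B, NSphF (NFreeF (Pos B)) -> Prop;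
     Gen := NGen : NCat -> Type;
     gsupp := ngsupp;
     sphsupp := nsphsupp : forall C : NCat, NSphF C -> NGen C -> Prop |}.

End Step.

Definition TermCat : Category.
Proof.
  refine {| Ob := unit; Hom := fun _ _ => unit;
            idm := fun _ => tt; cmp := fun _ _ _ _ _ => tt |};
    abstract (now intros; repeat match goal with x : unit |- _ => destruct x end).
Defined.

(** Dimension [-1].  Full spheres are only used for coherence cells in positive
    dimension, so [full] plays no role here. *)
Definition stage0 : Stage 0.
Proof.
  refine {| Cat := TermCat;
            SphF := {| fob := fun _ : TermCat => unit : SetCat;
                       fmap := fun _ _ _ s => s;
                       fmap_id := fun _ => eq_refl;
                       fmap_cmp := fun _ _ _ _ _ => eq_refl |};
            FreeF := {| fob := fun _ : GLOB => tt : TermCat;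
                        fmap := fun _ _ _ => tt;
                        fmap_id := fun _ => eq_refl;
                        fmap_cmp := fun _ _ _ _ _ => eq_refl |};
            fsph := fun _ _ => tt;
            full := fun _ _ => False;
            Gen := fun _ => Empty_set;
            gsupp := fun _ _ _ _ _ => False;
            sphsupp := fun _ _ _ => False |};
  abstract reflexivity.
Defined.

Fixpoint stage (k : nat) : Stage k :=
  match k with 0 => stage0 | S k => step (stage k) end.

Record SuppLaws (k : nat) (P : Stage k) : Prop := {
  gsupp_id : forall (C : Cat P) (g : Gen C), gsupp (idm C) g g;
  gsupp_cmp : forall (C D E : Cat P) (σ : Hom D E) (τ : Hom C D) g h,
    gsupp (σ ∘ τ) g h <-> exists g', gsupp τ g g' /\ gsupp σ g' h;
  sphsupp_act : forall (C D : Cat P) (σ : Hom C D) s h,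
    sphsupp (fmap (SphF P) σ s) h <-> exists g, sphsupp s g /\ gsupp σ g h
}.

Section SuppStep.
Context (k : nat) (P : Stage k) (L : SuppLaws P).

Lemma rsupp_bdry (C : NComp P) (r : raw C) h : sphsupp (rbdry r) h -> rsupp r (inl h).
Proof.
  destruct r as [v|B A τ τV]; simpl; [easy|].
  intros H; apply (sphsupp_act L) in H as [g [_ H]]; left; now exists g.
Qed.

Lemma rsupp_act (C D : NComp P) (σ : NMor C D) (r : raw C) h :
  rsupp (ract σ r) h <-> exists g, rsupp r g /\ ngsupp σ g h.
Proof.
  induction r as [v|B A τ τV IH]; simpl.
  - split; [intros H; exists (inr v); now split|].
    intros [[g|v'] [H1 H2]]; [|now subst].
    destruct h as [h|]; [|easy]; simpl in H2.
    apply rsupp_bdry.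
    change (sphsupp (bdry (mgen σ v)) h); rewrite mgen_bdry.
    apply (sphsupp_act L); now exists g.
  - split.
    + intros [H|[p H]].
      * destruct h as [h|]; [|easy]. destruct H as [q H].
        apply (gsupp_cmp L) in H as [g' [H1 H2]].
        exists (inl g'); split; [left; now exists q|exact H2].
      * apply IH in H as [g [H1 H2]]; exists g; split; [right; now exists p|easy].
    + intros [g [[H|[p H]] H2]].
      * destruct g as [g|]; [|easy]. destruct h as [h|]; [|easy].
        destruct H as [q H]; left; exists q; apply (gsupp_cmp L); now exists g.
      * right; exists p; apply IH; now exists g.
Qed.

Lemma SuppLaws_step : SuppLaws (step P).
Proof.
  split.
  - intros C [g|v]; simpl; [apply (gsupp_id L) | reflexivity].
  - intros C D E σ τ [g|v] h; simpl.
    + destruct h as [h|].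
      * rewrite (gsupp_cmp L); split.
        -- intros [g' H]; now exists (inl g').
        -- intros [[g'|] [H1 H2]]; [now exists g' | easy].
      * split; [easy|]. now intros [[g'|] [H1 H2]].
    + apply rsupp_act.
  - intros C D σ s h; simpl; unfold nsphsupp, supp; simpl; rewrite !rsupp_act.
    split; [intros [[g [H1 H2]]|[g [H1 H2]]]; exists g; auto|].
    intros [g [[H1|H1] H2]]; [left|right]; now exists g.
Qed.

End SuppStep.

Lemma SuppLaws_stage k : SuppLaws (stage k).
Proof.
  induction k; [split; simpl; try easy | now apply SuppLaws_step].
Qed.

Definition op_pos_mor (w : G) (B : tree) : @Hom GLOB (Pos (op_tree w B)) (op_glob w (Pos B)) :=
  bmap (op_pos w B).

Lemma op_pos_invl w B : op_pos_inv w B ∘ op_pos_mor w B = @idm GLOB (Pos (op_tree w B)).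
Proof. exact (inv_l (op_pos_iso w B)). Qed.

Lemma op_pos_invr w B : op_pos_mor w B ∘ op_pos_inv w B = @idm GLOB (op_glob w (Pos B)).
Proof. exact (inv_r (op_pos_iso w B)). Qed.

Lemma cancel_mid (C : Category) (v x y z : C) (t : Hom y z) (f : Hom x y) (g : Hom v x)
    (g' : Hom x v) (f' : Hom y x) :
  g ∘ g' = idm x -> f ∘ f' = idm y -> t ∘ f ∘ g ∘ (g' ∘ f') = t.
Proof.
  intros E1 E2; rewrite cmpA, <- (cmpA (t ∘ f)), E1, cmp_idr, <- cmpA, E2; apply cmp_idr.
Qed.

Lemma cancel_mid2 (C : Category) (x y z : C) (f : Hom y z) (g : Hom x y)
    (g' : Hom y x) (f' : Hom z y) :
  g ∘ g' = idm y -> f ∘ f' = idm z -> f ∘ g ∘ (g' ∘ f') = idm z.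
Proof.
  intros E1 E2; rewrite cmpA, <- (cmpA f), E1, cmp_idr; exact E2.
Qed.

Lemma op_pos_cancel_l w B n x : op_pos_inv w B n (op_pos w B n x) = x.
Proof. exact (f_equal (fun f : GMap _ _ => f n x) (op_pos_invl w B)). Qed.

Lemma op_pos_cancel_r w B n x : op_pos w B n (op_pos_inv w B n x) = x.
Proof. exact (f_equal (fun f : GMap _ _ => f n x) (op_pos_invr w B)). Qed.

Section Op.
Context (w : G).

(** [OpData P] collects what the definition of [op_w] in dimension [k] uses
    from dimension [k - 1].  The functors [op_w Free] and [Free op_w] are equal;
    [opfree] and [opfree'] are the corresponding identity transformations, which
    are given by [var] on generators. *)
Record OpData (k : nat) (P : Stage k) := {
  opF : Functor (Cat P) (Cat P);
  opSph : SphF P ⇒ SphF P ∘F opF;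
  opfree : FreeF P ∘F op_Glob w ⇒ opF ∘F FreeF P;
  opfree' : opF ∘F FreeF P ⇒ FreeF P ∘F op_Glob w;
  opfreeK : forall X, opfree' X ∘ opfree X = idm (FreeF P (op_Glob w X));
  opfreeK' : forall X, opfree X ∘ opfree' X = idm (opF (FreeF P X));
  opfree_fsph : forall (X : Glob) (x : X k),
    fmap (SphF P) (opfree X) (@fsph k P (op_glob w X) x) = opSph (FreeF P X) (fsph P x);
  opGen : forall C : Cat P, Gen C -> Gen (opF C)
}.

(** The sphere [A' = Sph Free ((op_w^B)^{-1}) (op^Sph A)]. *)
Definition op_filler (k : nat) (P : Stage k) (D : OpData P) (B : tree)
    (A : SphF P (FreeF P (Pos B))) : SphF P (FreeF P (Pos (op_tree w B))) :=
  fmap (SphF P) (fmap (FreeF P) (op_pos_inv w B))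
    (fmap (SphF P) (opfree' D (Pos B)) (opSph D (FreeF P (Pos B)) A)).

Record OpLaws (k : nat) (P : Stage k) (D : OpData P) : Prop := {
  op_faithful : forall (X Y : Cat P) (σ τ : Hom X Y), fmap (opF D) σ = fmap (opF D) τ -> σ = τ;
  op_fullF : forall (X Y : Cat P) (τ : Hom (opF D X) (opF D Y)), exists σ, fmap (opF D) σ = τ;
  opSph_inj : forall X s s', opSph D X s = opSph D X s' -> s = s';
  opSph_surj : forall X s', exists s, opSph D X s = s';
  opGen_surj : forall X g', exists g, opGen D (C := X) g = g';
  gsupp_op : forall (X Y : Cat P) (σ : Hom X Y) g h,
    gsupp (fmap (opF D) σ) (opGen D g) (opGen D h) <-> gsupp σ g h;
  sphsupp_op : forall (X : Cat P) s (g : Gen X),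
    @sphsupp k P (opF D X) (opSph D X s) (opGen D g) <-> sphsupp s g;
  full_op : forall B (A : SphF P (FreeF P (Pos B))), full (op_filler D A) <-> full A
}.

Section OpStep.
Context (k : nat) (P : Stage k) (SL : SuppLaws P) (D : OpData P) (L : OpLaws D).

Definition op_comp (C : NComp P) : NComp P :=
  {| low := opF D (low C); gen := gen C; att := fun v => opSph D (low C) (att v) |}.

(** The underlying morphism of [op τ ∘ Free (op_w^B)] in dimension [k - 1]. *)
Definition op_low (C : NComp P) (B : tree) (τ : Hom (FreeF P (Pos B)) (low C)) :
    Hom (FreeF P (Pos (op_tree w B))) (low (op_comp C)) :=
  fmap (opF D) τ ∘ opfree D (Pos B) ∘ fmap (FreeF P) (op_pos_mor w B).

Fixpoint op_raw (C : NComp P) (r : raw C) : raw (op_comp C) :=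
  match r with
  | rvar v => @rvar k P (op_comp C) v
  | rcoh B A τ τV =>
      rcoh (op_tree w B) (op_filler D A) (op_low τ) (fun p => op_raw (τV (op_pos w B k p)))
  end.

Lemma opSph_nat X Y (σ : Hom X Y) s :
  fmap (SphF P) (fmap (opF D) σ) (opSph D X s) = opSph D Y (fmap (SphF P) σ s).
Proof. exact (f_equal (fun f => f s) (eq_sym (ncomp_nat (opSph D) σ))). Qed.

Lemma op_low_inv C B (τ : Hom (FreeF P (Pos B)) (low C)) :
  op_low τ ∘ (fmap (FreeF P) (op_pos_inv w B) ∘ opfree' D (Pos B)) = fmap (opF D) τ.
Proof.
  exact (cancel_mid _ (fmap_retract (FreeF P) (op_pos_invr w B)) (opfreeK' D (Pos B))).
Qed.

Lemma rbdry_op C (r : raw C) : rbdry (op_raw r) = opSph D (low C) (rbdry r).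
Proof.
  destruct r as [v|B A τ τV]; simpl; [reflexivity|].
  unfold op_filler; etransitivity; [|apply opSph_nat].
  rewrite <- (op_low_inv τ); symmetry.
  etransitivity; [apply fun_cmp | apply f_equal, fun_cmp].
Qed.

Lemma op_low_fsph C B (τ : Hom (FreeF P (Pos B)) (low C)) p :
  fmap (SphF P) (op_low τ) (fsph P p) =
  opSph D (low C) (fmap (SphF P) τ (fsph P (op_pos w B k p : Pos B k))).
Proof.
  unfold op_low; rewrite !fun_cmp.
  etransitivity; [apply f_equal, f_equal, (fsph_nat P (op_pos w B : GMap _ (op_glob w (Pos B))))|].
  etransitivity; [apply f_equal, (opfree_fsph D (X := Pos B))|].
  apply opSph_nat.
Qed.

Lemma wf_op C (r : raw C) : wf r -> wf (op_raw r).
Proof.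
  induction r as [v|B A τ τV IH]; simpl; [easy|].
  intros (h1 & h2 & h3 & h4 & h5); repeat split; auto.
  - now rewrite dim_op_tree.
  - now apply (full_op L).
  - intros p; rewrite rbdry_op, h5; symmetry; apply op_low_fsph.
Qed.

Definition op_cell (C : NComp P) (a : cell C) : cell (op_comp C) :=
  exist _ (op_raw (proj1_sig a)) (wf_op (proj2_sig a)).

Lemma bdry_op C (a : cell C) : bdry (op_cell a) = opSph D (low C) (bdry a).
Proof. apply rbdry_op. Qed.

Definition op_mor (C E : NComp P) (σ : NMor C E) : NMor (op_comp C) (op_comp E).
Proof.
  refine {| mlow := fmap (opF D) (mlow σ) : Hom (low (op_comp C)) (low (op_comp E));
            mgen := fun v : gen (op_comp C) => op_cell (mgen σ v) |}.
  abstract (intros v; rewrite bdry_op, mgen_bdry; symmetry; apply opSph_nat).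
Defined.

Lemma op_raw_ract C E (σ : NMor C E) r : op_raw (ract σ r) = ract (op_mor σ) (op_raw r).
Proof.
  induction r as [v|B A τ τV IH]; simpl; [reflexivity|].
  unfold op_low; rewrite fmap_cmp, !cmpA; f_equal.
  apply functional_extensionality; intros p; apply IH.
Qed.

Definition op_NF : Functor (NCat P) (NCat P).
Proof.
  refine {| fob := op_comp : NCat P -> NCat P; fmap := op_mor |}.
  - abstract (intros; apply NMor_eq; [apply (fmap_id (opF D)) | reflexivity]).
  - abstract (intros; apply NMor_eq; [apply (fmap_cmp (opF D)) | intros; apply op_raw_ract]).
Defined.

Definition opCell : CellF P ⇒ CellF P ∘F op_NF.
Proof.
  exists (op_cell : forall C : NCat P, CellF P C -> CellF P (op_NF C)).
  abstract (intros; apply functional_extensionality; intros; apply cell_eq, op_raw_ract).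
Defined.

Lemma op_sphere_bdry C (s : sphere C) : bdry (op_cell (pr1 s)) = bdry (op_cell (pr2 s)).
Proof. now rewrite !bdry_op, pr_bdry. Qed.

Definition op_sphere (C : NComp P) (s : sphere C) : sphere (op_comp C) :=
  if w k then mksph (eq_sym (op_sphere_bdry s)) else mksph (op_sphere_bdry s).

Lemma pr1_op C (s : sphere C) : pr1 (op_sphere s) = op_cell (if w k then pr2 s else pr1 s).
Proof. unfold op_sphere; now destruct (w k). Qed.

Lemma pr2_op C (s : sphere C) : pr2 (op_sphere s) = op_cell (if w k then pr1 s else pr2 s).
Proof. unfold op_sphere; now destruct (w k). Qed.

Lemma op_sphere_nat C E (σ : NMor C E) s :
  op_sphere (sph_act σ s) = sph_act (op_mor σ) (op_sphere s).
Proof.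
  unfold op_sphere; destruct (w k);
    apply sphere_eq; apply cell_eq; unfold pr1, pr2; simpl; apply op_raw_ract.
Qed.

Definition op_NSph : NSphF P ⇒ NSphF P ∘F op_NF.
Proof.
  exists (op_sphere : forall C : NCat P, NSphF P C -> NSphF P (op_NF C)).
  abstract (intros; apply functional_extensionality; intros; apply op_sphere_nat).
Defined.

Definition nopfree_mor (X : Glob) : NMor (nfree P (op_glob w X)) (op_comp (nfree P X)).
Proof.
  refine {| mlow := opfree D X : Hom (low (nfree P (op_glob w X))) (low (op_comp (nfree P X)));
            mgen := fun x : gen (nfree P (op_glob w X)) => var (x : gen (op_comp (nfree P X))) |}.
  abstract (intros x; symmetry; apply (opfree_fsph D)).
Defined.

Definition nopfree_mor' (X : Glob) : NMor (op_comp (nfree P X)) (nfree P (op_glob w X)).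
Proof.
  refine {| mlow := opfree' D X : Hom (low (op_comp (nfree P X))) (low (nfree P (op_glob w X)));
            mgen := fun x : gen (op_comp (nfree P X)) => var (x : gen (nfree P (op_glob w X))) |}.
  abstract (intros x; simpl; rewrite <- (opfree_fsph D); etransitivity;
    [|apply (fun_cmp (SphF P))]; etransitivity;
    [|apply (f_equal (fun f => fmap (SphF P) f _)); symmetry; apply opfreeK];
    symmetry; apply fun_id).
Defined.

(** [op^Cell (coh (B, A, τ)) = coh (op_w B, A', op τ ∘ Free (op_w^B))], with
    [nopfree_mor] the identity [Free op_w = op_w Free]. *)
Lemma op_cell_coh C (hk : 0 < k) B (hB : dim B <= k) (A : SphF P (FreeF P (Pos B)))
    (hA : full A) (τ : NMor (nfree P (Pos B)) C) :
  op_cell (coh hk hB hA τ) =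
  coh hk (eq_ind_r (fun d => d <= k) hB (dim_op_tree B w)) (proj2 (full_op L A) hA)
    (ncmp (ncmp (op_mor τ) (nopfree_mor (Pos B))) (nfree_map P (op_pos_mor w B))).
Proof. now apply cell_eq. Qed.

Definition nopfree : NFreeF P ∘F op_Glob w ⇒ op_NF ∘F NFreeF P.
Proof.
  exists (nopfree_mor : forall X, Hom ((NFreeF P ∘F op_Glob w) X) ((op_NF ∘F NFreeF P) X)).
  abstract (intros; apply NMor_eq; [apply (ncomp_nat (opfree D)) | reflexivity]).
Defined.

Definition nopfree' : op_NF ∘F NFreeF P ⇒ NFreeF P ∘F op_Glob w.
Proof.
  exists (nopfree_mor' : forall X, Hom ((op_NF ∘F NFreeF P) X) ((NFreeF P ∘F op_Glob w) X)).
  abstract (intros; apply NMor_eq; [apply (ncomp_nat (opfree' D)) | reflexivity]).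
Defined.

Definition op_ngen (C : NComp P) (g : NGen C) : NGen (op_comp C) :=
  match g with inl g => inl (opGen D g) | inr v => inr v end.

Definition op_step_data : OpData (step P).
Proof.
  refine (@Build_OpData _ (step P) op_NF op_NSph nopfree nopfree' _ _ _ op_ngen).
  - abstract (intros; apply NMor_eq; [apply opfreeK | reflexivity]).
  - abstract (intros; apply NMor_eq; [apply opfreeK' | reflexivity]).
  - abstract (intros; simpl; unfold op_sphere; apply sphere_eq; apply cell_eq;
      destruct (w k) eqn:E; unfold pr1, pr2; simpl; now rewrite E).
Defined.

Definition fill_mor (B : tree) : Hom (opF D (FreeF P (Pos B))) (FreeF P (Pos (op_tree w B))) :=
  fmap (FreeF P) (op_pos_inv w B) ∘ opfree' D (Pos B).

Definition fill_mor_inv (B : tree) : Hom (FreeF P (Pos (op_tree w B))) (opF D (FreeF P (Pos B))) :=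
  opfree D (Pos B) ∘ fmap (FreeF P) (op_pos_mor w B).

Lemma fill_mor_l B : fill_mor_inv B ∘ fill_mor B = idm _.
Proof.
  exact (cancel_mid2 (fmap_retract (FreeF P) (op_pos_invr w B)) (opfreeK' D (Pos B))).
Qed.

Lemma fill_mor_r B : fill_mor B ∘ fill_mor_inv B = idm _.
Proof.
  exact (cancel_mid2 (opfreeK D (Pos B)) (fmap_retract (FreeF P) (op_pos_invl w B))).
Qed.

Lemma op_filler_eq B (A : SphF P (FreeF P (Pos B))) :
  op_filler D A = fmap (SphF P) (fill_mor B) (opSph D _ A).
Proof. symmetry; apply fun_cmp. Qed.

Lemma op_low_eq C B (τ : Hom (FreeF P (Pos B)) (low C)) :
  op_low τ = fmap (opF D) τ ∘ fill_mor_inv B.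
Proof. symmetry; apply cmpA. Qed.

Lemma op_filler_inj B (A A' : SphF P (FreeF P (Pos B))) :
  op_filler D A = op_filler D A' -> A = A'.
Proof.
  rewrite !op_filler_eq; intros E.
  apply (f_equal (fmap (SphF P) (fill_mor_inv B))) in E.
  rewrite <- !(fun_cmp (SphF P)), fill_mor_l, !fun_id in E; exact (opSph_inj L E).
Qed.

Lemma op_filler_surj B A' : exists A : SphF P (FreeF P (Pos B)), op_filler D A = A'.
Proof.
  destruct (opSph_surj L (fmap (SphF P) (fill_mor_inv B) A')) as [A E].
  exists A; rewrite op_filler_eq, E, <- (fun_cmp (SphF P)), fill_mor_r; apply fun_id.
Qed.

Lemma op_low_inj C B (τ τ' : Hom (FreeF P (Pos B)) (low C)) : op_low τ = op_low τ' -> τ = τ'.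
Proof.
  intros E; apply (op_faithful L); now rewrite <- op_low_inv, E, op_low_inv.
Qed.

Lemma op_low_surj C B τ' : exists τ : Hom (FreeF P (Pos B)) (low C), op_low τ = τ'.
Proof.
  destruct (op_fullF L (τ' ∘ fill_mor B)) as [τ E].
  exists τ; rewrite op_low_eq, E, <- cmpA, fill_mor_r; apply cmp_idr.
Qed.

Lemma rcoh_inj (C : NComp P) B A τ τV A' τ' τV' :
  @rcoh k P C B A τ τV = rcoh B A' τ' τV' -> A = A' /\ τ = τ' /\ τV = τV'.
Proof.
  intros E; injection E as E1 E2 E3; apply inj_pair2 in E1, E2, E3; auto.
Qed.

Lemma op_raw_inj C (r r' : raw C) : op_raw r = op_raw r' -> r = r'.
Proof.
  revert r'; induction r as [v|B A τ τV IH]; intros [v'|B' A' τ' τV']; simpl; try easy.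
  - intros E; injection E as ->; reflexivity.
  - intros E.
    assert (EB : B = B').
    { injection E; intros _ _ _ EB.
      now rewrite <- (op_tree_invol B w), EB, op_tree_invol. }
    subst B'; apply rcoh_inj in E as (E1 & E2 & E3).
    apply op_filler_inj in E1 as <-; apply op_low_inj in E2 as <-; f_equal.
    apply functional_extensionality; intros p; apply IH.
    pose proof (f_equal (fun f => f (op_pos_inv w B k p)) E3) as E; simpl in E.
    rewrite !op_pos_cancel_r in E; exact E.
Qed.

Lemma op_raw_surj C (r' : raw (op_comp C)) : wf r' -> exists r : raw C, wf r /\ op_raw r = r'.
Proof.
  induction r' as [v|B' A' τ' τV' IH]; [now exists (@rvar k P C v)|].
  assert (EB : exists B, B' = op_tree w B) by (exists (op_tree w B'); now rewrite op_tree_invol).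
  destruct EB as [B ->]; simpl; intros (h1 & h2 & h3 & h4 & h5).
  destruct (op_filler_surj A') as [A <-], (op_low_surj τ') as [τ <-].
  pose (V := fun p : Pos B k => constructive_indefinite_description _
     (IH (op_pos_inv w B k p) (h4 (op_pos_inv w B k p)))).
  exists (rcoh B A τ (fun p => proj1_sig (V p))); simpl; repeat split; auto.
  - now rewrite dim_op_tree in h2.
  - now apply (full_op L).
  - intros p; exact (proj1 (proj2_sig (V p))).
  - intros p; apply (opSph_inj L).
    rewrite <- rbdry_op, (proj2 (proj2_sig (V p))), h5.
    etransitivity; [apply op_low_fsph|]; do 3 apply f_equal; apply op_pos_cancel_r.
  - f_equal; apply functional_extensionality; intros p.
    etransitivity; [exact (proj2 (proj2_sig (V (op_pos w B k p))))|].
    now rewrite op_pos_cancel_l.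
Qed.

Lemma op_cell_inj C (a a' : cell C) : op_cell a = op_cell a' -> a = a'.
Proof.
  intros E; apply cell_eq, op_raw_inj; exact (f_equal (@proj1_sig _ _) E).
Qed.

Lemma op_cell_surj C (a' : cell (op_comp C)) : exists a, op_cell a = a'.
Proof.
  destruct a' as [r' h']; destruct (op_raw_surj h') as [r [h E]].
  exists (exist _ r h); now apply cell_eq.
Qed.

Lemma gsupp_op_low C B (τ : Hom (FreeF P (Pos B)) (low C)) g :
  (exists q, gsupp (op_low τ) q (opGen D g)) <-> (exists q, gsupp τ q g).
Proof.
  pose proof (op_low_inv τ) as E.
  split; intros [q H].
  - rewrite op_low_eq in H; apply (gsupp_cmp SL) in H as [q' [_ H]].
    destruct (opGen_surj L q') as [q'' <-]; exists q''; now apply (gsupp_op L).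
  - apply (gsupp_op L) in H; rewrite <- E in H.
    apply (gsupp_cmp SL) in H as [q' [_ H]]; now exists q'.
Qed.

Lemma rsupp_op C (r : raw C) g : rsupp (op_raw r) (op_ngen g) <-> rsupp r g.
Proof.
  induction r as [v|B A τ τV IH]; simpl.
  - destruct g as [g|v']; simpl; [apply (sphsupp_op L) | reflexivity].
  - assert (E1 : match op_ngen g with inl g => exists q, gsupp (op_low τ) q g | inr _ => False end
              <-> match g with inl g => exists q, gsupp τ q g | inr _ => False end)
      by (destruct g; [apply gsupp_op_low | reflexivity]).
    assert (E2 : (exists p, rsupp (op_raw (τV (op_pos w B k p))) (op_ngen g)) <->
                 (exists p, rsupp (τV p) g)).
    { split; intros [p H].
      - apply IH in H; eauto.
      - exists (op_pos_inv w B k p); apply IH; now rewrite op_pos_cancel_r. }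
    tauto.
Qed.

Lemma supp_full_act (C E : NComp P) (σ : NMor C E) (σ' : NMor E C) (a : cell C) :
  ncmp σ σ' = nid E -> (forall g, supp a g) -> forall h, supp (act σ a) h.
Proof.
  intros K H h; apply (rsupp_act SL).
  pose proof (gsupp_id (SuppLaws_step SL) h) as I; simpl in I; rewrite <- K in I.
  apply (gsupp_cmp (SuppLaws_step SL)) in I as [g' [_ I]].
  exists g'; split; [apply H | exact I].
Qed.

Lemma op_full_mor : forall (C E : NComp P) (τ : NMor (op_comp C) (op_comp E)),
  exists σ, op_mor σ = τ.
Proof.
  intros C E τ; destruct (op_fullF L (mlow τ)) as [σ Eσ].
  pose (V := fun v => constructive_indefinite_description _ (op_cell_surj (mgen τ v))).
  unshelve eexists {| mlow := σ; mgen := fun v => proj1_sig (V v) |}.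
  - intros v; apply (opSph_inj L); rewrite <- bdry_op, (proj2_sig (V v)), mgen_bdry.
    simpl in Eσ; rewrite <- Eσ; apply opSph_nat.
  - apply NMor_eq; [exact Eσ | intros v; exact (f_equal (@proj1_sig _ _) (proj2_sig (V v)))].
Qed.

Lemma op_faithful_mor : forall (C E : NComp P) (σ τ : NMor C E), op_mor σ = op_mor τ -> σ = τ.
Proof.
  intros C E σ τ H; apply NMor_eq.
  - apply (op_faithful L); exact (f_equal (@mlow _ _ _ _) H).
  - intros v; apply op_raw_inj.
    exact (f_equal (fun ρ : NMor (op_comp C) (op_comp E) => proj1_sig (mgen ρ (v : gen (op_comp C)))) H).
Qed.

Lemma op_sphere_inj C (s s' : sphere C) : op_sphere s = op_sphere s' -> s = s'.
Proof.
  intros E.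
  pose proof (f_equal (@pr1 _ _ _) E) as E1; pose proof (f_equal (@pr2 _ _ _) E) as E2.
  rewrite !pr1_op in E1; rewrite !pr2_op in E2; apply op_cell_inj in E1, E2.
  destruct (w k); now apply sphere_eq.
Qed.

Lemma op_sphere_surj C (s' : sphere (op_comp C)) : exists s, op_sphere s = s'.
Proof.
  destruct (op_cell_surj (pr1 s')) as [a Ea], (op_cell_surj (pr2 s')) as [b Eb].
  assert (h : bdry a = bdry b).
  { apply (opSph_inj L); rewrite <- !bdry_op, Ea, Eb; exact (pr_bdry s'). }
  exists (if w k then mksph (eq_sym h) else mksph h).
  apply sphere_eq; rewrite ?pr1_op, ?pr2_op; now destruct (w k).
Qed.

Definition conv (B : tree) (a : cell (nfree P (Pos (op_tree w B)))) :
    cell (op_comp (nfree P (Pos B))) :=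
  act (nopfree_mor (Pos B)) (act (nfree_map P (op_pos_mor w B)) a).

Lemma nopfree_retract X : ncmp (nopfree_mor X) (nopfree_mor' X) = nid (op_comp (nfree P X)).
Proof. apply NMor_eq; [exact (opfreeK' D X) | reflexivity]. Qed.

Lemma nopfree_retract' X : ncmp (nopfree_mor' X) (nopfree_mor X) = nid (nfree P (op_glob w X)).
Proof. apply NMor_eq; [exact (opfreeK D X) | reflexivity]. Qed.

Lemma nfree_map_retract (X Y : Glob) (f : GMap X Y) (g : GMap Y X) :
  gcmp g f = gid X -> ncmp (nfree_map P g) (nfree_map P f) = nid (nfree P X).
Proof. exact (@fmap_retract GLOB _ (NFreeF P) X Y g f). Qed.

Lemma act_cmp (C E F : NComp P) (σ : NMor E F) (τ : NMor C E) a :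
  act (ncmp σ τ) a = act σ (act τ a).
Proof. exact (fun_cmp (CellF P) (x := C) (y := E) (z := F) σ τ a). Qed.

Lemma act_id (C : NComp P) a : act (nid C) a = a.
Proof. exact (fun_id (CellF P) (x := C) a). Qed.

Lemma nfree_act_square (X Y Y' Z : Glob) (g : GMap Y Z) (f : GMap X Y) (g' : GMap Y' Z)
    (f' : GMap X Y') a :
  gcmp g f = gcmp g' f' ->
  act (nfree_map P g) (act (nfree_map P f) a) = act (nfree_map P g') (act (nfree_map P f') a).
Proof.
  intros E; rewrite <- !act_cmp; f_equal.
  exact (@fmap_square GLOB _ (NFreeF P) X Y Y' Z g f g' f' E).
Qed.

Lemma nopfree_act (X Y : Glob) (f : GMap X Y) a :
  act (nopfree_mor Y) (act (nfree_map P (op_gmap w f)) a) =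
  act (op_mor (nfree_map P f)) (act (nopfree_mor X) a).
Proof.
  rewrite <- !act_cmp; f_equal.
  exact (ncomp_nat nopfree f).
Qed.

Lemma op_cell_act (C E : NComp P) (σ : NMor C E) a :
  op_cell (act σ a) = act (op_mor σ) (op_cell a).
Proof. apply cell_eq, op_raw_ract. Qed.

Lemma filler_conv1 B (A : sphere (nfree P (Pos B))) a :
  pr1 (op_filler op_step_data A) = a <-> conv a = pr1 (op_sphere A).
Proof.
  change (pr1 (op_filler op_step_data A)) with
    (act (nfree_map P (op_pos_inv w B)) (act (nopfree_mor' (Pos B)) (pr1 (op_sphere A)))).
  unfold conv; split.
  - intros <-.
    rewrite <- (act_cmp (nfree_map P (op_pos_mor w B))).
    rewrite (nfree_map_retract (op_pos_invr w B)), act_id, <- act_cmp, nopfree_retract; apply act_id.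
  - intros <-.
    rewrite <- (act_cmp (nopfree_mor' (Pos B))), nopfree_retract', act_id, <- act_cmp.
    rewrite (nfree_map_retract (op_pos_invl w B)); apply act_id.
Qed.

Lemma filler_conv2 B (A : sphere (nfree P (Pos B))) a :
  pr2 (op_filler op_step_data A) = a <-> conv a = pr2 (op_sphere A).
Proof.
  change (pr2 (op_filler op_step_data A)) with
    (act (nfree_map P (op_pos_inv w B)) (act (nopfree_mor' (Pos B)) (pr2 (op_sphere A)))).
  unfold conv; split.
  - intros <-.
    rewrite <- (act_cmp (nfree_map P (op_pos_mor w B))).
    rewrite (nfree_map_retract (op_pos_invr w B)), act_id, <- act_cmp, nopfree_retract; apply act_id.
  - intros <-.
    rewrite <- (act_cmp (nopfree_mor' (Pos B))), nopfree_retract', act_id, <- act_cmp.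
    rewrite (nfree_map_retract (op_pos_invl w B)); apply act_id.
Qed.

(** A cell of [Free Pos B] comes from a cell of the source (target) boundary with
    full support iff its opposite comes from the corresponding boundary of
    [op_w B]. *)
Definition covers (e : bool) (B : tree) (a : cell (nfree P (Pos B))) : Prop :=
  exists a' : cell (nfree P (Pos (bdry_tree k B))),
    (forall g, supp a' g) /\ a = act (nfree_map P (bdry_inc e k B)) a'.

Lemma covers_op e B (a : cell (nfree P (Pos B))) (a1 : cell (nfree P (Pos (op_tree w B)))) :
  conv a1 = op_cell a -> covers e a1 <-> covers (xorb e (w k)) a.
Proof.
  intros H; destruct (op_pos_inc k w B) as [j [[j' [Hj1 Hj2]] Hj]].
  assert (K : forall c, conv (act (nfree_map P (bdry_inc e k (op_tree w B))) c) =
    act (op_mor (nfree_map P (bdry_inc (xorb e (w k)) k B)))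
      (act (nopfree_mor _) (act (nfree_map P j) c))).
  { intros c; unfold conv; rewrite <- nopfree_act; f_equal.
    exact (nfree_act_square c (Hj e)). }
  split; intros [c [Hc Ec]].
  - rewrite Ec, K in H.
    destruct (op_cell_surj (act (nopfree_mor _) (act (nfree_map P j) c))) as [d Ed].
    exists d; split.
    + intros g; apply rsupp_op.
      change (supp (op_cell d) (op_ngen g)); rewrite Ed.
      apply (supp_full_act (nopfree_retract _)), (supp_full_act (σ' := nfree_map P j')); [|exact Hc].
      exact (nfree_map_retract Hj2).
    + apply op_cell_inj; rewrite op_cell_act, Ed; now rewrite <- H.
  - exists (act (nfree_map P j') (act (nopfree_mor' _) (op_cell c))); split.
    + apply (supp_full_act (σ' := nfree_map P j)); [exact (nfree_map_retract Hj1)|].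
      apply (supp_full_act (nopfree_retract' _)).
      intros [g|v].
      * destruct (opGen_surj L g) as [g' <-]; apply (rsupp_op (proj1_sig c) (inl g')), Hc.
      * apply (rsupp_op (proj1_sig c) (inr v)), Hc.
    + assert (CI : forall x y, @conv B x = conv y -> x = y).
      { intros x y E.
        apply (f_equal (fun z => act (nfree_map P (op_pos_inv w B)) (act (nopfree_mor' (Pos B)) z))) in E.
        unfold conv in E.
        rewrite <- !(act_cmp (nopfree_mor' (Pos B))), nopfree_retract', !act_id, <- !act_cmp in E.
        now rewrite (nfree_map_retract (op_pos_invl w B)), !act_id in E. }
      apply CI; rewrite K, H, Ec, op_cell_act; f_equal.
      rewrite <- (act_cmp (nfree_map P j)), (nfree_map_retract Hj2), act_id.
      rewrite <- act_cmp, nopfree_retract; symmetry; apply act_id.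
Qed.

Lemma nfull_covers B (s : sphere (nfree P (Pos B))) :
  nfull s <-> covers false (pr1 s) /\ covers true (pr2 s).
Proof.
  split.
  - intros (a & b & Ha & Hb & Ea & Eb); split; [now exists a | now exists b].
  - intros ([a [Ha Ea]] & [b [Hb Eb]]); now exists a, b.
Qed.

Lemma nfull_op B (A : sphere (nfree P (Pos B))) :
  nfull (op_filler op_step_data A) <-> nfull A.
Proof.
  rewrite !nfull_covers.
  pose proof (proj1 (@filler_conv1 B A _) eq_refl) as H1.
  pose proof (proj1 (@filler_conv2 B A _) eq_refl) as H2.
  rewrite pr1_op in H1; rewrite pr2_op in H2.
  rewrite (covers_op false H1), (covers_op true H2).
  destruct (w k); simpl; tauto.
Qed.

Lemma op_step_laws : OpLaws op_step_data.
Proof.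
  split.
  - exact op_faithful_mor.
  - exact op_full_mor.
  - exact op_sphere_inj.
  - exact op_sphere_surj.
  - intros X [g|v]; [|now exists (inr v)].
    destruct (opGen_surj L g) as [g' <-]; now exists (inl g').
  - intros X Y σ [g|v] [h|v']; simpl; try easy.
    + apply (gsupp_op L).
    + apply (rsupp_op (proj1_sig (mgen σ v)) (inl h)).
    + apply (rsupp_op (proj1_sig (mgen σ v)) (inr v')).
  - intros X s g; simpl; unfold nsphsupp; rewrite pr1_op, pr2_op.
    pose proof (rsupp_op (proj1_sig (pr1 s)) g) as E1.
    pose proof (rsupp_op (proj1_sig (pr2 s)) g) as E2.
    unfold supp; destruct (w k); simpl; tauto.
  - exact nfull_op.
Qed.

End OpStep.

Definition op_stage0_data : OpData stage0.
Proof.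
  unshelve refine {| opF := idF TermCat : Functor (Cat stage0) (Cat stage0);
                     opGen := fun _ g => g |}.
  - exists (fun _ s => s); reflexivity.
  - exists (fun _ => tt); reflexivity.
  - exists (fun _ => tt); reflexivity.
  - reflexivity.
  - reflexivity.
  - reflexivity.
Defined.

Lemma op_stage0_laws : OpLaws op_stage0_data.
Proof.
  split; simpl; try easy.
  - intros _ _ s; now exists s.
  - intros _ s; now exists s.
Qed.

Fixpoint op_stage (k : nat) : {D : OpData (stage k) | OpLaws D} :=
  match k return {D : OpData (stage k) | OpLaws D} with
  | 0 => exist _ op_stage0_data op_stage0_laws
  | S k => exist _ (op_step_data (proj2_sig (op_stage k)))
                   (op_step_laws (SuppLaws_stage k) (proj2_sig (op_stage k)))
  end.

End Op.

(** [n]-computads; note that [NComp (stage n)] is the set of objects of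
    [Cat (stage (S n))]. *)
Definition Comp_ (n : nat) : Category := NCat (stage n).

Record Computad := {
  lev : forall n, Comp_ n;
  lev_low : forall n, (low (lev (S n)) : Comp_ n) = lev n
}.

Record CMor (C D : Computad) := {
  clev : forall n, Hom (lev C n) (lev D n);
  clev_low : forall n,
    eq_to_hom (lev_low D n) ∘ (mlow (clev (S n)) : @Hom (Comp_ n) _ _)
    = clev n ∘ eq_to_hom (lev_low C n)
}.

Lemma CMor_eq C D (f g : CMor C D) : (forall n, clev f n = clev g n) -> f = g.
Proof.
  destruct f as [f hf], g as [g hg]; simpl; intros E.
  assert (f = g) by (apply functional_extensionality_dep; exact E).
  subst; f_equal; apply proof_irrelevance.
Qed.

Definition cid (C : Computad) : CMor C C.
Proof.
  exists (fun n => idm (lev C n)).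
  abstract (intros n; rewrite cmp_idl; exact (cmp_idr (c := Comp_ n) _)).
Defined.

Definition ccmp (C D E : Computad) (g : CMor D E) (f : CMor C D) : CMor C E.
Proof.
  exists (fun n => clev g n ∘ clev f n).
  abstract (intros n; etransitivity; [exact (cmpA (c := Comp_ n) _ _ _)|];
    rewrite clev_low, <- !cmpA; f_equal; apply clev_low).
Defined.

Definition COMP : Category.
Proof.
  refine {| Ob := Computad; Hom := CMor; idm := cid; cmp := ccmp |}.
  - abstract (intros; apply CMor_eq; intros; apply cmp_idl).
  - abstract (intros; apply CMor_eq; intros; apply cmp_idr).
  - abstract (intros; apply CMor_eq; intros; apply cmpA).
Defined.

Definition Free_ob (X : Glob) : Computad :=
  {| lev := fun n => NFreeF (stage n) X; lev_low := fun n => eq_refl |}.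

Definition Free_mor (X Y : Glob) (f : GMap X Y) : CMor (Free_ob X) (Free_ob Y).
Proof.
  exists (fun n => fmap (NFreeF (stage n)) f).
  abstract (intros n; etransitivity; [apply (cmp_idl (c := Comp_ n)) | symmetry; apply (cmp_idr (c := Comp_ n))]).
Defined.

Definition Free : Functor GLOB COMP.
Proof.
  refine {| fob := Free_ob : GLOB -> COMP; fmap := Free_mor |}.
  - abstract (intros; apply CMor_eq; intros; apply (fmap_id (NFreeF (stage n)))).
  - abstract (intros; apply CMor_eq; intros; apply (fmap_cmp (NFreeF (stage n)))).
Defined.

(** The source and the target of a cell are the two projections of its
    boundary, a sphere of [u_{n+1} C_{n+1} = C_n]. *)
Definition cell_src (C : Computad) (n : nat) (a : cell (lev C (S n))) : cell (lev C n) :=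
  act (eq_to_hom (lev_low C n)) (pr1 (bdry a : sphere _)).

Definition cell_tgt (C : Computad) (n : nat) (a : cell (lev C (S n))) : cell (lev C n) :=
  act (eq_to_hom (lev_low C n)) (pr2 (bdry a : sphere _)).

Lemma bdry_cell_src_tgt C n (a : cell (lev C (S n))) :
  bdry (cell_src a) = bdry (cell_tgt a).
Proof.
  unfold cell_src, cell_tgt; rewrite !bdry_act; f_equal; exact (pr_bdry (bdry a)).
Qed.

Definition Cell_ob (C : Computad) : Glob.
Proof.
  refine {| gcell := fun n => cell (lev C n); src := @cell_src C; tgt := @cell_tgt C |}.
  - abstract (intros n a; unfold cell_src at 1 3; now rewrite bdry_cell_src_tgt).
  - abstract (intros n a; unfold cell_tgt at 1 3; now rewrite bdry_cell_src_tgt).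
Defined.

Lemma act_square n (C D D' E : Comp_ n) (g : Hom D E) (f : Hom C D) (g' : Hom D' E)
    (f' : Hom C D') (a : cell C) :
  g ∘ f = g' ∘ f' -> act g (act f a) = act g' (act f' a).
Proof.
  intros H; etransitivity; [symmetry; exact (fun_cmp (CellF (stage n)) g f a)|].
  etransitivity; [|exact (fun_cmp (CellF (stage n)) g' f' a)].
  exact (f_equal (fun z : NMor C E => act z a) H).
Qed.

Lemma act_idm n (C : Comp_ n) (a : cell C) : act (idm C) a = a.
Proof. exact (fun_id (CellF (stage n)) a). Qed.

Definition Cell_mor (C D : Computad) (σ : CMor C D) : GMap (Cell_ob C) (Cell_ob D).
Proof.
  refine {| gmap := fun n (a : Cell_ob C n) => act (clev σ n) a : Cell_ob D n |}.
  - abstract (intros n a; simpl; unfold cell_src; rewrite bdry_act;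
      apply act_square; symmetry; apply clev_low).
  - abstract (intros n a; simpl; unfold cell_tgt; rewrite bdry_act;
      apply act_square; symmetry; apply clev_low).
Defined.

Definition Cell : Functor COMP GLOB.
Proof.
  refine {| fob := Cell_ob : COMP -> GLOB; fmap := Cell_mor |}.
  - abstract (intros; apply GMap_eq; intros; apply act_idm).
  - abstract (intros C D E g f; apply GMap_eq; intros n a;
      exact (fun_cmp (CellF (stage n)) (clev g n) (clev f n) a)).
Defined.

Definition unit_mor (X : Glob) : GMap X (Cell_ob (Free_ob X)).
Proof.
  refine {| gmap := fun n (x : X n) => var (x : gen (nfree (stage n) X)) : Cell_ob (Free_ob X) n |}.
  - abstract (intros n x;
      exact (eq_sym (@act_idm n (nfree (stage n) X) (var (src x : gen (nfree (stage n) X)))))).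
  - abstract (intros n x;
      exact (eq_sym (@act_idm n (nfree (stage n) X) (var (tgt x : gen (nfree (stage n) X)))))).
Defined.

Definition ηC : idF GLOB ⇒ Cell ∘F Free.
Proof.
  exists (unit_mor : forall X, Hom (idF GLOB X) ((Cell ∘F Free) X)).
  abstract (intros; apply GMap_eq; intros; now apply cell_eq).
Defined.

Lemma bdry_faces (C : Computad) n (a : cell (lev C (S n))) :
  (bdry a : sphere _) =
  sph_act (eq_to_hom (eq_sym (lev_low C n)))
    (mksph (a := cell_src a) (b := cell_tgt a) (bdry_cell_src_tgt a)).
Proof.
  apply sphere_eq; symmetry; (etransitivity;
    [symmetry; exact (fun_cmp (CellF (stage n)) (eq_to_hom (eq_sym (lev_low C n))) (eq_to_hom (lev_low C n)) _)|]);
    rewrite eq_to_hom_sym_l; apply act_idm.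
Qed.

(** The components of the counit: [ε_n] is the identity on generators. *)
Definition counit_spec (C : Computad) (n : nat) : Type :=
  {f : Hom (NFreeF (stage n) (Cell_ob C)) (lev C n) |
   forall a : cell (lev C n), mgen f (a : gen (nfree (stage n) (Cell_ob C))) = a}.

Definition counit_base_mor (C : Computad) : NMor (nfree (stage 0) (Cell_ob C)) (lev C 0).
Proof.
  refine {| mlow := tt : Hom (low (nfree (stage 0) (Cell_ob C))) (low (lev C 0));
            mgen := fun a : gen (nfree (stage 0) (Cell_ob C)) => a : cell (lev C 0) |}.
  abstract (intros v; generalize (bdry v : unit); intros []; reflexivity).
Defined.

Definition counit_base (C : Computad) : counit_spec C 0 :=
  exist _ (counit_base_mor C) (fun a => eq_refl).

Lemma counit_step_bdry C n (f : counit_spec C n) (a : cell (lev C (S n))) :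
  bdry a =
  fmap (SphF (stage (S n))) (eq_to_hom (eq_sym (lev_low C n)) ∘ proj1_sig f)
    (fsph (stage (S n)) (a : Cell_ob C (S n))).
Proof.
  etransitivity; [apply bdry_faces|]; symmetry.
  etransitivity; [exact (fun_cmp (NSphF (stage n)) _ (proj1_sig f) _)|].
  apply (f_equal (sph_act (eq_to_hom (eq_sym (lev_low C n))))).
  apply sphere_eq; apply cell_eq;
    [exact (f_equal (@proj1_sig _ _) (proj2_sig f (cell_src a)))
    |exact (f_equal (@proj1_sig _ _) (proj2_sig f (cell_tgt a)))].
Qed.

Definition counit_step_mor (C : Computad) n (f : counit_spec C n) :
    NMor (nfree (stage (S n)) (Cell_ob C)) (lev C (S n)) :=
  {| mlow := eq_to_hom (eq_sym (lev_low C n)) ∘ proj1_sig f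
       : Hom (low (nfree (stage (S n)) (Cell_ob C))) (low (lev C (S n)));
     mgen := fun a : gen (nfree (stage (S n)) (Cell_ob C)) => a : cell (lev C (S n));
     mgen_bdry := counit_step_bdry f |}.

Definition counit_step (C : Computad) n (f : counit_spec C n) : counit_spec C (S n) :=
  exist _ (counit_step_mor f) (fun a => eq_refl).

Fixpoint counit_comp (C : Computad) (n : nat) : counit_spec C n :=
  match n with
  | 0 => counit_base C
  | S n => counit_step (counit_comp C n)
  end.

Definition counit_mor (C : Computad) : CMor (Free_ob (Cell_ob C)) C.
Proof.
  exists (fun n => proj1_sig (counit_comp C n)).
  abstract (intros n; simpl mlow; etransitivity; [exact (cmpA (c := Comp_ n) _ _ _)|];
    rewrite eq_to_hom_sym_r; etransitivity; [apply (cmp_idl (c := Comp_ n))|];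
    symmetry; apply (cmp_idr (c := Comp_ n))).
Defined.

Lemma counit_gen C n (a : cell (lev C n)) :
  mgen (clev (counit_mor C) n) (a : gen (nfree (stage n) (Cell_ob C))) = a.
Proof. exact (proj2_sig (counit_comp C n) a). Qed.

Lemma TermCat_eq (x y : TermCat) (f g : Hom x y) : f = g.
Proof. now destruct f, g. Qed.

Lemma clev_low' C D (σ : CMor C D) n :
  (mlow (clev σ (S n)) : @Hom (Comp_ n) _ _) ∘ eq_to_hom (eq_sym (lev_low C n)) =
  eq_to_hom (eq_sym (lev_low D n)) ∘ clev σ n.
Proof.
  rewrite <- (cmp_idr (clev σ n)), <- (eq_to_hom_sym_r (lev_low C n)).
  rewrite (cmpA (clev σ n)), <- clev_low, !cmpA, eq_to_hom_sym_l.
  now rewrite cmp_idl.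
Qed.

Lemma counit_nat C D (σ : CMor C D) :
  ccmp (counit_mor D) (Free_mor (Cell_mor σ)) = ccmp σ (counit_mor C).
Proof.
  apply CMor_eq; intros n; simpl clev.
  induction n as [|n IH].
  - apply NMor_eq; [apply TermCat_eq | intros v; reflexivity].
  - apply NMor_eq; [|reflexivity].
    etransitivity; [symmetry; exact (cmpA (c := Comp_ n) _ _ _)|].
    etransitivity; [exact (f_equal (fun z => eq_to_hom (eq_sym (lev_low D n)) ∘ z) IH)|].
    etransitivity; [exact (cmpA (c := Comp_ n) _ _ _)|].
    rewrite <- clev_low'; symmetry; exact (cmpA (c := Comp_ n) _ _ _).
Qed.

Definition εC : Free ∘F Cell ⇒ idF COMP :=
  {| ncomp := counit_mor : forall C, Hom ((Free ∘F Cell) C) (idF COMP C);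
     ncomp_nat := counit_nat |}.

Lemma triL X : εC (Free X) ∘ fmap Free (ηC X) = idm (Free X).
Proof.
  apply CMor_eq; intros n; induction n as [|n IH].
  - apply NMor_eq; [apply TermCat_eq | intros v; reflexivity].
  - apply NMor_eq; [|reflexivity].
    etransitivity; [symmetry; exact (cmpA (c := Comp_ n) _ _ _)|].
    etransitivity; [apply (cmp_idl (c := Comp_ n))|]; exact IH.
Qed.

Lemma triR C : fmap Cell (εC C) ∘ ηC (Cell C) = idm (Cell C).
Proof.
  apply GMap_eq; intros n a; apply cell_eq.
  exact (f_equal (@proj1_sig _ _) (@counit_gen C n a)).
Qed.

Definition FreeCell : Adjunction Free Cell :=
  {| adj_unit := ηC; adj_counit := εC; adj_triL := triL; adj_triR := triR |}.

Definition T : Monad GLOB := adj_monad FreeCell.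

Definition ωCat : Category := AlgCat T.

Definition K : Functor COMP ωCat := comparison FreeCell.

Lemma fmap_eq_to_hom_square (C D : Category) (F : Functor C D) (x x' y y' : C)
    (e : x = x') (e' : y = y') (f : Hom x y) (g : Hom x' y') :
  eq_to_hom e' ∘ f = g ∘ eq_to_hom e ->
  eq_to_hom (f_equal (fob F) e') ∘ fmap F f = fmap F g ∘ eq_to_hom (f_equal (fob F) e).
Proof. rewrite <- !fmap_eq_to_hom; apply fmap_square. Qed.

Section OpComputad.
Context (w : G).

Definition op_dat (k : nat) : OpData w (stage k) := proj1_sig (op_stage w k).

Definition op_ (n : nat) : Functor (Comp_ n) (Comp_ n) := op_NF (proj2_sig (op_stage w n)).

Definition op_Cell_ (n : nat) : CellF (stage n) ⇒ CellF (stage n) ∘F op_ n :=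
  opCell (proj2_sig (op_stage w n)).

Definition op_ob (C : Computad) : Computad :=
  {| lev := fun n => op_ n (lev C n);
     lev_low := fun n => f_equal (op_ n) (lev_low C n) |}.

Definition op_hom (C D : Computad) (σ : CMor C D) : CMor (op_ob C) (op_ob D).
Proof.
  exists (fun n => fmap (op_ n) (clev σ n)).
  abstract (intros n; exact (fmap_eq_to_hom_square (op_ n) (clev_low σ n))).
Defined.

Definition op_Comp : Functor COMP COMP.
Proof.
  refine {| fob := op_ob : COMP -> COMP; fmap := op_hom |}.
  - abstract (intros; apply CMor_eq; intros; apply (fmap_id (op_ n))).
  - abstract (intros; apply CMor_eq; intros; apply (fmap_cmp (op_ n))).
Defined.

Lemma op_cell_face (C : Computad) n (a : cell (lev C n)) (b : cell (low (lev C (S n)) : Comp_ n)) :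
  act (eq_to_hom (lev_low C n)) b = a ->
  op_Cell_ n (lev C n) a =
  act (eq_to_hom (lev_low (op_ob C) n)) (op_Cell_ n (low (lev C (S n))) b).
Proof.
  intros <-.
  etransitivity; [exact (f_equal (fun f => f b) (ncomp_nat (op_Cell_ n) (eq_to_hom (lev_low C n))))|].
  exact (f_equal (fun z : NMor _ _ => act z (op_Cell_ n (low (lev C (S n))) b))
    (fmap_eq_to_hom (op_ n) (lev_low C n))).
Qed.

Lemma bdry_op_cell (C : Computad) n (a : cell (lev C (S n))) :
  (bdry (op_Cell_ (S n) (lev C (S n)) a : cell _) : sphere _) =
  op_sphere (proj2_sig (op_stage w n)) (bdry a : sphere _).
Proof. exact (bdry_op (proj2_sig (op_stage w (S n))) a). Qed.

Lemma op_cell_src (C : Computad) n (a : cell (lev C (S n))) :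
  op_Cell_ n (lev C n) (if w n then cell_tgt a else cell_src a) =
  @cell_src (op_ob C) n (op_Cell_ (S n) (lev C (S n)) a).
Proof.
  etransitivity; [apply (@op_cell_face C n _
    (if w n then pr2 (bdry a : sphere _) else pr1 (bdry a : sphere _))); now destruct (w n)|].
  apply (f_equal (act (eq_to_hom (lev_low (op_ob C) n)))); symmetry.
  etransitivity; [exact (f_equal (@pr1 _ _ _) (bdry_op_cell a)) | exact (pr1_op _ _)].
Qed.

Lemma op_cell_tgt (C : Computad) n (a : cell (lev C (S n))) :
  op_Cell_ n (lev C n) (if w n then cell_src a else cell_tgt a) =
  @cell_tgt (op_ob C) n (op_Cell_ (S n) (lev C (S n)) a).
Proof.
  etransitivity; [apply (@op_cell_face C n _
    (if w n then pr1 (bdry a : sphere _) else pr2 (bdry a : sphere _))); now destruct (w n)|].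
  apply (f_equal (act (eq_to_hom (lev_low (op_ob C) n)))); symmetry.
  etransitivity; [exact (f_equal (@pr2 _ _ _) (bdry_op_cell a)) | exact (pr2_op _ _)].
Qed.

Definition op_Cell_mor (C : Computad) : GMap (op_glob w (Cell_ob C)) (Cell_ob (op_ob C)) :=
  {| gmap := fun n (a : op_glob w (Cell_ob C) n) =>
               op_Cell_ n (lev C n) a : Cell_ob (op_ob C) n;
     gmap_src := @op_cell_src C;
     gmap_tgt := @op_cell_tgt C |}.

Definition op_Cell : op_Glob w ∘F Cell ⇒ Cell ∘F op_Comp.
Proof.
  exists (op_Cell_mor : forall C, Hom ((op_Glob w ∘F Cell) C) ((Cell ∘F op_Comp) C)).
  abstract (intros C D σ; apply GMap_eq; intros n a;
    exact (f_equal (fun f => f a) (ncomp_nat (op_Cell_ n) (clev σ n)))).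
Defined.

Lemma op_Cell_iso : is_nat_iso op_Cell.
Proof.
  intros C; apply gbij_iso; intros n; split.
  - intros a a'; exact (@op_cell_inj w n (stage n) _ (proj2_sig (op_stage w n)) (lev C n) a a').
  - exact (@op_cell_surj w n (stage n) _ (proj2_sig (op_stage w n)) (lev C n)).
Qed.

(** The identity transformation [Free op_w ⇒ op_w Free]. *)
Definition op_Free_mor (X : Glob) : CMor (Free_ob (op_glob w X)) (op_ob (Free_ob X)).
Proof.
  exists (fun n => nopfree (proj2_sig (op_stage w n)) X).
  abstract (intros n; etransitivity; [apply (cmp_idl (c := Comp_ n))|];
    symmetry; apply (cmp_idr (c := Comp_ n))).
Defined.

Definition op_Free : Free ∘F op_Glob w ⇒ op_Comp ∘F Free.
Proof.
  exists (op_Free_mor : forall X, Hom ((Free ∘F op_Glob w) X) ((op_Comp ∘F Free) X)).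
  abstract (intros X Y f; apply CMor_eq; intros n; exact (ncomp_nat (nopfree _) f)).
Defined.

Definition op_T_ob (X : Glob) : Hom ((T ∘F op_Glob w) X) ((op_Glob w ∘F T) X) :=
  inv (op_Cell_iso (Free X)) ∘ fmap Cell (op_Free X).

(** [op_w^T = (op_w^Cell Free)^{-1} : T op_w ⇒ op_w T], where
    [T op_w = Cell Free op_w] is identified with [Cell op_w Free]. *)
Definition op_T : T ∘F op_Glob w ⇒ op_Glob w ∘F T.
Proof.
  exists op_T_ob.
  abstract (intros X Y f; unfold op_T_ob; simpl fmap at 1;
    etransitivity; [symmetry; apply cmpA|];
    etransitivity; [apply f_equal; exact (fmap_square Cell (ncomp_nat op_Free f))|];
    etransitivity; [apply cmpA|]; etransitivity; [|symmetry; apply cmpA];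
    apply (f_equal (fun z => z ∘ fmap Cell (op_Free X)));
    exact (nat_trans_inv_nat op_Cell_iso (fmap Free f))).
Defined.

(** [op_w Free = Free op_w], and [op_Free] is the identity. *)

Lemma NMor_eq_to_hom k (P : Stage k) (c c' : Cat P) (V : Type) (a : V -> SphF P c)
    (a' : V -> SphF P c') (e : c = c')
    (f : NMor {| low := c; gen := V; att := a |} {| low := c'; gen := V; att := a' |}) :
  mlow f = eq_to_hom e -> (forall v : V, mgen f v = var (v : gen {| low := c'; gen := V; att := a' |})) ->
  exists E : {| low := c; gen := V; att := a |} = {| low := c'; gen := V; att := a' |} :> NCat P,
    f = eq_to_hom E.
Proof.
  destruct e; intros H1 H2.
  assert (Ea : a = a').
  { apply functional_extensionality; intros v.
    pose proof (mgen_bdry f v) as Hb; rewrite H1, H2 in Hb; simpl in Hb.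
    symmetry; etransitivity; [exact Hb|]; apply fun_id. }
  destruct Ea; exists eq_refl; apply NMor_eq; [exact H1|].
  intros v; exact (f_equal (@proj1_sig _ _) (H2 v)).
Qed.

Lemma opfree_identity k X :
  exists e : FreeF (stage k) (op_Glob w X) = opF (op_dat k) (FreeF (stage k) X),
    opfree (op_dat k) X = eq_to_hom e.
Proof.
  induction k as [|k [e He]]; [now exists eq_refl|].
  exact (NMor_eq_to_hom (f := nopfree_mor (op_dat k) X) He (fun v => eq_refl)).
Qed.

Lemma CMor_eq_to_hom C D (f : CMor C D) :
  (forall n, exists e : lev C n = lev D n, clev f n = eq_to_hom e) ->
  exists E : C = D :> COMP, f = eq_to_hom E.
Proof.
  destruct C as [c hc], D as [d hd]; simpl; intros H.
  assert (E : c = d) by (apply functional_extensionality_dep; intros n; now destruct (H n)).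
  destruct E.
  assert (E : hc = hd) by apply proof_irrelevance.
  destruct E; exists eq_refl; apply CMor_eq; intros n; destruct (H n) as [e ->].
  now rewrite (proof_irrelevance _ e eq_refl).
Qed.

Lemma op_Free_identity X :
  exists E : Free (op_Glob w X) = op_Comp (Free X), op_Free X = eq_to_hom E.
Proof.
  apply CMor_eq_to_hom; intros n; exact (opfree_identity (S n) X).
Qed.

End OpComputad.

Definition free_on (X : ωCat) (C : COMP) : Prop := isomorphic X (K C).

(* Main.v *)
From Stdlib Require Import List Lia Bool.
From Stdlib Require Import FunctionalExtensionality ProofIrrelevance.
Require Import Defs.
Import ListNotations.

Set Implicit Arguments.
Unset Strict Implicit.
Unset Printing Implicit Defensive.

(** Write [κ] for [op_Cell w : op_w Cell ⇒ Cell op_w] and [φ] for the identity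
    [op_Free w : Free op_w ⇒ op_w Free], so that [op_T w] is characterised by
    [κ Free ∘ op_T w = Cell φ].  The pair [(κ, φ)] is compatible with the counit
    of [Free ⊣ Cell] ([op_counit]): both sides are morphisms out of a computad
    [Free (op_w (Cell C))] and agree on each generator, a cell of [C], which they
    send to its opposite.  The monad morphism law ([mate_monad_morphism]) and
    the statement that [κ] is an isomorphism of algebras [op_w K C ≅ K (op_w C)]
    ([mate_algebra], [comparison_mate_iso]) follow by diagram chasing, for any
    adjunction.

    For the group action, [op_w (op_w' X)] and [op_(ww') X] have the same cells
    and propositionally equal source and target maps.  So the functors
    [op_ω w ∘F op_ω w'] and [op_ω (ww')] are compared along the map that is the
    identity on cells, and are equal as soon as that map is a morphism of
    algebras ([algebra_functor_eq]).  This amounts to [op_T_mul], an identity between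
    [op_T (ww')] and the composite of [op_T w] and [op_T w'], which is in turn
    reduced ([mate_composite]) to the compatibility of [op_Cell] and [op_Free]
    with products in [G].  The latter is an induction on the dimension of
    computads ([OpMul_step]); in each dimension, the step for coherence cells
    rests on two facts about trees: [op_w (op_w' B) = op_(ww') B]
    ([op_tree_mul]), and under this identification the isomorphism [op_pos] of
    [ww'] is the composite of those of [w] and [w'] ([op_pos_mul]).

    The neutral element needs no second induction: by multiplicativity [op_T 1]
    is idempotent, and an invertible idempotent is the identity ([op_T_one]).
    As [w w = 1], every [op_ω w] is then its own inverse. *)

(** * Formal consequences of compatibility with an adjunction *)

Lemma whisker_l (C : Category) (x y z : C) (h : Hom y z) (f g : Hom x y) :
  f = g -> h ∘ f = h ∘ g.
Proof. now intros ->. Qed.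

Lemma whisker_r (C : Category) (x y z : C) (f g : Hom y z) (h : Hom x y) :
  f = g -> f ∘ h = g ∘ h.
Proof. now intros ->. Qed.

Lemma iso_cancel_l (C : Category) (x y z : C) (f : Hom y z) (g h : Hom x y) :
  is_iso f -> f ∘ g = f ∘ h -> g = h.
Proof.
  intros [f' [K _]] e; rewrite <- (cmp_idl g), <- (cmp_idl h), <- K, <- !cmpA.
  now apply whisker_l.
Qed.

Lemma iso_cancel_r (C : Category) (x y z : C) (f : Hom x y) (g h : Hom y z) :
  is_iso f -> g ∘ f = h ∘ f -> g = h.
Proof.
  intros [f' [_ K]] e; rewrite <- (cmp_idr g), <- (cmp_idr h), <- K, !cmpA.
  now apply whisker_r.
Qed.

Lemma is_iso_inv (C : Category) (x y : C) (f : Hom x y) (h : is_iso f) : is_iso (inv h).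
Proof. exists f; split; [apply inv_r | apply inv_l]. Qed.

Lemma is_iso_alg (C : Category) (T : Monad C) (X Y : AlgCat T) (f : Hom X Y) :
  is_iso (ahom f) -> is_iso f.
Proof.
  intros [g [K1 K2]].
  assert (E : g ∘ astr Y = astr X ∘ fmap T g).
  { rewrite <- (cmp_idl (astr X ∘ fmap T g)), <- K1, <- !cmpA, (cmpA (ahom f) (astr X)), ahom_str.
    now rewrite <- !cmpA, <- fmap_cmp, K2, fmap_id, cmp_idr. }
  exists ({| ahom := g; ahom_str := E |} : AlgHom Y X); split; now apply AlgHom_eq.
Qed.

(** [φ] is the mate of [κ] under [L ⊣ R], which [mate_unit] and [mate_counit]
    express, and [ψ] is [(κ L)^{-1} ∘ R φ], given by the equation [κψ] rather than
    by a choice of inverse. *)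
Section Mates.
Context (C D : Category) (L : Functor C D) (R : Functor D C) (A : Adjunction L R)
  (F : Functor C C) (H : Functor D D)
  (κ : F ∘F R ⇒ R ∘F H) (κ_iso : is_nat_iso κ) (φ : L ∘F F ⇒ H ∘F L)
  (ψ : adj_monad A ∘F F ⇒ F ∘F adj_monad A)
  (κψ : forall x, κ (L x) ∘ ψ x = fmap R (φ x))
  (mate_unit : forall x,
     fmap R (φ x) ∘ adj_unit A (F x) = κ (L x) ∘ fmap F (adj_unit A x))
  (mate_counit : forall y,
     adj_counit A (H y) ∘ fmap L (κ y) = fmap H (adj_counit A y) ∘ φ (R y)).

(** By naturality, [κ] carries [F R ε] to [R H ε]; after composing with [κψ], what
    remains is the image under [R] of the counit condition. *)
Lemma mate_algebra y :
  κ y ∘ (fmap F (fmap R (adj_counit A y)) ∘ ψ (R y)) =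
  fmap R (adj_counit A (H y)) ∘ fmap (adj_monad A) (κ y).
Proof.
  etransitivity; [apply cmpA|].
  etransitivity; [exact (whisker_r (ψ (R y)) (ncomp_nat κ (adj_counit A y)))|].
  etransitivity; [symmetry; apply cmpA|].
  etransitivity; [exact (whisker_l (fmap R (fmap H (adj_counit A y))) (κψ (R y)))|].
  exact (fmap_square R (eq_sym (mate_counit y))).
Qed.

(** Both laws may be tested after composing with the isomorphism [κ L]; the
    multiplication law then is [mate_algebra] at [L x], precomposed with [T ψ]. *)
Lemma mate_monad_morphism : monad_morphism ψ.
Proof.
  split; intros x; apply (iso_cancel_l (κ_iso (L x))).
  - etransitivity; [apply cmpA|].
    etransitivity; [exact (whisker_r (adj_unit A (F x)) (κψ x)) | apply mate_unit].
  - etransitivity; [apply cmpA|].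
    etransitivity; [exact (whisker_r (fmap R (adj_counit A (L (F x)))) (κψ x))|].
    etransitivity; [exact (fmap_square R (eq_sym (ncomp_nat (adj_counit A) (φ x))))|].
    etransitivity; [|symmetry; apply cmpA].
    etransitivity;
      [|exact (whisker_r (fmap (adj_monad A) (ψ x)) (eq_sym (mate_algebra (L x))))].
    etransitivity; [|apply cmpA]; apply whisker_l.
    etransitivity; [exact (f_equal (fun z => fmap R (fmap L z)) (eq_sym (κψ x)))|].
    apply (fmap_cmp (adj_monad A)).
Qed.

Definition comparison_mate (M : monad_morphism ψ) :
  induced M ∘F comparison A ⇒ comparison A ∘F H.
Proof.
  exists (fun y => @Build_AlgHom C (adj_monad A) (induced_ob M (comparison_ob A y))
                     (comparison_ob A (H y)) (κ y) (mate_algebra y)).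
  abstract (intros y z f; apply AlgHom_eq; exact (ncomp_nat κ f)).
Defined.

Lemma comparison_mate_iso (M : monad_morphism ψ) : is_nat_iso (comparison_mate M).
Proof. intros y; apply is_iso_alg, κ_iso. Qed.

End Mates.

(** Transformations [γ : F1 F2 ⇒ F3] and [χ : H1 H2 ⇒ H3] under which [κ1], [κ2]
    compose to [κ3] and [φ1], [φ2] to [φ3]. *)
Section Composite.
Context (C D : Category) (L : Functor C D) (R : Functor D C)
  (F1 F2 F3 : Functor C C) (H1 H2 H3 : Functor D D)
  (κ1 : F1 ∘F R ⇒ R ∘F H1) (κ2 : F2 ∘F R ⇒ R ∘F H2) (κ3 : F3 ∘F R ⇒ R ∘F H3)
  (κ3_iso : is_nat_iso κ3)
  (φ1 : L ∘F F1 ⇒ H1 ∘F L) (φ2 : L ∘F F2 ⇒ H2 ∘F L) (φ3 : L ∘F F3 ⇒ H3 ∘F L)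
  (ψ1 : (R ∘F L) ∘F F1 ⇒ F1 ∘F (R ∘F L)) (ψ2 : (R ∘F L) ∘F F2 ⇒ F2 ∘F (R ∘F L))
  (ψ3 : (R ∘F L) ∘F F3 ⇒ F3 ∘F (R ∘F L))
  (κψ1 : forall x, κ1 (L x) ∘ ψ1 x = fmap R (φ1 x))
  (κψ2 : forall x, κ2 (L x) ∘ ψ2 x = fmap R (φ2 x))
  (κψ3 : forall x, κ3 (L x) ∘ ψ3 x = fmap R (φ3 x))
  (γ : F1 ∘F F2 ⇒ F3) (χ : H1 ∘F H2 ⇒ H3)
  (κ_mul : forall y, κ3 y ∘ γ (R y) = fmap R (χ y) ∘ (κ1 (H2 y) ∘ fmap F1 (κ2 y)))
  (φ_mul : forall x, φ3 x ∘ fmap L (γ x) = χ (L x) ∘ (fmap H1 (φ2 x) ∘ φ1 (F2 x))).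

(** After composing with the isomorphism [κ3 L], the equations [κψ1], [κψ2], [κψ3]
    turn the claim into the image under [R] of [φ_mul]. *)
Lemma mate_composite x :
  ψ3 x ∘ fmap R (fmap L (γ x)) = γ (R (L x)) ∘ (fmap F1 (ψ2 x) ∘ ψ1 (F2 x)).
Proof.
  apply (iso_cancel_l (κ3_iso (L x))).
  etransitivity; [apply cmpA|].
  etransitivity; [exact (whisker_r (fmap R (fmap L (γ x))) (κψ3 x))|].
  etransitivity; [exact (fmap_square R (φ_mul x))|].
  symmetry.
  etransitivity; [apply cmpA|].
  etransitivity; [exact (whisker_r (fmap F1 (ψ2 x) ∘ ψ1 (F2 x)) (κ_mul (L x)))|].
  etransitivity; [symmetry; apply cmpA|]; apply whisker_l.
  etransitivity; [symmetry; apply cmpA|].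
  etransitivity; [apply whisker_l; etransitivity; [apply cmpA|];
    exact (whisker_r (ψ1 (F2 x)) (fmap_square F1 (eq_trans (κψ2 x) (eq_sym (cmp_idr _)))))|].
  rewrite fmap_id, cmp_idr, cmpA.
  etransitivity; [exact (whisker_r (ψ1 (F2 x)) (ncomp_nat κ1 (φ2 x)))|].
  etransitivity; [symmetry; apply cmpA|].
  etransitivity; [exact (whisker_l (fmap R (fmap H1 (φ2 x))) (κψ1 (F2 x)))|].
  symmetry; apply (fmap_cmp R).
Qed.

End Composite.

(** * Equality of functors into a category of algebras *)

(** Two functors equal on objects are equal on morphisms as soon as the transport
    between them is natural. *)
Lemma functor_eq C D (F G : Functor C D) (θ : F ⇒ G) :
  (forall x, exists e : F x = G x, θ x = eq_to_hom e) -> F = G.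
Proof.
  destruct θ as [θ nat]; destruct F as [o m i c], G as [o' m' i' c']; simpl in *; intros H.
  assert (E : o = o') by (apply functional_extensionality; intros x; now destruct (H x)).
  destruct E.
  assert (K : forall x, θ x = idm (o x)).
  { intros x; destruct (H x) as [e ->]; now rewrite (proof_irrelevance _ e eq_refl). }
  assert (E : m = m').
  { do 3 (apply functional_extensionality_dep; intro).
    now rewrite <- (cmp_idl (m _ _ _)), <- K, nat, K, cmp_idr. }
  destruct E; f_equal; apply proof_irrelevance.
Qed.

(** An algebra is determined by its carrier and structure map, so transport along
    an equality of carriers is one of algebras once it respects structure. *)
Lemma AlgHom_eq_to_hom (C : Category) (T : Monad C) (X Y : AlgCat T) (f : Hom X Y)
    (e : acar X = acar Y) :
  ahom f = eq_to_hom e -> exists E : X = Y, f = eq_to_hom E.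
Proof.
  destruct X as [x a u m], Y as [y b u' m'], f as [f hf]; simpl in *; destruct e; intros ->.
  assert (E : a = b).
  { simpl in hf; now rewrite fmap_id, cmp_idl, cmp_idr in hf. }
  destruct E.
  assert (u = u') as <- by apply proof_irrelevance.
  assert (m = m') as <- by apply proof_irrelevance.
  exists eq_refl; now apply AlgHom_eq.
Qed.

(** Equality of functors into algebras is checked on carriers, where the two sides
    may differ by an equality of objects that is not a definitional one. *)
Lemma algebra_functor_eq (C E : Category) (T : Monad C) (F G : Functor E (AlgCat T))
    (θ : forall x, Hom (acar (F x)) (acar (G x))) :
  (forall x, exists e : acar (F x) = acar (G x), θ x = eq_to_hom e) ->
  (forall x, θ x ∘ astr (F x) = astr (G x) ∘ fmap T (θ x)) ->
  (forall x y (f : Hom x y), θ y ∘ ahom (fmap F f) = ahom (fmap G f) ∘ θ x) ->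
  F = G.
Proof.
  intros He Ha Hn.
  unshelve eapply (@functor_eq E (AlgCat T) F G).
  - exists (fun x => @Build_AlgHom C T (F x) (G x) (θ x) (Ha x)).
    intros x y f; apply AlgHom_eq, Hn.
  - intros x; destruct (He x) as [e Ee].
    now apply AlgHom_eq_to_hom with (e := e).
Qed.

(** * The action of G on globular sets *)

(** Source and target maps are recovered from a morphism that is the identity on
    cells, so such a morphism is a transport. *)
Lemma GMap_eq_to_hom (c : nat -> Type) s t s' t' p q p' q'
    (X := {| gcell := c; src := s; tgt := t; src_src := p; tgt_src := q |})
    (Y := {| gcell := c; src := s'; tgt := t'; src_src := p'; tgt_src := q' |}) (f : GMap X Y) :
  (forall n (x : c n), f n x = x) -> exists e : X = Y :> GLOB, f = eq_to_hom e.
Proof.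
  intros H.
  assert (s = s') as <-.
  { do 2 (apply functional_extensionality_dep; intro).
    etransitivity; [symmetry; apply H|]; etransitivity; [apply (gmap_src f)|]; apply f_equal, H. }
  assert (t = t') as <-.
  { do 2 (apply functional_extensionality_dep; intro).
    etransitivity; [symmetry; apply H|]; etransitivity; [apply (gmap_tgt f)|]; apply f_equal, H. }
  assert (p = p') as <- by apply proof_irrelevance.
  assert (q = q') as <- by apply proof_irrelevance.
  exists eq_refl; apply GMap_eq, H.
Qed.

Section Mul.
Context (w w' : G).

(** [mulG] and [one_G] below are convertible with the product and the unit of
    [G_group]; they are stated on [G], the index of the opposites. *)
Definition mulG : G := fun n => xorb (w n) (w' n).

Definition op_glob_mul (X : Glob) : GMap (op_glob w (op_glob w' X)) (op_glob mulG X).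
Proof.
  refine {| gmap := fun n (x : op_glob w (op_glob w' X) n) => (x : X n) : op_glob mulG X n |};
    abstract (intros n x; simpl; unfold mulG; now destruct (w n), (w' n)).
Defined.

End Mul.

Lemma op_glob_mul_eq w w' X : exists e : op_Glob w (op_Glob w' X) = op_Glob (mulG w w') X,
  op_glob_mul w w' X = eq_to_hom e.
Proof. apply (GMap_eq_to_hom (f := op_glob_mul w w' X)); reflexivity. Qed.

Definition op_Glob_mul w w' : op_Glob w ∘F op_Glob w' ⇒ op_Glob (mulG w w').
Proof.
  exists (op_glob_mul w w' : forall X, Hom ((op_Glob w ∘F op_Glob w') X) (op_Glob (mulG w w') X)).
  abstract (intros X Y f; now apply GMap_eq).
Defined.

Definition one_G : G := fun _ => false.

Definition op_glob_one X : GMap (op_glob one_G X) X.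
Proof. exists (fun n (x : op_glob one_G X n) => x : X n); reflexivity. Defined.

Lemma op_glob_one_eq X : exists e : op_Glob one_G X = X, op_glob_one X = eq_to_hom e.
Proof.
  destruct X as [c s t p q].
  exact (GMap_eq_to_hom (f := op_glob_one (Build_Glob p q)) (fun n x => eq_refl)).
Qed.

Definition op_Glob_one : op_Glob one_G ⇒ idF GLOB.
Proof.
  exists (op_glob_one : forall X, Hom (op_Glob one_G X) (idF GLOB X)).
  abstract (intros X Y f; now apply GMap_eq).
Defined.

(** * The action of G on trees and their positions *)

Section Inclusions.
Context (A : Type) (f : A -> BGlob).

(** The inclusions are jointly surjective, except into the empty wedge, whose only
    cell is the basepoint. *)
Lemma wedges_ind (l : list A) (Q : forall n, Wedges f l n -> Prop) :
  Q 0 (bminus (Wedges f l)) ->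
  (forall i a ι, inclusion (f := f) (l := l) (a := a) i ι -> forall n y, Q n (ι n y)) ->
  forall n z, Q n z.
Proof.
  induction l as [|a l IH]; intros H0 Hι n z.
  - now destruct n, z.
  - destruct (wedge_cell (X := f a) (Y := Wedges f l) z) as [[x ->]|[y ->]].
    + apply (Hι 0 a _ (incl_head f a l)).
    + apply (IH (fun n y => Q n (in2 (f a) (Wedges f l) n y))).
      * rewrite <- (wedge_glue (f a) (Wedges f l)).
        apply (Hι 0 a _ (incl_head f a l)).
      * intros i b ι H m t; exact (Hι _ _ _ (incl_tail a H) m t).
Qed.

(** The relation [inclusion] as a partial function, from which its uniqueness can be
    read off without inverting a proof with dependent indices. *)
Fixpoint inclusion_at (l : list A) (i : nat) : option {a : A & GMap (f a) (Wedges f l)} :=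
  match l, i with
  | [], _ => None
  | a :: l, 0 => Some (existT _ a (in1 (f a) (Wedges f l)))
  | b :: l, S i =>
      option_map (fun s => existT (fun a => GMap (f a) (Wedges f (b :: l))) (projT1 s)
                             (gcmp (in2 (f b) (Wedges f l)) (projT2 s)))
        (inclusion_at l i)
  end.

Lemma inclusion_at_spec l i a ι :
  inclusion (f := f) (l := l) (a := a) i ι -> inclusion_at l i = Some (existT _ a ι).
Proof. induction 1 as [|b l i a ι H IH]; simpl; [reflexivity | now rewrite IH]. Qed.

Lemma inclusion_unique l i a ι ι' :
  inclusion (f := f) (l := l) (a := a) i ι -> inclusion (f := f) (l := l) (a := a) i ι' ->
  ι = ι'.
Proof.
  intros H%inclusion_at_spec H'%inclusion_at_spec.
  rewrite H in H'; injection H' as E; exact (inj_pair2 _ _ _ _ _ E).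
Qed.

Lemma inclusion_lt l i a ι : inclusion (f := f) (l := l) (a := a) i ι -> i < length l.
Proof. induction 1; simpl; lia. Qed.

Lemma inclusion_In l i a ι : inclusion (f := f) (l := l) (a := a) i ι -> In a l.
Proof. induction 1; simpl; auto. Qed.

End Inclusions.

Definition pos_cast (B B' : tree) (e : B = B') : BMap (Pos B) (Pos B') :=
  match e with eq_refl => bid (Pos B) end.

Lemma pos_cast_inclusion (l l' : list tree) (e : br l = br l') i a a' (ea : a = a') ι ι' :
  inclusion (f := fun b => Susp (Pos b)) (l := l) (a := a) i ι ->
  inclusion (f := fun b => Susp (Pos b)) (l := l') (a := a') i ι' ->
  forall n y, pos_cast e n (ι n y) = ι' n (susp_map (pos_cast ea) n y).
Proof.
  intros H H' n y; assert (El : l = l') by congruence; destruct El, ea.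
  rewrite (proof_irrelevance _ e eq_refl), (inclusion_unique H H'); simpl pos_cast.
  apply (f_equal (ι' n)); now destruct n.
Qed.

Lemma length_swap A b (l : list A) : length (swap b l) = length l.
Proof. destruct b; [apply length_rev | reflexivity]. Qed.

(** The index of an entry of a list of length [n] after two successive swaps. *)
Lemma swap_index (b b' : bool) i n : i < n ->
  (if b then n - S (if b' then n - S i else i) else if b' then n - S i else i) =
  (if xorb b b' then n - S i else i).
Proof. destruct b, b'; simpl; lia. Qed.

Lemma op_tree_mul : forall B w w', op_tree w (op_tree w' B) = op_tree (mulG w w') B.
Proof.
  apply (tree_ind' (P := fun B => forall w w', op_tree w (op_tree w' B) = op_tree (mulG w w') B)).
  intros l IH w w'; simpl; f_equal.
  assert (E : map (op_tree (pred_G w)) (map (op_tree (pred_G w')) l) =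
              map (op_tree (pred_G (mulG w w'))) l).
  { rewrite map_map; apply map_ext_in; intros b Hb; exact (IH b Hb _ _). }
  change (mulG w w' 0) with (xorb (w 0) (w' 0)).
  destruct (w 0), (w' 0); simpl; rewrite <- ?E, ?map_rev, ?rev_involutive; reflexivity.
Qed.

Lemma op_pos_inj w B n x x' : op_pos w B n x = op_pos w B n x' -> x = x'.
Proof. intros E; now rewrite <- (op_pos_cancel_l (w := w) x), E, op_pos_cancel_l. Qed.

(** The restriction of [op_pos] to one factor of the wedge. *)
Definition op_factor (w : G) (b : tree) :
  BMap (Susp (Pos (op_tree (pred_G w) b))) (op_bglob w (Susp (Pos b))) :=
  bcmp (op_susp w (Pos b)) (susp_map (op_pos (pred_G w) b)).

Lemma op_factor_surj w b n y : exists x, op_factor w b n x = y.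
Proof.
  assert (H : @is_iso BGLOB _ _ (op_factor w b)).
  { apply (@is_iso_cmp BGLOB); [apply op_susp_iso | apply susp_map_iso, op_pos_iso]. }
  destruct H as [g [_ H]]; exists (g n y).
  exact (f_equal (fun k : BMap _ _ => k n y) H).
Qed.

Lemma op_pos_inclusion w l i a ι :
  inclusion (f := fun b => Susp (Pos b)) (l := l) (a := a) i ι ->
  exists ι', inclusion (f := fun b => Susp (Pos b))
               (l := swap (w 0) (map (op_tree (pred_G w)) l))
               (a := op_tree (pred_G w) a) (if w 0 then length l - S i else i) ι' /\
    forall n y, op_pos w (br l) n (ι' n y) = ι n (op_factor w a n y).
Proof.
  intros H.
  destruct (@op_wedges_inclusion w tree tree (fun b => Susp (Pos b)) (fun b => Susp (Pos b))
    (op_tree (pred_G w)) (op_factor w) l i a ι H) as [ι' [H' E]].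
  exists ι'; split; [exact H'|]; intros n y; exact (f_equal (fun k : GMap _ _ => k n y) E).
Qed.

(** A position of [op_w (op_w' (br l))] whose image in [Pos (br l)] is the first
    basepoint is itself a basepoint, and basepoints are preserved up to exchange.
    Any other one comes from a factor of the wedge, and both sides send the
    inclusion of that factor to the inclusion of the same entry of [l], as the
    indices agree by [swap_index].  Within the factor, the claim is the exchange of [v_-] and
    [v_+] in dimension [0] and the induction hypothesis above. *)
Lemma op_pos_mul : forall B w w' n x,
  op_pos (mulG w w') B n (pos_cast (op_tree_mul B w w') n x) =
  op_pos w' B n (op_pos w (op_tree w' B) n x).
Proof.
  apply (tree_ind' (P := fun B => forall w w' n x,
    op_pos (mulG w w') B n (pos_cast (op_tree_mul B w w') n x) =
    op_pos w' B n (op_pos w (op_tree w' B) n x))).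
  intros l IH w w'.
  (* Case analysis is on the image [z] in [Pos (br l)], an explicit wedge. *)
  enough (H : forall n (z : Pos (br l) n), forall x,
    op_pos w' (br l) n (op_pos w (op_tree w' (br l)) n x) = z ->
    op_pos (mulG w w') (br l) n (pos_cast (op_tree_mul (br l) w w') n x) = z)
    by (intros n x; now apply H).
  apply (wedges_ind (f := fun b => Susp (Pos b))
    (Q := fun n z => forall x, op_pos w' (br l) n (op_pos w (op_tree w' (br l)) n x) = z ->
    op_pos (mulG w w') (br l) n (pos_cast (op_tree_mul (br l) w w') n x) = z)).
  - change (bminus (Wedges (fun b => Susp (Pos b)) l)) with (basepoint false (Pos (br l))).
    intros x Hx.
    assert (E : x = basepoint (xorb (w 0) (w' 0)) (Pos (op_tree w (op_tree w' (br l))))).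
    { apply op_pos_inj with (w := w), op_pos_inj with (w := w').
      rewrite Hx, (bmap_basepoint _ (op_pos w (op_tree w' (br l)))), basepoint_op.
      rewrite (bmap_basepoint _ (op_pos w' (br l))), basepoint_op.
      now destruct (w 0), (w' 0). }
    rewrite E, !bmap_basepoint, basepoint_op; simpl; unfold mulG.
    now destruct (w 0), (w' 0).
  - intros i a ι H n y x Hx.
    destruct (op_pos_inclusion w' H) as [ι1 [H1 E1]].
    destruct (op_pos_inclusion w H1) as [ι2 [H2 E2]].
    destruct (op_pos_inclusion (mulG w w') H) as [ι3 [H3 E3]].
    destruct (op_factor_surj (w := w') (b := a) y) as [y1 <-].
    destruct (op_factor_surj (w := w) (b := op_tree (pred_G w') a) y1) as [y2 <-].
    rewrite <- E1, <- E2 in Hx; apply op_pos_inj, op_pos_inj in Hx as ->.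
    rewrite length_swap, length_map in H2.
    pose proof (swap_index (w 0) (w' 0) (inclusion_lt H)) as Ei; rewrite Ei in H2.
    etransitivity;
      [exact (f_equal (op_pos (mulG w w') (br l) n) (pos_cast_inclusion (op_tree_mul (br l) w w')
         (op_tree_mul a (pred_G w) (pred_G w')) H2 H3 y2))|].
    etransitivity; [apply E3|]; apply (f_equal (ι n)).
    destruct n as [|n]; simpl.
    + unfold mulG; clear; now destruct (w 0), (w' 0), y2.
    + apply (IH a (inclusion_In H) (pred_G w) (pred_G w') n y2).
Qed.

(** * The action of G on computads *)

Lemma fill_mor_inv_filler w k (P : Stage k) (D : OpData w P) B (A : SphF P (FreeF P (Pos B))) :
  fmap (SphF P) (fill_mor_inv D B) (op_filler D A) = opSph D (FreeF P (Pos B)) A.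
Proof. now rewrite op_filler_eq, <- (fun_cmp (SphF P)), fill_mor_l, fun_id. Qed.

Section OpMul.
Context (w w' : G).

(** The comparison of [op_w op_w'] with [op_(ww')] in one dimension: what the
    construction in the next dimension uses. *)
Record OpMul k (P : Stage k) (D : OpData w P) (D' : OpData w' P)
    (D'' : OpData (mulG w w') P) := {
  mulF : opF D ∘F opF D' ⇒ opF D'';
  mulF_sph : forall c s,
    fmap (SphF P) (mulF c) (opSph D (opF D' c) (opSph D' c s)) = opSph D'' c s;
  mulF_free : forall X,
    opfree D'' X ∘
      fmap (FreeF P) (op_glob_mul w w' X : @Hom GLOB (op_Glob w (op_Glob w' X)) _) =
    mulF (FreeF P X) ∘ fmap (opF D) (opfree D' X) ∘ opfree D (op_Glob w' X)
}.

(** The index [B] of a coherence cell may be replaced by an equal tree, transporting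
    its other components along [pos_cast]. *)
Lemma rcoh_cast k (P : Stage k) (C : NComp P) B B' (e : B = B') A A' τ τ' τV τV' :
  fmap (SphF P) (fmap (FreeF P) (pos_cast e : @Hom GLOB _ _)) A = A' ->
  τ' ∘ fmap (FreeF P) (pos_cast e : @Hom GLOB _ _) = τ ->
  (forall p, τV p = τV' (pos_cast e k p)) ->
  @rcoh k P C B A τ τV = rcoh B' A' τ' τV'.
Proof.
  destruct e; simpl; intros HA Hτ HV.
  rewrite <- HA, <- Hτ.
  change (gid (Pos B)) with (@idm GLOB (Pos B)).
  rewrite fmap_id, fun_id, cmp_idr; f_equal.
  apply functional_extensionality; exact HV.
Qed.

Section Step.
Context k (P : Stage k) (D : OpData w P) (D' : OpData w' P) (D'' : OpData (mulG w w') P)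
  (L : OpLaws D) (L' : OpLaws D') (L'' : OpLaws D'') (M : OpMul D D' D'').

Definition op_tree_cast (B : tree) :
  @Hom GLOB (Pos (op_tree w (op_tree w' B))) (Pos (op_tree (mulG w w') B)) :=
  pos_cast (op_tree_mul B w w').

Lemma op_pos_mor_mul B :
  op_pos_mor (mulG w w') B ∘ op_tree_cast B =
  (op_glob_mul w w' (Pos B) : @Hom GLOB (op_Glob w (op_Glob w' (Pos B))) _) ∘
   (fmap (op_Glob w) (op_pos_mor w' B) ∘ op_pos_mor w (op_tree w' B)).
Proof. apply GMap_eq; intros n x; apply op_pos_mul. Qed.

(** [fill_mor_inv] is the identification [Free Pos (op_w B) → op_w (Free Pos B)]
    through which both the filler and the underlying morphism of the opposite of a
    coherence cell are defined; so this identity, which combines [op_pos_mul] with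
    [mulF_free], settles both ([op_filler_mul] and [op_low_mul]). *)
Lemma fill_mor_inv_mul B :
  fill_mor_inv D'' B ∘ fmap (FreeF P) (op_tree_cast B) =
  mulF M (FreeF P (Pos B)) ∘ (fmap (opF D) (fill_mor_inv D' B) ∘ fill_mor_inv D (op_tree w' B)).
Proof.
  unfold fill_mor_inv.
  etransitivity; [symmetry; apply cmpA|].
  etransitivity;
    [exact (whisker_l (opfree D'' (Pos B)) (fmap_square (FreeF P) (op_pos_mor_mul B)))|].
  rewrite !fmap_cmp, !cmpA.
  etransitivity; [do 2 apply (f_equal (fun z => z ∘ _)); apply (mulF_free M)|].
  apply (f_equal (fun z => z ∘ _)); rewrite <- !cmpA; do 2 apply f_equal.
  exact (ncomp_nat (opfree D) (op_pos_mor w' B)).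
Qed.

Lemma op_filler_mul B (A : SphF P (FreeF P (Pos B))) :
  fmap (SphF P) (fmap (FreeF P) (op_tree_cast B)) (op_filler D (op_filler D' A)) =
  op_filler D'' A.
Proof.
  rewrite (op_filler_eq D'' A), <- (mulF_sph M), <- (fill_mor_inv_filler D' A), <- opSph_nat,
    <- (fill_mor_inv_filler D (op_filler D' A)), <- !(fun_cmp (SphF P)), <- !cmpA.
  etransitivity;
    [|apply (f_equal (fun z => fmap (SphF P) (fill_mor D'' B ∘ z) _)), fill_mor_inv_mul].
  now rewrite cmpA, fill_mor_r, cmp_idl.
Qed.

Lemma op_low_mul (C : NComp P) B (τ : Hom (FreeF P (Pos B)) (low C)) :
  op_low D'' τ ∘ fmap (FreeF P) (op_tree_cast B) =
  mulF M (low C) ∘ op_low D (C := op_comp D' C) (op_low D' τ).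
Proof.
  rewrite !op_low_eq, <- cmpA, fill_mor_inv_mul, !cmpA, fmap_cmp, !cmpA.
  do 2 f_equal; symmetry; exact (ncomp_nat (mulF M) τ).
Qed.

Definition op_comp_mul (C : NComp P) : NMor (op_comp D (op_comp D' C)) (op_comp D'' C).
Proof.
  refine {| mlow := mulF M (low C) : Hom (low (op_comp D (op_comp D' C))) (low (op_comp D'' C));
            mgen := fun v : gen (op_comp D (op_comp D' C)) => var (v : gen (op_comp D'' C)) |}.
  abstract (intros v; symmetry; apply mulF_sph).
Defined.

Lemma op_raw_mul (C : NComp P) (r : raw C) :
  ract (op_comp_mul C) (op_raw D (op_raw D' r)) = op_raw D'' r.
Proof.
  induction r as [v|B A τ τV IH]; simpl; [reflexivity|].
  apply rcoh_cast with (e := op_tree_mul B w w').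
  - apply op_filler_mul.
  - apply op_low_mul.
  - intros p; rewrite IH; f_equal; f_equal; symmetry; apply op_pos_mul.
Qed.

Lemma op_cell_mul (C : NComp P) (a : cell C) :
  act (op_comp_mul C) (op_cell L (op_cell L' a)) = op_cell L'' a.
Proof. apply cell_eq, op_raw_mul. Qed.

Definition op_NF_mul : op_NF L ∘F op_NF L' ⇒ op_NF L''.
Proof.
  exists (op_comp_mul : forall C, Hom ((op_NF L ∘F op_NF L') C) (op_NF L'' C)).
  abstract (intros C E σ; apply NMor_eq;
    [exact (ncomp_nat (mulF M) (mlow σ)) | intros v; exact (op_raw_mul (proj1_sig (mgen σ v)))]).
Defined.

Definition OpMul_step : OpMul (op_step_data L) (op_step_data L') (op_step_data L'').
Proof.
  refine (@Build_OpMul _ (step P) (op_step_data L) (op_step_data L') (op_step_data L'')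
    op_NF_mul _ _).
  - abstract (intros C s; apply sphere_eq;
     [change (act (op_comp_mul C) (pr1 (op_sphere L (op_sphere L' s))) = pr1 (op_sphere L'' s))
     |change (act (op_comp_mul C) (pr2 (op_sphere L (op_sphere L' s))) = pr2 (op_sphere L'' s))];
     rewrite ?pr1_op, ?pr2_op, <- op_cell_mul; change (mulG w w' k) with (xorb (w k) (w' k));
     destruct (w k); rewrite ?pr1_op, ?pr2_op; now destruct (w' k)).
  - abstract (intros X; apply NMor_eq; [exact (mulF_free M X) | reflexivity]).
Defined.

End Step.

Definition OpMul_stage0 : OpMul (op_stage0_data w) (op_stage0_data w') (op_stage0_data (mulG w w')).
Proof.
  unshelve refine (@Build_OpMul 0 stage0 _ _ _ _ _ _); [|reflexivity..].
  exists (fun c => tt); reflexivity.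
Defined.

Fixpoint OpMul_stage k : OpMul (op_dat w k) (op_dat w' k) (op_dat (mulG w w') k) :=
  match k with
  | 0 => OpMul_stage0
  | S k => OpMul_step _ _ _ (OpMul_stage k)
  end.

End OpMul.

Lemma ncomp_eq_to_hom (A B C : Category) (F1 : Functor B C) (F2 : Functor A B) (F3 : Functor A C)
    (α : F1 ∘F F2 ⇒ F3) (x y : A) (e : x = y) :
  eq_to_hom (f_equal (fob F3) e) ∘ α x = α y ∘ eq_to_hom (f_equal (fob F1) (f_equal (fob F2) e)).
Proof. destruct e; exact (eq_trans (cmp_idl (α x)) (eq_sym (cmp_idr (α x)))). Qed.

Section CompMul.
Context (w w' : G).

Definition op_n_mul n : op_ w n ∘F op_ w' n ⇒ op_ (mulG w w') n :=
  op_NF_mul _ _ _ (OpMul_stage w w' n).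

Definition op_Comp_mul_mor (C : Computad) : CMor (op_ob w (op_ob w' C)) (op_ob (mulG w w') C).
Proof.
  exists (fun n => op_n_mul n (lev C n)).
  abstract (intros n; exact (ncomp_eq_to_hom (op_n_mul n) (lev_low C n))).
Defined.

Definition op_Comp_mul : op_Comp w ∘F op_Comp w' ⇒ op_Comp (mulG w w').
Proof.
  exists (op_Comp_mul_mor : forall C, Hom ((op_Comp w ∘F op_Comp w') C) (op_Comp (mulG w w') C)).
  abstract (intros C E σ; apply CMor_eq; intros n; exact (ncomp_nat (op_n_mul n) (clev σ n))).
Defined.

Lemma op_Cell_mul C :
  op_Cell (mulG w w') C ∘ op_Glob_mul w w' (Cell C) =
  fmap Cell (op_Comp_mul C) ∘ (op_Cell w (op_Comp w' C) ∘ fmap (op_Glob w) (op_Cell w' C)).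
Proof.
  apply GMap_eq; intros n a; symmetry; exact (op_cell_mul _ _ _ (OpMul_stage w w' n) a).
Qed.

Lemma op_Free_mul X :
  op_Free (mulG w w') X ∘ fmap Free (op_Glob_mul w w' X) =
  op_Comp_mul (Free X) ∘ (fmap (op_Comp w) (op_Free w' X) ∘ op_Free w (op_Glob w' X)).
Proof.
  apply CMor_eq; intros n.
  etransitivity; [exact (mulF_free (OpMul_stage w w' (S n)) X)|].
  symmetry; apply (cmpA (c := Comp_ n)).
Qed.

End CompMul.

(** * The monad morphism *)

Lemma op_T_spec w X : op_Cell w (Free X) ∘ op_T w X = fmap Cell (op_Free w X).
Proof.
  etransitivity; [apply cmpA|].
  etransitivity; [exact (whisker_r (fmap Cell (op_Free w X)) (inv_r (op_Cell_iso w (Free X))))|].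
  apply cmp_idl.
Qed.

Lemma op_T_mul w w' X :
  op_T (mulG w w') X ∘ fmap T (op_Glob_mul w w' X) =
  op_Glob_mul w w' (T X) ∘ (fmap (op_Glob w) (op_T w' X) ∘ op_T w (op_Glob w' X)).
Proof.
  exact (mate_composite (op_Cell_iso (mulG w w')) (op_T_spec w) (op_T_spec w')
    (op_T_spec (mulG w w')) (op_Cell_mul w w') (op_Free_mul w w') X).
Qed.

Lemma fmap_eq_to_hom_sym (C D : Category) (F : Functor C D) (x y : C) (e : x = y) :
  fmap F (eq_to_hom (eq_sym e)) = eq_to_hom (eq_sym (f_equal (fob F) e)).
Proof. destruct e; apply fmap_id. Qed.

(** Both sides send a generator of [Free (op_w (Cell C))], a cell of [C], to its
    opposite; by induction they agree in lower dimensions. *)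
Lemma op_counit w C :
  εC (op_Comp w C) ∘ fmap Free (op_Cell w C) = fmap (op_Comp w) (εC C) ∘ op_Free w (Cell C).
Proof.
  apply CMor_eq; intros n; simpl clev; induction n as [|n IH].
  - apply NMor_eq; [apply TermCat_eq | intros v; reflexivity].
  - apply NMor_eq; [|reflexivity].
    etransitivity; [symmetry; exact (cmpA (c := Comp_ n) _ _ _)|].
    etransitivity;
      [exact (whisker_l (C := Comp_ n) (eq_to_hom (eq_sym (lev_low (op_ob w C) n))) IH)|].
    etransitivity; [exact (cmpA (c := Comp_ n) _ _ _)|].
    apply (f_equal (fun z => cmp (c := Comp_ n) z (nopfree (proj2_sig (op_stage w n)) (Cell C)))).
    etransitivity; [|symmetry; apply (fmap_cmp (op_ w n))].
    apply (f_equal (fun z => cmp (c := Comp_ n) z (fmap (op_ w n) (clev (counit_mor C) n)))).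
    symmetry; apply fmap_eq_to_hom_sym.
Qed.

Lemma op_unit w X :
  fmap Cell (op_Free w X) ∘ adj_unit FreeCell (op_Glob w X) =
  op_Cell w (Free X) ∘ fmap (op_Glob w) (adj_unit FreeCell X).
Proof. apply GMap_eq; intros n x; now apply cell_eq. Qed.

Lemma op_monad_morphism w : monad_morphism (op_T w).
Proof.
  exact (mate_monad_morphism (op_Cell_iso w) (op_T_spec w) (op_unit w) (op_counit w)).
Qed.

Lemma op_T_iso w X : is_iso (op_T w X).
Proof.
  apply (is_iso_cmp (g := inv (op_Cell_iso w (Free X))) (f := fmap Cell (op_Free w X))).
  - exact (is_iso_inv (op_Cell_iso w (Free X))).
  - apply (is_iso_fmap Cell (f := op_Free w X)).
    destruct (op_Free_identity w X) as [e ->]; apply is_iso_eq_to_hom.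
Qed.

(** Write [1] for [one_G], [ψ] for [op_T 1] and [i] for the identification
    [op_1 ⇒ id].  Since [1 * 1 = 1], [op_T_mul] gives
    [ψ_X ∘ T (op_1 i_X) = ψ_X ∘ i_(T (op_1 X)) ∘ ψ_(op_1 X)]; the leading [ψ_X]
    cancels, which leaves the claim for [op_1 X], and naturality along the
    isomorphism [i_X : op_1 X → X] transfers it to [X]. *)
Lemma op_T_one X : op_Glob_one (T X) ∘ op_T one_G X = fmap T (op_Glob_one X).
Proof.
  pose (i := fun Y => op_Glob_one Y : @Hom GLOB (op_Glob one_G Y) Y).
  change (i (T X) ∘ op_T one_G X = fmap T (i X)).
  assert (Hi : forall Y, is_iso (i Y)).
  { intros Y; destruct (op_glob_one_eq Y) as [e E];
    exact (eq_ind_r (@is_iso GLOB _ _) (is_iso_eq_to_hom e) E). }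
  assert (Eo : i (T (op_Glob one_G X)) ∘ op_T one_G (op_Glob one_G X) =
               fmap T (fmap (op_Glob one_G) (i X))).
  { apply (iso_cancel_l (op_T_iso one_G X)); symmetry.
    (* [op_Glob_mul 1 1 X] and [op_1 i_X] are both the identity on cells. *)
    assert (E : op_Glob_mul one_G one_G X = fmap (op_Glob one_G) (i X)) by now apply GMap_eq.
    rewrite <- E; etransitivity; [exact (op_T_mul one_G one_G X)|].
    now apply GMap_eq. }
  apply (iso_cancel_r (f := fmap T (fmap (op_Glob one_G) (i X)))).
  { now do 2 apply is_iso_fmap. }
  etransitivity; [symmetry; apply cmpA|].
  etransitivity; [exact (whisker_l (i (T X)) (ncomp_nat (op_T one_G) (i X)))|].
  etransitivity; [|exact (whisker_l (fmap T (i X)) Eo)].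
  now apply GMap_eq.
Qed.

(** * Opposites of ω-categories *)

Definition op_ω w : Functor ωCat ωCat := induced (op_monad_morphism w).

Lemma op_ω_mul w w' : op_ω w ∘F op_ω w' = op_ω (mulG w w').
Proof.
  apply (@algebra_functor_eq GLOB ωCat T (op_ω w ∘F op_ω w') (op_ω (mulG w w'))
    (fun X : ωCat => op_Glob_mul w w' (acar X))).
  - intros X; apply op_glob_mul_eq.
  - intros X; symmetry.
    etransitivity;
      [symmetry; exact (cmpA (c := GLOB) (fmap (op_Glob (mulG w w')) (astr X)) _ _)|].
    etransitivity; [exact (whisker_l _ (op_T_mul w w' (acar X)))|].
    etransitivity; [apply cmpA|].
    etransitivity; [exact (whisker_r _ (eq_sym (ncomp_nat (op_Glob_mul w w') (astr X))))|].
    etransitivity; [symmetry; apply cmpA|]; apply whisker_l.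
    etransitivity; [apply cmpA|]; apply whisker_r.
    symmetry; apply (fmap_cmp (op_Glob w)).
  - intros X Y f; exact (ncomp_nat (op_Glob_mul w w') (ahom f)).
Qed.

Lemma op_ω_one : op_ω one_G = idF ωCat.
Proof.
  apply (@algebra_functor_eq GLOB ωCat T (op_ω one_G) (idF ωCat)
    (fun X : ωCat => op_Glob_one (acar X))).
  - intros X; apply op_glob_one_eq.
  - intros X.
    etransitivity; [apply cmpA|].
    etransitivity; [exact (whisker_r _ (ncomp_nat op_Glob_one (astr X)))|].
    etransitivity; [symmetry; apply cmpA|].
    exact (whisker_l (astr X) (op_T_one (acar X))).
  - intros X Y f; exact (ncomp_nat op_Glob_one (ahom f)).
Qed.

Lemma op_ω_invol w : op_ω w ∘F op_ω w = idF ωCat.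
Proof.
  rewrite op_ω_mul, <- op_ω_one; f_equal.
  apply functional_extensionality; intros n; apply xorb_nilpotent.
Qed.

Definition op_ω_aut (w : G) : Automorphism ωCat :=
  {| aut_fun := op_ω w; aut_inv := op_ω w;
     aut_invl := op_ω_invol w; aut_invr := op_ω_invol w |}.

Definition op_K w : op_ω w ∘F K ⇒ K ∘F op_Comp w :=
  comparison_mate (op_T_spec w) (op_counit w) (op_monad_morphism w).

Lemma op_K_iso w : is_nat_iso (op_K w).
Proof.
  exact (comparison_mate_iso (op_Cell_iso w) (op_T_spec w) (op_counit w) (op_monad_morphism w)).
Qed.

Lemma op_free_on w X C : free_on X C -> free_on (op_ω w X) (op_Comp w C).
Proof.
  intros [f Hf]; exists (op_K w C ∘ fmap (op_ω w) f).
  exact (is_iso_cmp (op_K_iso w C) (is_iso_fmap (op_ω w) Hf)).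
Qed.

Theorem mainTheorem4 :
  exists mm : forall w : G_group, monad_morphism (op_T w),
    (exists h : G_group -> Aut ωCat,
        is_group_hom h /\ forall w, aut_fun (h w) = induced (mm w)) /\
    (forall w : G_group,
        exists op_K : induced (mm w) ∘F K ⇒ K ∘F op_Comp w,
          is_nat_iso op_K /\ forall C : COMP, ahom (op_K C) = op_Cell w C) /\
    (forall (w : G_group) (X : ωCat) (C : COMP),
        free_on X C -> free_on (induced (mm w) X) (op_Comp w C)).
Proof.
  exists op_monad_morphism; split; [|split].
  - exists op_ω_aut; split; [|reflexivity].
    intros w w'; apply Automorphism_eq; symmetry; exact (op_ω_mul w w').
  - intros w; exists (op_K w); split; [apply op_K_iso | reflexivity].
  - exact op_free_on.
Qed.
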